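(* Let $0<\alpha<1$ and $\theta>-\alpha$, and let $M_n=\max\{X_1,\dots,X_n\}$ be the maximum of a size $n$ $\mathsf{GEM}(\alpha,\theta)$ exchangeable sample. Then for each $x>0$, $$\mathbb{P}\bigl[M_n\le x\,n^{\alpha/(1-\alpha)}\bigr]\to\mathbb{E}\exp\bigl(-\alpha D_{\alpha,\theta}^{1/\alpha}\,x^{-(1-\alpha)/\alpha}\bigr)\quad\text{as } n\to\infty,$$ where $D_{\alpha,\theta}$ is a positive random variable whose distribution is determined by its moments $$\mathbb{E} D_{\alpha,\theta}^p=\frac{\Gamma(\theta+1)}{\Gamma(\tfrac{\theta}{\alpha}+1)}\,\frac{\Gamma(p+\tfrac{\theta}{\alpha}+1)}{\Gamma(p\alpha+\theta+1)},\qquad p>0.$$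
   Context: $\mathbb{N}=\{1,2,\dots\}$. The $\mathsf{GEM}(\alpha,\theta)$ exchangeable sample ($0\le\alpha<1$, $\theta>-\alpha$): let $H_1,H_2,\dots$ be independent random variables, $H_i$ having the beta$(1-\alpha,\theta+i\alpha)$ distribution, i.e. density $\frac{1}{B(1-\alpha,\theta+i\alpha)}x^{-\alpha}(1-x)^{\theta+i\alpha-1}$ on $[0,1]$, where $B$ is Euler's beta function. Put $Y_k=1-\prod_{i=1}^k(1-H_i)$ for $k\in\mathbb{N}$; then $Y_k\uparrow1$ a.s. Given $\mathbf{Y}=(Y_k)_{k\ge1}$, let $X_1,X_2,\dots$ be i.i.d. with values in $\mathbb{N}$ and $\mathbb{P}[X_1\le k\mid\mathbf{Y}]=Y_k$ for all $k\in\mathbb{N}$. The (unconditional) law of $(X_1,X_2,\dots)$ is the $\mathsf{GEM}(\alpha,\theta)$ exchangeable distribution and $(X_1,\dots,X_n)$ is a size $n$ $\mathsf{GEM}(\alpha,\theta)$ exchangeable sample. The variable $D_{\alpha,\theta}$ is the $\alpha$-diversity: $D_{\alpha,\theta}=\lim_{n\to\infty}K_n/n^\alpha$ a.s., where $K_n$ is the number of distinct values among $X_1,\dots,X_n$. It is a known fact that this limit exists a.s., is positive, and has the stated moments, which determine its distribution. *)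

(* Defs.v *)
From HB Require Import structures.
From mathcomp Require Import all_boot all_order all_algebra finmap.
From mathcomp Require Import all_classical all_reals all_analysis.

Set Implicit Arguments.
Unset Strict Implicit.
Unset Printing Implicit Defensive.

Import Order.TTheory GRing.Theory Num.Theory.
Import numFieldNormedType.Exports.

Local Open Scope classical_set_scope.
Local Open Scope ring_scope.

Definition Gamma_fun (R : realType) (s : R) : R :=
  \int[lebesgue_measure]_(x in `]0, +oo[) (x `^ (s - 1) * expR (- x)).

(* The library's [beta_fun], [beta_pdf] only cover natural parameters. *)
Definition Beta_fun (R : realType) (a b : R) : R :=
  \int[lebesgue_measure]_(x in `[0, 1]) (x `^ (a - 1) * (1 - x) `^ (b - 1)).

Definition Beta_pdf (R : realType) (a b : R) : R -> R :=
  (fun x => x `^ (a - 1) * (1 - x) `^ (b - 1) / Beta_fun a b) \_ `[0, 1].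

Definition determined_by_moments (R : realType) (mu : probability R R) : Prop :=
  forall nu : probability R R, nu [set x | 0 < x] = 1%E ->
    (forall p : R, 0 < p ->
      (\int[nu]_x (x `^ p)%:E = \int[mu]_x (x `^ p)%:E)%E) ->
    forall A : set R, measurable A -> nu A = mu A.

Section random_variables.
Context d (T : measurableType d) (R : realType) (P : probability T R).

Definition has_pdf (X : {RV P >-> R}) (f : R -> R) : Prop :=
  forall A : set R, measurable A ->
    P (X @^-1` A) = (\int[lebesgue_measure]_(x in A) (f x)%:E)%E.

Definition mutually_independent (X : nat -> {RV P >-> R}) : Prop :=
  forall (J : {fset nat}) (A : nat -> set R), (forall i, measurable (A i)) ->
    P (\bigcap_(i in [set` J]) (X i @^-1` A i)) =
    (\prod_(i <- J) fine (P (X i @^-1` A i)))%:E.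

Definition sigma_seq (Y : nat -> T -> R) : set (set T) :=
  <<s \bigcup_k preimage_set_system setT (Y k) measurable >>.

(* [f] is a version of the conditional probability of [E] given the
   sub-sigma-algebra [G]. *)
Definition is_cond_prob (G : set (set T)) (E : set T) (f : T -> R) : Prop :=
  [/\ forall B : set R, measurable B -> G (f @^-1` B),
      P.-integrable setT (EFin \o f) &
      forall B, G B -> (\int[P]_(w in B) (f w)%:E)%E = P (E `&` B)].

Definition cond_independent (G : set (set T)) (X : nat -> {RV P >-> nat}) : Prop :=
  forall (J : {fset nat}) (A : nat -> set nat) (f : nat -> T -> R),
    (forall j, j \in J -> is_cond_prob G (X j @^-1` A j) (f j)) ->
    is_cond_prob G (\bigcap_(j in [set` J]) (X j @^-1` A j))
                   (fun w => \prod_(j <- J) f j w).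

End random_variables.

Arguments has_pdf {d T R} P X f.
Arguments mutually_independent {d T R} P X.
Arguments cond_independent {d T R} P G X.

Section GEM.
Context d (T : measurableType d) (R : realType) (P : probability T R).

Definition stick (H : nat -> T -> R) (k : nat) (w : T) : R :=
  1 - \prod_(i < k) (1 - H i w).

(* Indices are shifted: [H i] and [X j] are the usual H_{i+1} and X_{j+1},
   whereas [stick H k] is Y_k (with Y_0 = 0). The values of the X_j are not
   shifted: they range over {1, 2, ...}. *)
Definition GEM_sample (alpha theta : R) (H : nat -> {RV P >-> R})
    (X : nat -> {RV P >-> nat}) : Prop :=
  [/\ mutually_independent P H,
      forall i, has_pdf P (H i) (Beta_pdf (1 - alpha) (theta + i.+1%:R * alpha)),
      forall j w, (0 < X j w)%N,
      forall j k, is_cond_prob P (sigma_seq (stick H))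
                    [set w | (X j w <= k)%N] (stick H k) &
      cond_independent P (sigma_seq (stick H)) X].

Definition sample_max (X : nat -> T -> nat) (n : nat) (w : T) : nat :=
  \max_(j < n) X j w.

Definition num_distinct (X : nat -> T -> nat) (n : nat) (w : T) : nat :=
  size (undup (mkseq (fun j => X j w) n)).

Definition alpha_diversity (alpha : R) (X : nat -> {RV P >-> nat})
    (D : {RV P >-> R}) : Prop :=
  {ae P, forall w,
    (num_distinct X n w)%:R / n%:R `^ alpha @[n --> \oo] --> D w}.

End GEM.

Arguments GEM_sample {d T R} P alpha theta H X.
Arguments alpha_diversity {d T R} P alpha X D.

(* Main.v *)
Require Import Defs.
From HB Require Import structures.
From mathcomp Require Import all_boot all_order all_algebra finmap.
From mathcomp Require Import all_classical all_reals all_analysis.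
From mathcomp Require Import measurable_realfun ring lra.

Set Implicit Arguments.
Unset Strict Implicit.
Unset Printing Implicit Defensive.

Import Order.TTheory GRing.Theory Num.Theory.
Import numFieldNormedType.Exports.

Local Open Scope classical_set_scope.
Local Open Scope ring_scope.

(** Everything is read off the rests V_k = (1 - H_1) ... (1 - H_k), the mass of the
    values larger than k. The rests are products of independent Beta variables, so
    their moments are products of Beta quotients; by the identity between Beta and
    Gamma functions (Beta_Gamma, a consequence of the Bohr-Mollerup theorem) these
    products telescope. Hence the moments of
      D_k = V_k `^ alpha * k `^ (1 - alpha) * alpha `^ (- alpha)
    converge to those stated for the diversity (cvg_approx_div_moment). Divided by
    its mean, D_k is a martingale with summable increments in mean square, so D_k
    converges almost surely (approx_div_ae_cvg). The limit D has the stated moments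
    (diversity_momentE) and is positive, as its moments of small order tend to 1
    (diversity_gt0).

    The maximum. Given the sticks the sample is independent and identically
    distributed, so P (M_n <= k) = E (1 - V_k) ^ n (sample_max_law). For k close to
    x n `^ (alpha / (1 - alpha)) the convergence D_k -> D says that n V_k tends to
    alpha D `^ (1 / alpha) x `^ (- (1 - alpha) / alpha), and bounded convergence gives
    the limit law (sample_max_cvg).

    The number of distinct values. It remains to see that D is the diversity of the
    sample, that is K_n / n `^ alpha -> D (num_distinct_ae_cvg). Given the sticks,
    distinct values are missed in a negatively correlated way, so K_n is within
    O (n `^ (alpha / 2)) of its conditional expectation in mean square
    (hit_count_variance). That expectation is replaced by its projection on the first
    k sticks, which is explicit because the values appear in size-biased order: the
    hits among the first i values plus an explicit function g of the remaining mass V_i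
    (hits_left) form a martingale in i (hits_mart_orth), with increments bounded by n V_i U_i
    (hits_mart_increment). Taking n and k along suitable powers, k being much smaller
    than n `^ alpha, all the errors are summable (num_distinct_error,
    subsequence_exponents), while g n k (V_k) / n `^ alpha has the same limit as D_k
    (hits_left_cvg). Monotonicity of K_n fills in the other n.

    Determinacy. The moments of D grow like a power less than 1 of the factorials, so
    the Taylor polynomials of the exponential converge in mean and the moments
    determine the Laplace transform (laplace_unique). Its values at the integers are
    the moments of exp (- D), which has values in [0, 1]; Bernstein polynomials then
    give the law (laplace_determines). *)

(** * Integrals over open intervals and real powers *)

Section exhaustion.
Context d (T : measurableType d) (R : realType) (mu : {measure set T -> \bar R}).

(** Monotone convergence for real-valued integrals: for a nonnegative function,
    bounded integrals over an exhaustion give both integrability on the union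
    and convergence of the truncated integrals. *)
Lemma Rintegral_exhaustion (D : set T) (F : (set T)^nat) (f : T -> R) (C : R) :
  nondecreasing_seq F -> (forall n, measurable (F n)) -> \bigcup_n F n = D ->
  (forall x, D x -> 0 <= f x) ->
  (forall n, mu.-integrable (F n) (EFin \o f)) ->
  (forall n, \int[mu]_(x in F n) f x <= C) ->
  mu.-integrable D (EFin \o f) /\
  \int[mu]_(x in F n) f x @[n --> \oo] --> \int[mu]_(x in D) f x.
Proof.
move=> ndF mF FD f0 iF FC.
have FinD n x : F n x -> D x by move=> Fx; rewrite -FD; exists n.
have mfD : measurable_fun D f.
  rewrite -FD; apply/measurable_fun_bigcup => // n.
  by apply/measurable_EFinP; exact: measurable_int (iF n).
have H := @ge0_nondecreasing_set_cvg_integral _ _ _ F (EFin \o f) mu ndF mF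
  (fun n => measurable_int _ (iF n))
  (fun n x Fx => f0 x (FinD n x Fx)).
have E n : (\int[mu]_(x in F n) (f x)%:E = (\int[mu]_(x in F n) f x)%:E)%E.
  by rewrite /Rintegral fineK//; exact: integrable_fin_num.
have intlt : (\int[mu]_(x in D) (f x)%:E <= C%:E)%E.
  rewrite -FD -(cvg_lim _ H)//; apply: lime_le.
    by apply/cvg_ex; exists (\int[mu]_(x in \bigcup_i F i) (f x)%:E)%E.
  by apply: nearW => n; rewrite E lee_fin.
have iD : mu.-integrable D (EFin \o f).
  apply/integrableP; split; first exact/measurable_EFinP.
  apply: le_lt_trans (ltry C).
  rewrite (eq_integral (fun x => (f x)%:E))// => x.
  by rewrite inE => Dx; rewrite /= ger0_norm// f0.
split => //.
rewrite FD in H.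
have mD : measurable D by rewrite -FD; exact: bigcup_measurable.
have ED : (\int[mu]_(x in D) (f x)%:E = (\int[mu]_(x in D) f x)%:E)%E.
  by rewrite /Rintegral fineK//; exact: integrable_fin_num.
have -> : (fun n => \int[mu]_(x in F n) f x) =
   fine \o (fun n => \int[mu]_(x in F n) (f x)%:E)%E by [].
by apply: fine_cvg; rewrite -ED.
Qed.

Lemma integrable_ZR (D : set T) (k : R) (f : T -> R) : measurable D ->
  mu.-integrable D (EFin \o f) -> mu.-integrable D (EFin \o (fun x => k * f x)).
Proof. by move=> mD /(integrableZl mD k). Qed.

Lemma integrable_DR (D : set T) (f g : T -> R) : measurable D ->
  mu.-integrable D (EFin \o f) -> mu.-integrable D (EFin \o g) ->
  mu.-integrable D (EFin \o (fun x => f x + g x)).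
Proof. by move=> mD hf hg; exact: (integrableD mD hf hg). Qed.

End exhaustion.

Section real_prelim.
Context {R : realType}.
Notation mu := (@lebesgue_measure R).

Lemma segment_integrable (f : R -> R) a b :
  (forall x, a <= x <= b -> {for x, continuous f}) ->
  mu.-integrable `[a, b] (EFin \o f).
Proof.
move=> cf; apply: continuous_compact_integrable; first exact: segment_compact.
apply: continuous_in_subspaceT => x; rewrite inE/= in_itv/=; exact: cf.
Qed.

Lemma FTC2_segment (f F : R -> R) (a b : R) : a < b ->
  (forall x, a <= x <= b -> is_derive x 1 F (f x)) ->
  (forall x, a <= x <= b -> {for x, continuous f}) ->
  \int[mu]_(x in `[a, b]) f x = F b - F a.
Proof.
move=> ab dF cf.
have cF x : a <= x <= b -> {for x, continuous F}.
  move=> /dF dFx; apply: differentiable_continuous; apply/derivable1_diffP.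
  exact: ex_derive.
rewrite /Rintegral (@continuous_FTC2 _ f F)//.
- apply: continuous_in_subspaceT => x; rewrite inE/= in_itv/=; exact: cf.
- split.
  + move=> x; rewrite in_itv/= => /andP[ax xb].
    by apply: ex_derive; apply: dF; rewrite !ltW.
  + by apply: cvg_at_right_filter; apply: cF; rewrite lexx ltW.
  + by apply: cvg_at_left_filter; apply: cF; rewrite lexx ltW.
- move=> x; rewrite in_itv/= => /andP[ax xb].
  by rewrite derive1E; apply: derive_val; apply: dF; rewrite !ltW.
Qed.

Lemma powRDp (x r s : R) : 0 < x -> x `^ (r + s) = x `^ r * x `^ s.
Proof. by move=> x0; rewrite powRD// (lt0r_neq0 x0) implybT. Qed.

Lemma powRBp (x r s : R) : 0 < x -> x `^ (r - s) = x `^ r / x `^ s.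
Proof. by move=> x0; rewrite powRB// (lt0r_neq0 x0) implybT. Qed.

Lemma powRB1 (x s : R) : 0 < x -> x `^ (s - 1) = x `^ s / x.
Proof. by move=> x0; rewrite powRBp// powRr1// ltW. Qed.

Lemma powRD1 (x s : R) : 0 < x -> x `^ (s + 1) = x `^ s * x.
Proof. by move=> x0; rewrite powRDp// powRr1// ltW. Qed.

(** Concavity of x |-> x `^ s: its graph lies below the tangent at l. Log-convexity
    of the Gamma and Beta integrals is obtained by integrating this bound and
    optimising over l afterwards, which replaces Holder's inequality by linearity
    and monotonicity of the integral. *)
Lemma powR_tangent (x l s : R) : 0 < x -> 0 < l -> 0 <= s <= 1 ->
  x `^ s <= s * x * l `^ (s - 1) + (1 - s) * l `^ s.
Proof.
move=> x0 l0 /andP[s0 s1].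
have [->|s0'] := eqVneq s 0; first by rewrite !powRr0 mul0r mul0r add0r subr0 mulr1.
have [->|s1'] := eqVneq s 1.
  by rewrite subrr powRr0 !(powRr1 (ltW x0)) mul0r addr0 mulr1 mul1r lexx.
have sp : 0 < s by rewrite lt_neqAle eq_sym s0'.
have xl : 0 <= x / l by rewrite divr_ge0// ltW.
have sp1 : 0 < 1 - s by rewrite subr_gt0 lt_neqAle s1'.
have := @conjugate_powR _ ((x / l) `^ s) 1 s^-1 (1 - s)^-1 (powR_ge0 _ _) ler01.
rewrite !invr_gt0 !invrK subrKC => /(_ sp sp1 erefl).
rewrite mulr1 powR1 mul1r -powRrM mulfV// (powRr1 xl) => H.
have -> : x `^ s = (x / l) `^ s * l `^ s.
  by rewrite -powRM ?divr_ge0 ?ltW// divfK// gt_eqF.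
apply: le_trans (ler_wpM2r (powR_ge0 _ _) H) _.
rewrite (powRB1 _ l0) mulrDl le_eqVlt; apply/orP; left.
by apply/eqP; field; rewrite gt_eqF.
Qed.

Lemma powR_continuous (p x : R) : 0 < x -> {for x, continuous (fun y : R => y `^ p)}.
Proof.
move=> x0; apply: differentiable_continuous; apply/derivable1_diffP.
by apply: ex_derive; exact: is_derive1_powR.
Qed.

Lemma powRVp (x s : R) : 0 < x -> x^-1 `^ s = (x `^ s)^-1.
Proof. by move=> x0; rewrite -powR_inv1 ?ltW// -powRrM mulN1r powRN. Qed.

Lemma powR_le1 (x s : R) : 0 <= x <= 1 -> 0 <= s -> x `^ s <= 1.
Proof.
move=> /andP[x0 x1] s0.
have -> : 1 = 1 `^ s :> R by rewrite powR1.
by rewrite ge0_ler_powR ?nnegrE ?ler01.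
Qed.

Lemma powR_natSinv_cvg0 (k : nat) (s : R) : 0 < s ->
  (n + k).+1%:R^-1 `^ s @[n --> \oo] --> (0 : R).
Proof.
move=> s0.
suff H : n.+1%:R^-1 `^ s @[n --> \oo] --> (0 : R).
  by move: H; rewrite -(cvg_shiftn k).
apply/cvgrPdist_le => e e0; near=> n.
rewrite sub0r normrN ger0_norm ?powR_ge0//.
have -> : e = (e `^ s^-1) `^ s by rewrite -powRrM mulVf ?gt_eqF// powRr1// ltW.
rewrite ge0_ler_powR ?nnegrE ?invr_ge0 ?powR_ge0 ?ltW//.
near: n; apply: (near_infty_natSinv_lt (PosNum (powR_gt0 s^-1 e0))).
Unshelve. all: by end_near. Qed.

Lemma powR_le_pow (x s : R) (m : nat) : 0 <= x -> 0 < s -> s <= m%:R -> x `^ s <= 1 + x ^+ m.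
Proof.
move=> x0 s0 sm; have [x1|x1] := leP x 1.
  apply: (@le_trans _ _ 1); last by rewrite lerDl exprn_ge0.
  by rewrite powR_le1 ?x0 ?x1 ?ltW.
rewrite -powR_mulrn// ; apply: (@le_trans _ _ (x `^ m%:R)).
  by apply: ler_powR => //; exact: ltW.
by rewrite lerDr.
Qed.

End real_prelim.

(** * The Gamma integral *)

Section gamma.
Context {R : realType}.
Notation mu := (@lebesgue_measure R).
Notation Gamma := (@Gamma_fun R).

Let G (s x : R) := x `^ (s - 1) * expR (- x).
Let I (n : nat) : set R := `[n.+1%:R^-1, n.+1%:R].

Let IP n x : I n x -> 0 < x.
Proof. by rewrite /I/= in_itv/= => /andP[h _]; apply: lt_le_trans h; rewrite invr_gt0. Qed.

Let mI n : measurable (I n).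
Proof. exact: measurable_itv. Qed.

Let G_ge0 s x : 0 <= G s x.
Proof. by rewrite mulr_ge0 ?powR_ge0 ?expR_ge0. Qed.

Let cG (s x : R) : 0 < x -> {for x, continuous (G s)}.
Proof.
move=> x0; apply: continuousM; first exact: powR_continuous.
apply: continuous_comp; first exact: opp_continuous.
exact: continuous_expR.
Qed.

Let iG s n : mu.-integrable (I n) (EFin \o G s).
Proof.
apply: segment_integrable => x /andP[h _]; apply: cG.
by apply: lt_le_trans h; rewrite invr_gt0.
Qed.

Let F (s x : R) := x `^ s * expR (- x).

Let Gamma_by_parts s n : s * \int[mu]_(x in I n) G s x =
  \int[mu]_(x in I n) G (s + 1) x + (F s n.+1%:R - F s n.+1%:R^-1).
Proof.
have [->|n0] := eqVneq n 0%N.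
  rewrite /I invr1 subrr addr0 set_itv1 !Rintegral_set1 mulr0//.
have nlt : n.+1%:R^-1 < n.+1%:R :> R.
  apply: (@lt_trans _ _ 1); first by rewrite invf_lt1// ltr1n ltnS lt0n.
  by rewrite ltr1n ltnS lt0n.
have : \int[mu]_(x in I n) (s * G s x - G (s + 1) x) = F s n.+1%:R - F s n.+1%:R^-1.
  apply: FTC2_segment => // x /andP[h _].
    have x0 : 0 < x by apply: lt_le_trans h; rewrite invr_gt0.
    have H1 : is_derive x (1:R) (fun y : R => y `^ s) (s * x `^ (s - 1)).
      exact: is_derive1_powR.
    apply: is_derive_eq.
    rewrite /G addrK /GRing.scale/=; ring.
  have x0 : 0 < x by apply: lt_le_trans h; rewrite invr_gt0.
  apply: continuousB; last exact: cG.
  by apply: continuousM; [exact: cst_continuous|exact: cG].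
rewrite (@RintegralB _ _ _ mu _ _ _ (mI n) (@integrable_ZR _ _ _ mu _ s _ (mI n) (iG s n)) (iG (s + 1) n)).
rewrite (@RintegralZl _ _ _ mu _ _ s (mI n) (iG s n)).
by move=> <-; rewrite addrC subrK.
Qed.

Let ndI : nondecreasing_seq I.
Proof.
move=> m n mn; rewrite subsetEset => x; rewrite /I/= !in_itv/= => /andP[h1 h2].
rewrite (le_trans _ h1) ?(le_trans h2) ?ler_nat//.
by rewrite lef_pV2 ?posrE// ler_nat.
Qed.

Let bigI : \bigcup_n I n = `]0, +oo[%classic.
Proof.
apply/seteqP; split => [x [n _ /IP]|x] /=; rewrite in_itv/= andbT// => x0.
exists (maxn (Num.truncn x) (Num.truncn x^-1)) => //; rewrite /I/= in_itv/=.
apply/andP; split; last first.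
  by rewrite (le_trans (ltW (truncnS_gt _)))// ler_nat ltnS leq_maxl.
rewrite invf_ple ?posrE//.
by rewrite (le_trans (ltW (truncnS_gt _)))// ler_nat ltnS leq_maxr.
Qed.

(** Integrability over an unbounded interval is reduced to a bound that is
    uniform over the compact truncations; such a bound travels along integration
    by parts, in both directions between s and s + 1. *)
Let trunc_bounded (s : R) := exists C : R, forall n, \int[mu]_(x in I n) G s x <= C.

Let trunc_boundedP s : trunc_bounded s -> mu.-integrable `]0, +oo[ (EFin \o G s) /\
  \int[mu]_(x in I n) G s x @[n --> \oo] --> Gamma s.
Proof.
move=> [C hC].
apply: (@Rintegral_exhaustion _ _ _ mu _ _ _ _ ndI mI bigI (fun x _ => G_ge0 s x) (iG s) hC).
Qed.

Let F_ge0 s x : 0 <= F s x.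
Proof. by rewrite mulr_ge0 ?powR_ge0 ?expR_ge0. Qed.

Let trunc_bounded_up (s : R) : 0 < s -> trunc_bounded s -> trunc_bounded (s + 1).
Proof.
move=> s0 [C hC]; exists (s * C + 1) => n.
have : \int[mu]_(x in I n) G (s + 1) x <= s * \int[mu]_(x in I n) G s x + F s n.+1%:R^-1.
  by rewrite Gamma_by_parts; have := F_ge0 s n.+1%:R; lra.
move/le_trans; apply; apply: lerD; first by rewrite ler_pM2l.
rewrite /F; apply: mulr_ile1; rewrite ?powR_ge0 ?expR_ge0//.
  apply: powR_le1; last exact: ltW.
by rewrite invr_ge0 ler0n/= invf_ple ?posrE// invr1 ler1n.
Qed.

Let trunc_bounded1 : trunc_bounded 1.
Proof.
exists 1 => n; have [->|n0] := eqVneq n 0%N.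
  by rewrite /I invr1 set_itv1 !Rintegral_set1.
have nlt : n.+1%:R^-1 < n.+1%:R :> R.
  apply: (@lt_trans _ _ 1); first by rewrite invf_lt1// ltr1n ltnS lt0n.
  by rewrite ltr1n ltnS lt0n.
pose E x : R := - expR (- x).
have -> : \int[mu]_(x in I n) G 1 x = E n.+1%:R - E n.+1%:R^-1.
  apply: (@FTC2_segment _ (G 1) E _ _ nlt) => x /andP[h _].
    by apply: is_derive_eq; rewrite /G subrr powRr0 /GRing.scale/=; ring.
  by apply: cG; apply: lt_le_trans h; rewrite invr_gt0.
have h1 : expR (- n.+1%:R^-1) <= 1 :> R by rewrite -expR0 ler_expR oppr_le0 invr_ge0.
have h2 := expR_gt0 (- n.+1%:R : R).
by rewrite /E opprK; lra.
Qed.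

Let trunc_bounded_nat m : trunc_bounded m.+1%:R.
Proof.
elim: m => [|m ih]; first exact: trunc_bounded1.
by rewrite -natr1; apply: trunc_bounded_up.
Qed.

Let F_bound (s : R) : 0 < s -> exists C, forall x : R, 0 < x -> F s x <= C.
Proof.
move=> s0; pose m := (Num.truncn s).+1.
exists (1 + m`!%:R) => x x0.
have h : x `^ s <= 1 + x ^+ m by exact: (powR_le_pow (ltW x0) s0 (ltW (truncnS_gt s))).
have h1 : x ^+ m <= m`!%:R * expR x.
  have fp : 0 < (m`!%:R : R) by rewrite ltr0n fact_gt0.
  rewrite -ler_pdivrMl// mulrC.
  apply: le_trans (@expR_ge1Dxn R x (Num.truncn s) (ltW x0)).
  by rewrite lerDr ler01.
rewrite /F expRN ler_pdivrMr ?expR_gt0//; apply: (le_trans h).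
rewrite mulrDl mul1r; apply: lerD h1.
by rewrite -expR0 ler_expR ltW.
Qed.

Let trunc_bounded_all (s : R) : 0 < s -> trunc_bounded s.
Proof.
move=> s0.
have [C1 h1] : trunc_bounded (s + 1).
  have [C1 h1] := trunc_bounded_nat 0; have [C2 h2] := trunc_bounded_nat (Num.truncn s).+1.
  exists (C1 + C2) => n.
  apply: le_trans (lerD (h1 n) (h2 n)).
  rewrite -(@RintegralD _ _ _ mu _ _ _ (mI n) (iG _ n) (iG _ n)).
  apply: (@le_Rintegral _ _ _ mu _ _ _ (mI n) (iG _ n) (@integrable_DR _ _ _ mu _ _ _ (mI n) (iG _ n) (iG _ n))).
  move=> x /IP x0; rewrite /G addrK subrr powRr0 mul1r -natr1 addrK.
  rewrite -{2}[expR (- x)]mul1r -mulrDl ler_wpM2r ?expR_ge0//.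
  rewrite (powR_mulrn _ (ltW x0)); exact: (powR_le_pow (ltW x0) s0 (ltW (truncnS_gt s))).
have [C3 h3] := F_bound s0.
exists ((C1 + C3) / s); move=> n; rewrite ler_pdivlMr// mulrC Gamma_by_parts.
have := h1 n; have := F_ge0 s n.+1%:R^-1; have := h3 n.+1%:R (ltr0Sn _ _); lra.
Qed.

Let cvg_Gamma (s : R) : 0 < s -> \int[mu]_(x in I n) G s x @[n --> \oo] --> Gamma s.
Proof. by move=> /trunc_bounded_all /trunc_boundedP[]. Qed.

Let cvg_F0 (s : R) : 0 < s -> F s n.+1%:R^-1 @[n --> \oo] --> 0.
Proof.
move=> s0; have := powR_natSinv_cvg0 0 s0; under eq_fun do rewrite addn0.
apply: squeeze_cvgr; last exact: cvg_cst.
apply: nearW => n; rewrite F_ge0/= /F -[leRHS]mulr1; apply: ler_wpM2l; first exact: powR_ge0.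
by rewrite -expR0 ler_expR oppr_le0 invr_ge0.
Qed.

Let cvg_Foo (s : R) : 0 < s -> F s n.+1%:R @[n --> \oo] --> 0.
Proof.
move=> s0; have [C hC] := F_bound (addr_gt0 s0 ltr01).
have C0 : C * n.+1%:R^-1 @[n --> \oo] --> 0.
  rewrite -[X in _ --> X](mulr0 C); apply: cvgM; first exact: cvg_cst.
  exact: cvg_harmonic.
apply: (squeeze_cvgr _ (cvg_cst 0) C0).
apply: nearW => n; rewrite F_ge0/= ler_pdivlMr//.
apply: le_trans (hC n.+1%:R _) => //.
by rewrite /F powRD1// mulrAC.
Qed.

Lemma GammaS (s : R) : 0 < s -> Gamma (s + 1) = s * Gamma s.
Proof.
move=> s0.
have h1 : s * \int[mu]_(x in I n) G s x @[n --> \oo] --> s * Gamma s.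
  by apply: cvgM; [exact: cvg_cst|exact: cvg_Gamma].
have h2 : s * \int[mu]_(x in I n) G s x @[n --> \oo] --> Gamma (s + 1).
  rewrite (_ : (fun n => _) = (fun n => \int[mu]_(x in I n) G (s + 1) x +
      (F s n.+1%:R - F s n.+1%:R^-1))); last by apply/funext => n; rewrite Gamma_by_parts.
  rewrite -[X in _ --> X]addr0; apply: cvgD.
    by apply: cvg_Gamma; rewrite addr_gt0.
  by rewrite -[X in _ --> X](subr0 0); apply: cvgB; [exact: cvg_Foo|exact: cvg_F0].
exact: (cvg_unique _ h2 h1).
Qed.

Lemma Gamma_le_tangent (y s l : R) : 0 < y -> 0 < l -> 0 <= s <= 1 ->
  Gamma (y + s) <= s * Gamma (y + 1) * l `^ (s - 1) + (1 - s) * l `^ s * Gamma y.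
Proof.
move=> y0 l0 s01; have /andP[s0 s1] := s01.
have ys : 0 < y + s by rewrite ltr_wpDr.
have y1 : 0 < y + 1 by rewrite addr_gt0.
apply: (ler_cvg_to (cvg_Gamma ys) (cvgD (cvgM (cvgM (cvg_cst s) (cvg_Gamma y1)) (cvg_cst (l `^ (s - 1)))) (cvgM (cvg_cst ((1 - s) * l `^ s)) (cvg_Gamma y0)))).
apply: nearW => n; change (\int[mu]_(x in I n) G (y + s) x <=
  s * \int[mu]_(x in I n) G (y + 1) x * l `^ (s - 1) +
  (1 - s) * l `^ s * \int[mu]_(x in I n) G y x).
rewrite mulrAC -(@RintegralZl _ _ _ mu _ _ (s * l `^ (s - 1)) (mI n) (iG _ n)).
rewrite -(@RintegralZl _ _ _ mu _ _ ((1 - s) * l `^ s) (mI n) (iG _ n)).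
have i1 := @integrable_ZR _ _ _ mu _ (s * l `^ (s - 1)) _ (mI n) (iG (y + 1) n).
have i2 := @integrable_ZR _ _ _ mu _ ((1 - s) * l `^ s) _ (mI n) (iG y n).
rewrite -(@RintegralD _ _ _ mu _ _ _ (mI n) i1 i2).
apply: (@le_Rintegral _ _ _ mu _ _ _ (mI n) (iG _ n) (@integrable_DR _ _ _ mu _ _ _ (mI n) i1 i2)).
have key (x : R) : 0 < x ->
    G (y + s) x <= s * l `^ (s - 1) * G (y + 1) x + (1 - s) * l `^ s * G y x.
  move=> x0; have := powR_tangent x0 l0 s01.
  have e1 : G (y + s) x = G y x * x `^ s.
    by rewrite /G (addrAC y s) (powRDp (y - 1) s x0) mulrAC.
  have e2 : G (y + 1) x = G y x * x.
    by rewrite /G (addrAC y 1) (powRD1 (y - 1) x0) mulrAC.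
  rewrite e1 e2 => h; apply: le_trans (ler_wpM2l (G_ge0 y x) h) _.
  by rewrite le_eqVlt; apply/orP; left; apply/eqP; ring.
by move=> x /IP; exact: key.
Qed.

Lemma Gamma1 : Gamma 1 = 1.
Proof.
pose E x : R := - expR (- x).
have h (n : nat) : \int[mu]_(x in I n.+1) G 1 x = expR (- n.+2%:R^-1) - expR (- n.+2%:R).
  have nlt : n.+2%:R^-1 < n.+2%:R :> R.
    apply: (@lt_trans _ _ 1); first by rewrite invf_lt1// ltr1n.
    by rewrite ltr1n.
  have -> : \int[mu]_(x in I n.+1) G 1 x = E n.+2%:R - E n.+2%:R^-1.
    apply: (@FTC2_segment _ (G 1) E _ _ nlt) => x /andP[h _].
      by apply: is_derive_eq; rewrite /G subrr powRr0 /GRing.scale/=; ring.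
    by apply: cG; apply: lt_le_trans h; rewrite invr_gt0.
  by rewrite /E; ring.
have := cvg_Gamma ltr01; rewrite -(cvg_shiftn 1) => H.
have H2 : expR (- n.+2%:R^-1) - expR (- n.+2%:R) @[n --> \oo] --> (1 : R).
  rewrite -[X in _ --> X]subr0; apply: cvgB.
    rewrite -[X in _ --> X]expR0; apply: continuous_cvg; first exact: continuous_expR.
    rewrite -[X in _ --> X]oppr0; apply: cvgN.
    by have := @cvg_harmonic R; rewrite -(cvg_shiftn 1); under eq_fun do rewrite addn1.
  have := @cvg_Foo 1 ltr01; rewrite -(cvg_shiftn 1) => H1.
  apply: (squeeze_cvgr _ (cvg_cst 0) H1); apply: nearW => n.
  rewrite expR_ge0/= addn1 /F powRr1// -{1}[expR _]mul1r ler_wpM2r ?expR_ge0//.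
  by rewrite ler1n.
have E2 : (fun n => \int[mu]_(x in I (n + 1)%N) G 1 x) =
    (fun n => expR (- n.+2%:R^-1) - expR (- n.+2%:R)).
  by apply/funext => n; rewrite addn1 h.
by rewrite E2 in H; exact: (cvg_unique _ H H2).
Qed.

Lemma Gamma_ge0 (s : R) : 0 <= Gamma s.
Proof. by apply: Rintegral_ge0 => x _; exact: G_ge0. Qed.

End gamma.

(** * The Bohr-Mollerup theorem in tangent form *)

Section bohr_mollerup.
Context {R : realType}.

(** The hypotheses of the Bohr-Mollerup theorem, with log-convexity replaced by
    the family of tangent bounds, which is linear in F. Being stable under
    limits and integrals, this form is what the Gamma and Beta integrals satisfy
    directly. *)
Definition gamma_like (F : R -> R) := [/\ (forall x : R, 0 < x -> 0 <= F x), 0 < F 1,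
  (forall x : R, 0 < x -> F (x + 1) = x * F x) &
  (forall y s l : R, 0 < y -> 0 < l -> 0 <= s <= 1 ->
    F (y + s) <= s * F (y + 1) * l `^ (s - 1) + (1 - s) * l `^ s * F y)].

(** A zero at x would, by the tangent bound, force a zero at the next integer,
    where F is a factorial times F 1. *)
Lemma gamma_like_gt0 F : gamma_like F -> forall x : R, 0 < x -> 0 < F x.
Proof.
move=> [F0 F1 FS FT] x x0; rewrite lt_neqAle F0// andbT eq_sym; apply/eqP => Fx.
have Fn n : 0 < F n.+1%:R.
  by elim: n => // n ih; rewrite -[n.+2%:R]natr1 FS// mulr_gt0.
have := FT x ((Num.truncn x).+1%:R - x) 1 x0 ltr01.
have h1 := truncnS_gt x; have h2 := truncn_le x.
rewrite (ltW x0) in h2.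
rewrite FS// Fx mulr0 !mulr0 mul0r addr0 subrKC => H.
have := Fn (Num.truncn x); rewrite ltNge H//.
by rewrite subr_ge0 ltW//= lerBlDl -natr1 lerD2r.
Qed.

(** Wendel's inequality: the tangent bound is optimal at l = y. The reverse bound
    follows by applying it from y + s with exponent 1 - s. *)
Lemma wendel_le F : gamma_like F -> forall y s : R, 0 < y -> 0 <= s <= 1 ->
  F (y + s) <= y `^ s * F y.
Proof.
move=> [F0 F1 FS FT] y s y0 s01.
apply: le_trans (FT y s y y0 y0 s01) _.
rewrite FS// powRB1//.
rewrite le_eqVlt; apply/orP; left; apply/eqP; field.
by rewrite gt_eqF.
Qed.

Lemma wendel_ge F : gamma_like F -> forall y s : R, 0 < y -> 0 <= s <= 1 ->
  y * (y + s) `^ (s - 1) * F y <= F (y + s).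
Proof.
move=> gF y s y0 /andP[s0 s1]; have ys : 0 < y + s by rewrite ltr_wpDr.
have s01' : 0 <= 1 - s <= 1 by rewrite subr_ge0 s1 lerBlDr lerDl.
have [F0 F1 FS FT] := gF.
have := wendel_le gF ys s01'.
have -> : y + s + (1 - s) = y + 1 by ring.
rewrite FS// => h.
have -> : (y + s) `^ (s - 1) = ((y + s) `^ (1 - s))^-1 by rewrite -powRN opprB.
by rewrite mulrAC ler_pdivrMr ?powR_gt0// [leRHS]mulrC.
Qed.

Lemma gamma_like_step F : gamma_like F -> forall (x : R) n, 0 < x ->
  F (x + n%:R) = \prod_(i < n) (x + i%:R) * F x.
Proof.
move=> [F0 F1 FS FT] x n x0; elim: n => [|n ih].
  by rewrite addr0 big_ord0 mul1r.
by rewrite -natr1 addrA FS ?ltr_wpDr// ih big_ord_recr/=; ring.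
Qed.

Lemma cvg_invDn (x : R) : 0 < x -> (x + n%:R)^-1 @[n --> \oo] --> (0 : R).
Proof.
move=> x0; rewrite -cvg_shiftS.
apply: squeeze_cvgr (cvg_cst (0 : R)) (@cvg_harmonic R); apply: nearW => n.
have xn : 0 < x + n.+1%:R by rewrite ltr_wpDr.
by rewrite invr_ge0 (ltW xn)/= lef_pV2 ?posrE// lerDr ltW.
Qed.

Lemma gamma_like_ratio_cvg F : gamma_like F -> forall (y : nat -> R) (s : R),
  (forall n, 0 < y n) -> (y n)^-1 @[n --> \oo] --> (0 : R) -> 0 <= s <= 1 ->
  F (y n + s) / F (y n) / (y n) `^ s @[n --> \oo] --> (1 : R).
Proof.
move=> gF y s yn yoo s01; have /andP[s0 s1] := s01.
have yns n : 0 < y n + s by rewrite ltr_wpDr.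
have H : y n / (y n + s) @[n --> \oo] --> (1 : R).
  rewrite (_ : (fun n => _) = (fun n => 1 - s / (y n + s))); last first.
    by apply/funext => n; field; rewrite gt_eqF.
  rewrite -[X in _ --> X]subr0; apply: cvgB; first exact: cvg_cst.
  rewrite -[X in _ --> X](mulr0 s); apply: cvgM; first exact: cvg_cst.
  apply: squeeze_cvgr (cvg_cst (0 : R)) yoo; apply: nearW => n.
  by rewrite invr_ge0 (ltW (yns n))/= lef_pV2 ?posrE// lerDl.
apply: squeeze_cvgr H (cvg_cst (1 : R)); apply: nearW => n.
have Fp := gamma_like_gt0 gF (yn n).
apply/andP; split; last first.
  by rewrite ler_pdivrMr ?powR_gt0// mul1r ler_pdivrMr// wendel_le.
rewrite ler_pdivlMr ?powR_gt0// ler_pdivlMr//.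
apply: le_trans (wendel_ge gF (yn n) s01).
rewrite ler_pM2r// -mulrA ler_pM2l//.
rewrite powRB1// [leRHS]mulrC ler_pM2l ?invr_gt0//.
rewrite ge0_ler_powR ?nnegrE ?(ltW (yn n)) ?(ltW (yns n))//.
by rewrite lerDl.
Qed.

(** The quotient Q of two solutions is 1-periodic, by the functional equation. By
    Wendel's inequalities Q (x + s + n) / Q (x + n) tends to 1 for s in [0, 1];
    this ratio does not depend on n, so Q is constant. *)
Lemma bohr_mollerup_unique F1 F2 : gamma_like F1 -> gamma_like F2 ->
  forall x : R, 0 < x -> F1 x / F1 1 = F2 x / F2 1.
Proof.
move=> g1 g2.
pose Q x := F1 x / F2 x.
have Qp (x : R) : 0 < x -> 0 < Q x.
  by move=> x0; rewrite divr_gt0 ?(gamma_like_gt0 g1) ?(gamma_like_gt0 g2).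
have QS (x : R) n : 0 < x -> Q (x + n%:R) = Q x.
  move=> x0; rewrite /Q !gamma_like_step//.
  have p0 : 0 < \prod_(i < n) (x + i%:R) by apply: prodr_gt0 => i _; rewrite ltr_wpDr.
  by rewrite invfM mulrACA divff ?gt_eqF// mul1r.
have Qs (x s : R) : 0 < x -> 0 <= s <= 1 -> Q (x + s) = Q x.
  move=> x0 s01; have /andP[s0 s1] := s01.
  have xn n : 0 < x + n%:R by rewrite ltr_wpDr.
  have xns n : 0 < x + n%:R + s by rewrite ltr_wpDr.
  have c1 := gamma_like_ratio_cvg g1 xn (cvg_invDn x0) s01.
  have c2 := gamma_like_ratio_cvg g2 xn (cvg_invDn x0) s01.
  have c3 := cvgM c1 (cvgV (oner_neq0 R) c2).
  have E n : Q (x + s) / Q x = F1 (x + n%:R + s) / F1 (x + n%:R) / (x + n%:R) `^ s *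
     (F2 (x + n%:R + s) / F2 (x + n%:R) / (x + n%:R) `^ s)^-1.
    rewrite -(QS _ n x0) -(QS (x + s) n (ltr_wpDr s0 x0)) /Q.
    rewrite (addrAC x s).
    have := gamma_like_gt0 g1 (xn n); have := gamma_like_gt0 g2 (xn n).
    have := gamma_like_gt0 g1 (xns n); have := gamma_like_gt0 g2 (xns n).
    have := powR_gt0 s (xn n) => h1 h2 h3 h4 h5.
    by field; rewrite !gt_eqF.
  have : Q (x + s) / Q x @[n --> \oo] --> (1 : R).
    rewrite (_ : (fun _ => _) = (fun n => F1 (x + n%:R + s) / F1 (x + n%:R) / (x + n%:R) `^ s *
     (F2 (x + n%:R + s) / F2 (x + n%:R) / (x + n%:R) `^ s)^-1)).
      by have := c3 _ _; rewrite mul1r invr1; apply.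
    by apply/funext => n; rewrite -E.
  move=> /(cvg_unique (@Rhausdorff R) (cvg_cst (Q (x + s) / Q x))) H.
  by rewrite -[LHS](divfK (lt0r_neq0 (Qp x x0))) H mul1r.
move=> x x0.
have h1 := truncnS_gt x; have := truncn_le x; rewrite (ltW x0) => h2.
have : Q x = Q 1.
  have [x1|x1] := leP 1 x.
    have [m mE] : exists m, Num.truncn x = m.+1.
      by exists (Num.truncn x).-1; rewrite prednK// truncn_gt0.
    rewrite mE in h1 h2.
    have pm : 0 < 1 + m%:R :> R by rewrite ltr_wpDr.
    rewrite -(QS 1 m)// -[in LHS](subrKC (1 + m%:R) x) (Qs (1 + m%:R))//.
    move: h1 h2; rewrite -!natr1 => h1 h2; apply/andP; split; lra.
  rewrite -[1](subrKC x) Qs//.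
  by rewrite subr_ge0 ltW//= lerBlDl lerDr ltW.
rewrite /Q => E.
have p1 := gamma_like_gt0 g1 (ltr01 : 0 < (1:R)).
have p2 := gamma_like_gt0 g2 (ltr01 : 0 < (1:R)).
have p3 := gamma_like_gt0 g2 x0.
by rewrite -[F1 x](divfK (lt0r_neq0 p3)) E; field; rewrite !gt_eqF.
Qed.

End bohr_mollerup.

(** * Positivity and growth of Gamma *)

Section gamma_ratio.
Context {R : realType}.
Notation Gamma := (@Gamma_fun R).

Lemma gamma_like_Gamma : gamma_like Gamma.
Proof.
split=> [x _||x x0|y s l y0 l0 s01]; first exact: Gamma_ge0.
- by rewrite Gamma1 ltr01.
- exact: GammaS.
- exact: Gamma_le_tangent.
Qed.

Lemma Gamma_gt0 (s : R) : 0 < s -> 0 < Gamma s.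
Proof. exact: (gamma_like_gt0 gamma_like_Gamma). Qed.

(** The integer part of p is absorbed by the functional equation, the fractional
    part by Wendel's inequalities. *)
Lemma Gamma_ratio_cvg (y : nat -> R) (p : R) :
  (forall n, 0 < y n) -> (y n)^-1 @[n --> \oo] --> (0 : R) -> 0 <= p ->
  Gamma (y n + p) / Gamma (y n) / (y n) `^ p @[n --> \oo] --> (1 : R).
Proof.
move=> yn yoo p0.
pose s := p - (Num.truncn p)%:R.
have s01 : 0 <= s <= 1.
  have h1 := truncnS_gt p; have := truncn_le p; rewrite p0 => h2.
  by rewrite subr_ge0 h2 lerBlDl natr1 ltW.
have /andP[s0 s1] := s01.
have -> : p = s + (Num.truncn p)%:R by rewrite subrK.
clearbody s; elim: (Num.truncn p) => [|m ih].
  rewrite addr0; exact: (gamma_like_ratio_cvg gamma_like_Gamma yn yoo s01).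
have H : (y n + s + m%:R) / y n @[n --> \oo] --> (1 : R).
  rewrite (_ : (fun n => _) = (fun n => 1 + (s + m%:R) / y n)); last first.
    by apply/funext => n; have := yn n => ?; field; rewrite gt_eqF.
  rewrite -[X in _ --> X]addr0; apply: cvgD; first exact: cvg_cst.
  by rewrite -[X in _ --> X](mulr0 (s + m%:R)); apply: cvgM; first exact: cvg_cst.
rewrite (_ : (fun n => _) = (fun n => Gamma (y n + (s + m%:R)) / Gamma (y n) /
    (y n) `^ (s + m%:R) * ((y n + s + m%:R) / y n))).
  by rewrite -[X in _ --> X]mulr1; apply: cvgM.
apply/funext => n; rewrite -natr1 !addrA.
have xns : 0 < y n + s + m%:R by rewrite !ltr_wpDr.
rewrite GammaS// powRD1//.
have := Gamma_gt0 (yn n); have := powR_gt0 (s + m%:R) (yn n) => h1 h2.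
have := yn n => h3.
move: (Gamma (y n + s + m%:R)) (Gamma (y n)) h2 => g g' h2.
by field; rewrite !gt_eqF.
Qed.

End gamma_ratio.

(** * The Beta integral *)

Section beta.
Context {R : realType}.
Notation mu := (@lebesgue_measure R).
Notation Gamma := (@Gamma_fun R).
Notation Beta := (@Beta_fun R).

Let G (a b x : R) := x `^ (a - 1) * (1 - x) `^ (b - 1).
Let J (n : nat) : set R := `[n.+2%:R^-1, 1 - n.+2%:R^-1].
Let F (a b x : R) := x `^ a * (1 - x) `^ b.

Let JP n (x : R) : J n x -> 0 < x < 1.
Proof.
rewrite /J/= in_itv/= => /andP[h1 h2]; apply/andP; split.
  by apply: lt_le_trans h1; rewrite invr_gt0.
by apply: le_lt_trans h2 _; rewrite ltrBlDr ltrDl invr_gt0.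
Qed.

Let mJ n : measurable (J n).
Proof. exact: measurable_itv. Qed.

Let G_ge0 a b x : 0 <= G a b x.
Proof. by rewrite mulr_ge0 ?powR_ge0. Qed.

Let F_ge0 a b x : 0 <= F a b x.
Proof. by rewrite mulr_ge0 ?powR_ge0. Qed.

Let cG (a b x : R) : 0 < x < 1 -> {for x, continuous (G a b)}.
Proof.
move=> /andP[x0 x1]; apply: continuousM; first exact: powR_continuous.
apply: (@continuous_comp _ _ _ (fun y : R => 1 - y) (fun y : R => y `^ (b - 1))).
  by apply: continuousB; [exact: cst_continuous|exact: cvg_id].
by apply: powR_continuous; rewrite subr_gt0.
Qed.

Let iG a b n : mu.-integrable (J n) (EFin \o G a b).
Proof.
apply: segment_integrable => x h; apply: cG; apply: (@JP n).
by rewrite /J/= in_itv.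
Qed.

Let J0 f : \int[mu]_(x in J 0%N) f x = 0.
Proof.
rewrite /J (_ : 1 - 2^-1 = 2^-1 :> R); last by field.
by rewrite set_itv1 Rintegral_set1.
Qed.

Let half_lt n : n != 0%N -> n.+2%:R^-1 < 1 - n.+2%:R^-1 :> R.
Proof.
move=> n0; have h1 : n.+2%:R^-1 * 3 <= 1 :> R.
  by rewrite ler_pdivrMl// mulr1 ler_nat !ltnS lt0n.
have h2 : 0 < n.+2%:R^-1 :> R by rewrite invr_gt0.
move: (n.+2%:R^-1 : R) h1 h2 => y h1 h2; lra.
Qed.

Let Beta_by_parts (a b : R) n : \int[mu]_(x in J n) (a * G a b x - (a + b) * G (a + 1) b x) =
  F a b (1 - n.+2%:R^-1) - F a b n.+2%:R^-1.
Proof.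
have [->|n0] := eqVneq n 0%N.
  by rewrite J0 (_ : 1 - 2^-1 = 2^-1 :> R) ?subrr//; field.
have nlt := half_lt n0.
have inJ (x : R) : n.+2%:R^-1 <= x <= 1 - n.+2%:R^-1 -> 0 < x < 1.
  by move=> h; apply: (@JP n); rewrite /J/= in_itv.
apply: (@FTC2_segment _ _ (F a b) _ _ nlt) => x /inJ /andP[x0 x1]; last first.
  apply: continuousB.
    apply: continuousM; first exact: cst_continuous.
    by apply: cG; rewrite x0.
  apply: continuousM; first exact: cst_continuous.
  by apply: cG; rewrite x0.
have y0 : 0 < 1 - x by rewrite subr_gt0.
have H1 : is_derive x (1:R) (fun y : R => y `^ a) (a * x `^ (a - 1)).
  exact: is_derive1_powR.
have H2 : is_derive x (1:R) (fun y : R => (1 - y) `^ b) (- (b * (1 - x) `^ (b - 1))).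
  have h3 : is_derive (1 - x) (1:R) (fun y : R => y `^ b) (b * (1 - x) `^ (b - 1)).
    exact: is_derive1_powR.
  have h4 : is_derive x (1:R) (fun y : R => 1 - y) (- 1).
    have := @is_deriveB _ _ _ (cst (1:R)) id x 1 0 1 (is_derive_cst (1:R) x 1) (is_derive_id x (1:R)).
    by rewrite sub0r.
  have := @is_derive1_comp R (fun y : R => y `^ b) (fun y : R => 1 - y) x _ _ h3 h4.
  by rewrite mulrN1.
apply: is_derive_eq.
rewrite /G addrK /GRing.scale/= !powRB1//.
by field; rewrite !gt_eqF.
Qed.

Let Beta_by_parts' (a b : R) n :
  a * \int[mu]_(x in J n) G a b x - (a + b) * \int[mu]_(x in J n) G (a + 1) b x =
  F a b (1 - n.+2%:R^-1) - F a b n.+2%:R^-1.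
Proof.
rewrite -Beta_by_parts.
rewrite (@RintegralB _ _ _ mu _ _ _ (mJ n) (@integrable_ZR _ _ _ mu _ a _ (mJ n) (iG a b n))
  (@integrable_ZR _ _ _ mu _ (a + b) _ (mJ n) (iG (a + 1) b n))).
by rewrite (@RintegralZl _ _ _ mu _ _ a (mJ n) (iG _ _ n)) (@RintegralZl _ _ _ mu _ _ (a + b) (mJ n) (iG _ _ n)).
Qed.

Let BetaD (a b : R) n :
  \int[mu]_(x in J n) G a b x = \int[mu]_(x in J n) G (a + 1) b x + \int[mu]_(x in J n) G a (b + 1) x.
Proof.
rewrite -(@RintegralD _ _ _ mu _ _ _ (mJ n) (iG _ _ n) (iG _ _ n)).
have key (x : R) : 0 < x < 1 -> G a b x = G (a + 1) b x + G a (b + 1) x.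
  move=> /andP[x0 x1]; have y0 : 0 < 1 - x by rewrite subr_gt0.
  by rewrite /G !addrK !powRB1//; field; rewrite !gt_eqF.
by apply: eq_Rintegral => x; rewrite inE => /JP; exact: key.
Qed.

Let ndJ : nondecreasing_seq J.
Proof.
move=> m n mn; rewrite subsetEset => x; rewrite /J/= !in_itv/= => /andP[h1 h2].
have h : n.+2%:R^-1 <= m.+2%:R^-1 :> R by rewrite lef_pV2 ?posrE// ler_nat.
by rewrite (le_trans _ h1)// (le_trans h2)// lerB.
Qed.

Let bigJ : \bigcup_n J n = `]0, 1[%classic.
Proof.
apply/seteqP; split => [x [n _ /JP]|x] /=; rewrite in_itv/= => /andP[x0 x1].
  by rewrite x0.
have y0 : 0 < 1 - x by rewrite subr_gt0.
exists (maxn (Num.truncn x^-1) (Num.truncn (1 - x)^-1)) => //; rewrite /J/= in_itv/=.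
apply/andP; split.
  rewrite invf_ple ?posrE//.
  by rewrite (le_trans (ltW (truncnS_gt _)))// ler_nat ltnS leqW// leq_maxl.
rewrite lerBrDr -lerBrDl invf_ple ?posrE//.
by rewrite (le_trans (ltW (truncnS_gt _)))// ler_nat ltnS leqW// leq_maxr.
Qed.

Let trunc_bounded (a b : R) := exists C : R, forall n, \int[mu]_(x in J n) G a b x <= C.

Let F_le1 (a b x : R) : 0 <= a -> 0 <= b -> 0 < x < 1 -> F a b x <= 1.
Proof.
move=> a0 b0 /andP[x0 x1]; apply: mulr_ile1; rewrite ?powR_ge0//.
  by apply: powR_le1; rewrite // (ltW x0) (ltW x1).
by apply: powR_le1; rewrite // subr_ge0 gerBl (ltW x0) (ltW x1).
Qed.

Let end1 n : 0 < (n.+2%:R^-1 : R) < 1.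
Proof. by rewrite invr_gt0 ltr0n/= invf_lt1// ltr1n. Qed.

Let end2 n : 0 < 1 - (n.+2%:R^-1 : R) < 1.
Proof. by have := end1 n => /andP[h1 h2]; rewrite subr_gt0 h2 gtrBl. Qed.

(** Integration by parts bounds the integral with the smaller exponent by the one
    with the larger exponent; two such steps reduce every pair of positive
    exponents to exponents at least 1, where the integrand is bounded. *)
Let trunc_bounded_down_l (a b : R) : 0 < a -> 0 <= b -> trunc_bounded (a + 1) b -> trunc_bounded a b.
Proof.
move=> a0 b0 [C hC]; exists (((a + b) * C + 1) / a) => n.
rewrite ler_pdivlMr// mulrC.
have := Beta_by_parts' a b n.
have := F_le1 (ltW a0) b0 (end2 n); have := F_ge0 a b n.+2%:R^-1.
have : (a + b) * \int[mu]_(x in J n) G (a + 1) b x <= (a + b) * C.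
  by rewrite ler_pM2l// ltr_wpDr.
lra.
Qed.

Let trunc_bounded_down_r (a b : R) : 0 <= a -> 0 < b -> trunc_bounded a (b + 1) -> trunc_bounded a b.
Proof.
move=> a0 b0 [C hC]; exists (((a + b) * C + 1) / b) => n.
rewrite ler_pdivlMr// mulrC.
have := Beta_by_parts' a b n; have E := BetaD a b n.
have := F_le1 a0 (ltW b0) (end1 n); have := F_ge0 a b (1 - n.+2%:R^-1).
have : (a + b) * \int[mu]_(x in J n) G a (b + 1) x <= (a + b) * C.
  by rewrite ler_pM2l// ltr_wpDl.
nra.
Qed.

Let trunc_bounded_large (a b : R) : 1 <= a -> 1 <= b -> trunc_bounded a b.
Proof.
move=> a1 b1; exists 1 => n.
have [->|n0] := eqVneq n 0%N; first by rewrite J0.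
apply: (@le_trans _ _ (\int[mu]_(x in J n) (cst 1) x)).
  apply: (@le_Rintegral _ _ _ mu _ _ _ (mJ n) (iG _ _ n)).
    by apply: segment_integrable => x _; exact: cst_continuous.
  by move=> x /JP; apply: F_le1; rewrite subr_ge0.
have /andP[h1 h2] := end1 n.
rewrite (@FTC2_segment _ (cst 1) id _ _ (half_lt n0)).
- by move: (n.+2%:R^-1 : R) h1 h2 => y; lra.
- by move=> x _; exact: cst_continuous.
Qed.

Let trunc_bounded_all (a b : R) : 0 < a -> 0 < b -> trunc_bounded a b.
Proof.
move=> a0 b0; apply: trunc_bounded_down_l => //; first exact: ltW.
apply: trunc_bounded_down_r => //; first by rewrite addr_ge0 ?ltW.
by apply: trunc_bounded_large; rewrite lerDr ltW.
Qed.

Let trunc_boundedP (a b : R) : 0 < a -> 0 < b -> mu.-integrable `]0, 1[ (EFin \o G a b) /\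
  \int[mu]_(x in J n) G a b x @[n --> \oo] --> \int[mu]_(x in `]0, 1[) G a b x.
Proof.
move=> a0 b0; have [C hC] := trunc_bounded_all a0 b0.
exact: (@Rintegral_exhaustion _ _ _ mu _ _ _ _ ndJ mJ bigJ (fun x _ => G_ge0 a b x) (iG a b) hC).
Qed.

Let mG (a b : R) : measurable_fun setT (G a b).
Proof.
apply: measurable_funM; first exact: measurable_powR.
apply: (@measurableT_comp _ _ _ _ _ _ (fun y : R => y `^ (b - 1))); first exact: measurable_powR.
by apply: measurable_funB.
Qed.

Lemma Beta_integrable (a b : R) : 0 < a -> 0 < b ->
  mu.-integrable `[0, 1] (fun x => (x `^ (a - 1) * (1 - x) `^ (b - 1))%:E).
Proof.
move=> a0 b0; have [+ _] := trunc_boundedP a0 b0.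
move=> /integrableP[m1 h1]; apply/integrableP; split.
  by apply/measurable_EFinP; apply: measurable_funTS; exact: mG.
rewrite -integral_itv_obnd_cbnd; last first.
  by apply/measurableT_comp => //; apply/measurable_EFinP/measurable_funTS; exact: mG.
rewrite -integral_itv_bndo_bndc//.
by apply/measurableT_comp => //; apply/measurable_EFinP/measurable_funTS; exact: mG.
Qed.

Let BetaE (a b : R) : 0 < a -> 0 < b -> \int[mu]_(x in `]0, 1[) G a b x = Beta a b.
Proof.
move=> a0 b0; have [i1 _] := trunc_boundedP a0 b0.
rewrite Rintegral_itv_bndo_bndc// Rintegral_itv_obnd_cbnd//.
have : mu.-integrable `[0, 1] (EFin \o G a b) by exact: Beta_integrable.
by apply: integrableS => //; apply: subset_itvr; rewrite bnd_simp.
Qed.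

Let cvg_Beta (a b : R) : 0 < a -> 0 < b -> \int[mu]_(x in J n) G a b x @[n --> \oo] --> Beta a b.
Proof. by move=> a0 b0; rewrite -BetaE//; have [] := trunc_boundedP a0 b0. Qed.

Let cvg_F1 (a b : R) : 0 < a -> 0 <= b -> F a b n.+2%:R^-1 @[n --> \oo] --> 0.
Proof.
move=> a0 b0; have := powR_natSinv_cvg0 1 a0; under eq_fun do rewrite addn1.
apply: squeeze_cvgr (cvg_cst (0 : R)); apply: nearW => n.
rewrite F_ge0/= /F -[leRHS]mulr1; apply: ler_wpM2l; first exact: powR_ge0.
by apply: powR_le1 => //; have /andP[h1 h2] := end2 n; rewrite (ltW h1) (ltW h2).
Qed.

Let cvg_F2 (a b : R) : 0 <= a -> 0 < b -> F a b (1 - n.+2%:R^-1) @[n --> \oo] --> 0.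
Proof.
move=> a0 b0; have := powR_natSinv_cvg0 1 b0; under eq_fun do rewrite addn1.
apply: squeeze_cvgr (cvg_cst (0 : R)); apply: nearW => n.
rewrite F_ge0/= /F subKr -[leRHS]mul1r; apply: ler_wpM2r; first exact: powR_ge0.
by apply: powR_le1 => //; have /andP[h1 h2] := end2 n; rewrite (ltW h1) (ltW h2).
Qed.

Lemma BetaS (a b : R) : 0 < a -> 0 < b -> Beta (a + 1) b = a / (a + b) * Beta a b.
Proof.
move=> a0 b0; have ab : 0 < a + b by rewrite addr_gt0.
have a10 : 0 < a + 1 by rewrite addr_gt0.
have h1 : a * \int[mu]_(x in J n) G a b x - (a + b) * \int[mu]_(x in J n) G (a + 1) b x @[n --> \oo]
     --> a * Beta a b - (a + b) * Beta (a + 1) b.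
  apply: cvgB; apply: cvgM; first exact: cvg_cst; first exact: cvg_Beta.
    exact: cvg_cst.
  exact: cvg_Beta.
have h2 : a * \int[mu]_(x in J n) G a b x - (a + b) * \int[mu]_(x in J n) G (a + 1) b x @[n --> \oo] --> 0 - (0 : R).
  rewrite (_ : (fun n => _) = (fun n => F a b (1 - n.+2%:R^-1) - F a b n.+2%:R^-1)).
    by apply: cvgB; [apply: cvg_F2; rewrite ?ltW|apply: cvg_F1; rewrite ?ltW].
  by apply/funext => n; rewrite Beta_by_parts'.
have : a * Beta a b - (a + b) * Beta (a + 1) b = 0 - 0.
  exact: (cvg_unique (@Rhausdorff R) h1 h2).
move/eqP; rewrite subr0 subr_eq0 => /eqP E.
by rewrite mulrAC E mulrAC divff ?mul1r// gt_eqF.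
Qed.

Lemma Beta1 (b : R) : 0 < b -> Beta 1 b = b^-1.
Proof.
move=> b0.
have h1 : - b * \int[mu]_(x in J n) G 1 b x @[n --> \oo] --> - b * Beta 1 b.
  by apply: cvgM; [exact: cvg_cst|exact: cvg_Beta].
have h2 : - b * \int[mu]_(x in J n) G 1 b x @[n --> \oo] --> 0 - (1 : R).
  rewrite (_ : (fun n => _) = (fun n => F 0 b (1 - n.+2%:R^-1) - F 0 b n.+2%:R^-1)).
    apply: cvgB; first by apply: cvg_F2.
    rewrite (_ : (fun n => _) = (fun n => (1 - n.+2%:R^-1 : R) `^ b)); last first.
      by apply/funext => n; rewrite /F powRr0 mul1r.
    have e1 : (1 : R) = 1 `^ b by rewrite powR1.
    rewrite [X in _ --> X]e1.
    apply: (@continuous_cvg _ _ _ _ _ (fun n => 1 - n.+2%:R^-1 : R) (fun y : R => y `^ b)).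
      exact: powR_continuous.
    rewrite -[X in _ --> X]subr0; apply: cvgB; first exact: cvg_cst.
    by have := @cvg_harmonic R; rewrite -(cvg_shiftn 1); under eq_fun do rewrite addn1.
  by apply/funext => n; rewrite -Beta_by_parts' mul0r !add0r mulNr.
have : - b * Beta 1 b = 0 - 1.
  exact: (cvg_unique (@Rhausdorff R) h1 h2).
move/eqP; rewrite sub0r mulNr eqr_opp => /eqP E.
by rewrite -[LHS](mulKf (lt0r_neq0 b0)) E mulr1.
Qed.

Lemma Beta_ge0 (a b : R) : 0 <= Beta a b.
Proof. by apply: Rintegral_ge0 => x _; exact: G_ge0. Qed.

Lemma Beta_le_tangent (y b s l : R) : 0 < y -> 0 < b -> 0 < l -> 0 <= s <= 1 ->
  Beta (y + s) b <= s * Beta (y + 1) b * l `^ (s - 1) + (1 - s) * l `^ s * Beta y b.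
Proof.
move=> y0 b0 l0 s01; have /andP[s0 s1] := s01.
have ys : 0 < y + s by rewrite ltr_wpDr.
have y1 : 0 < y + 1 by rewrite addr_gt0.
apply: (ler_cvg_to (cvg_Beta ys b0) (cvgD (cvgM (cvgM (cvg_cst s) (cvg_Beta y1 b0)) (cvg_cst (l `^ (s - 1)))) (cvgM (cvg_cst ((1 - s) * l `^ s)) (cvg_Beta y0 b0)))).
apply: nearW => n; change (\int[mu]_(x in J n) G (y + s) b x <=
  s * \int[mu]_(x in J n) G (y + 1) b x * l `^ (s - 1) +
  (1 - s) * l `^ s * \int[mu]_(x in J n) G y b x).
rewrite mulrAC -(@RintegralZl _ _ _ mu _ _ (s * l `^ (s - 1)) (mJ n) (iG _ _ n)).
rewrite -(@RintegralZl _ _ _ mu _ _ ((1 - s) * l `^ s) (mJ n) (iG _ _ n)).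
have i1 := @integrable_ZR _ _ _ mu _ (s * l `^ (s - 1)) _ (mJ n) (iG (y + 1) b n).
have i2 := @integrable_ZR _ _ _ mu _ ((1 - s) * l `^ s) _ (mJ n) (iG y b n).
rewrite -(@RintegralD _ _ _ mu _ _ _ (mJ n) i1 i2).
apply: (@le_Rintegral _ _ _ mu _ _ _ (mJ n) (iG _ _ n) (@integrable_DR _ _ _ mu _ _ _ (mJ n) i1 i2)).
have key (x : R) : 0 < x ->
    G (y + s) b x <= s * l `^ (s - 1) * G (y + 1) b x + (1 - s) * l `^ s * G y b x.
  move=> x0; have := powR_tangent x0 l0 s01.
  have e1 : G (y + s) b x = G y b x * x `^ s.
    by rewrite /G (addrAC y s) (powRDp (y - 1) s x0) mulrAC.
  have e2 : G (y + 1) b x = G y b x * x.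
    by rewrite /G (addrAC y 1) (powRD1 (y - 1) x0) mulrAC.
  rewrite e1 e2 => h; apply: le_trans (ler_wpM2l (G_ge0 y b x) h) _.
  by rewrite le_eqVlt; apply/orP; left; apply/eqP; ring.
by move=> x /JP /andP[h _]; exact: key.
Qed.

(** Up to the factor Gamma b, this function of a should be Gamma. Its tangent
    bounds multiply those of Beta, taken at l / (y + b), with Wendel's bound for
    Gamma at y + b: the powers of y + b cancel. *)
Lemma gamma_like_Beta (b : R) : 0 < b -> gamma_like (fun a => Beta a b * Gamma (a + b)).
Proof.
move=> b0.
split=> [x x0||x x0|y s l y0 l0 s01].
- by rewrite mulr_ge0 ?Beta_ge0 ?Gamma_ge0.
- by rewrite Beta1// mulr_gt0 ?invr_gt0 ?Gamma_gt0 ?addr_gt0.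
- rewrite BetaS// addrAC GammaS ?addr_gt0//.
  have xb : 0 < x + b by rewrite addr_gt0.
  by move: (Beta x b) (Gamma (x + b)) => B g; field; rewrite gt_eqF.
- have /andP[s0 s1] := s01.
  have yb : 0 < y + b by rewrite addr_gt0.
  have l'0 : 0 < l / (y + b) by rewrite divr_gt0.
  have h1 := Beta_le_tangent y0 b0 l'0 s01.
  have h2 := wendel_le gamma_like_Gamma yb s01.
  rewrite (addrAC y s) (addrAC y 1).
  apply: le_trans (ler_pM (Beta_ge0 _ _) (Gamma_ge0 _) h1 h2) _.
  rewrite BetaS// GammaS// !powRB1// powRM ?invr_ge0; [|exact: ltW..].
  rewrite powRVp//.
  have h3 := powR_gt0 s yb; have h4 := powR_gt0 s l0.
  move: (Beta y b) (Gamma (y + b)) (l `^ s) ((y + b) `^ s) h3 h4 => B g u v h3 h4.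
  by rewrite le_eqVlt; apply/orP; left; apply/eqP; field; rewrite !gt_eqF.
Qed.

Theorem Beta_Gamma (a b : R) : 0 < a -> 0 < b ->
  Beta a b = Gamma a * Gamma b / Gamma (a + b).
Proof.
move=> a0 b0; have ab : 0 < Gamma (a + b) by rewrite Gamma_gt0// addr_gt0.
have := bohr_mollerup_unique (gamma_like_Beta b0) gamma_like_Gamma a0.
rewrite Gamma1 divr1 Beta1// (addrC 1) GammaS// mulKf ?gt_eqF// => <-.
have gb := Gamma_gt0 b0.
by rewrite divfK ?mulfK// lt0r_neq0.
Qed.

Lemma Beta_gt0 (a b : R) : 0 < a -> 0 < b -> 0 < Beta a b.
Proof. by move=> a0 b0; rewrite Beta_Gamma// !mulr_gt0 ?invr_gt0 ?Gamma_gt0 ?addr_gt0. Qed.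

End beta.

(** * Expectations of bounded functions *)

Section bounded_functions.
Context d (T : measurableType d) (R : realType).
Implicit Types (f g : T -> R).

(** Everything integrated below, except the diversity itself, is a bounded function
    of the sticks; boundedness makes every integrability condition automatic. *)
Definition bmf f := measurable_fun setT f /\ exists C : R, forall w, `|f w| <= C.

Lemma bmf_measurable f : bmf f -> measurable_fun setT f. Proof. by case. Qed.

Lemma bmf_cst (c : R) : bmf (fun=> c).
Proof. by split; [exact: measurable_cst|exists `|c|]. Qed.

Lemma bmfD f g : bmf f -> bmf g -> bmf (fun w => f w + g w).
Proof.
move=> [mf [C fC]] [mg [D gD]]; split; first exact: measurable_funD.
by exists (C + D) => w; apply: le_trans (ler_normD _ _) (lerD _ _).
Qed.

Lemma bmfM f g : bmf f -> bmf g -> bmf (fun w => f w * g w).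
Proof.
move=> [mf [C fC]] [mg [D gD]]; split; first exact: measurable_funM.
by exists (C * D) => w; rewrite normrM ler_pM.
Qed.

Lemma bmfZ (c : R) f : bmf f -> bmf (fun w => c * f w).
Proof. by move=> bf; apply: bmfM bf; exact: bmf_cst. Qed.

Lemma bmfN f : bmf f -> bmf (fun w => - f w).
Proof. by move=> /(bmfZ (-1)); under eq_fun do rewrite mulN1r. Qed.

Lemma bmfB f g : bmf f -> bmf g -> bmf (fun w => f w - g w).
Proof. by move=> bf /bmfN; exact: bmfD. Qed.

Lemma bmf_sum (I : Type) (s : seq I) (p : pred I) (F : I -> T -> R) :
  (forall i, bmf (F i)) -> bmf (fun w => \sum_(i <- s | p i) F i w).
Proof.
move=> bF; elim: s => [|i s ih].
  by under eq_fun do rewrite big_nil; exact: bmf_cst.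
under eq_fun do rewrite big_cons.
by case: (p i) => //; exact: bmfD.
Qed.

Lemma bmf_prod (I : Type) (s : seq I) (p : pred I) (F : I -> T -> R) :
  (forall i, bmf (F i)) -> bmf (fun w => \prod_(i <- s | p i) F i w).
Proof.
move=> bF; elim: s => [|i s ih].
  by under eq_fun do rewrite big_nil; exact: bmf_cst.
under eq_fun do rewrite big_cons.
by case: (p i) => //; exact: bmfM.
Qed.

Lemma bmfX f n : bmf f -> bmf (fun w => f w ^+ n).
Proof.
move=> bf; elim: n => [|n ih].
  by under eq_fun do rewrite expr0; exact: bmf_cst.
by under eq_fun do rewrite exprS; exact: bmfM.
Qed.

Lemma bmf_indic (A : set T) : measurable A -> bmf (\1_A).
Proof.
move=> mA; split; first exact: measurable_indic.
by exists 1 => w; rewrite indicE; case: (_ \in _); rewrite ?normr1 ?normr0.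
Qed.

Lemma bmf_unit f : measurable_fun setT f -> (forall w, 0 <= f w <= 1) -> bmf f.
Proof. by move=> mf f01; split=> //; exists 1 => w; have /andP[h1 h2] := f01 w; rewrite ger0_norm. Qed.

End bounded_functions.

Section bounded_expectation.
Context d (T : measurableType d) (R : realType) (P : probability T R).
Implicit Types (f g : T -> R).

Definition Ex f : R := \int[P]_w f w.

Lemma bmf_integrable f : bmf f -> P.-integrable setT (EFin \o f).
Proof.
move=> [mf [C fC]]; apply/integrableP; split; first exact/measurable_EFinP.
apply: (@le_lt_trans _ _ (\int[P]_w (cst C%:E) w)%E).
  apply: ge0_le_integral => //.
  - by apply/measurableT_comp => //; exact/measurable_EFinP.
  - by move=> w _; rewrite /= lee_fin; exact: le_trans (fC w).
by rewrite integral_cst//= probability_setT mule1 ltry.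
Qed.

Lemma ExE f : bmf f -> (\int[P]_w (f w)%:E)%E = (Ex f)%:E.
Proof.
move=> bf; rewrite /Ex /Rintegral fineK//; apply: integrable_fin_num => //.
exact: bmf_integrable.
Qed.

Lemma Ex_ext f g : (forall w, f w = g w) -> Ex f = Ex g.
Proof. by move=> fg; congr Ex; exact/funext. Qed.

Lemma Ex_cst (c : R) : Ex (fun=> c) = c.
Proof. by rewrite /Ex /Rintegral integral_cst//= probability_setT mule1. Qed.

Lemma ExD f g : bmf f -> bmf g -> Ex (fun w => f w + g w) = Ex f + Ex g.
Proof. by move=> bf bg; rewrite /Ex RintegralD//; exact: bmf_integrable. Qed.

Lemma ExB f g : bmf f -> bmf g -> Ex (fun w => f w - g w) = Ex f - Ex g.
Proof. by move=> bf bg; rewrite /Ex RintegralB//; exact: bmf_integrable. Qed.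

Lemma ExZ (c : R) f : bmf f -> Ex (fun w => c * f w) = c * Ex f.
Proof. by move=> bf; rewrite /Ex RintegralZl//; exact: bmf_integrable. Qed.

Lemma Ex_le f g : bmf f -> bmf g -> (forall w, f w <= g w) -> Ex f <= Ex g.
Proof.
by move=> bf bg fg; apply: le_Rintegral => //; exact: bmf_integrable.
Qed.

Lemma Ex_ge0 f : (forall w, 0 <= f w) -> 0 <= Ex f.
Proof. by move=> f0; exact: Rintegral_ge0. Qed.

Lemma Ex_sum (I : Type) (s : seq I) (p : pred I) (F : I -> T -> R) :
  (forall i, bmf (F i)) ->
  Ex (fun w => \sum_(i <- s | p i) F i w) = \sum_(i <- s | p i) Ex (F i).
Proof.
move=> bF; elim: s => [|i s ih].
  by rewrite big_nil; under Ex_ext do rewrite big_nil; rewrite Ex_cst.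
rewrite big_cons -ih; under Ex_ext do rewrite big_cons.
by case: (p i) => //; rewrite ExD//; exact: bmf_sum.
Qed.

Lemma Ex_indic (A : set T) : measurable A -> (Ex (\1_A))%:E = P A.
Proof.
move=> mA; rewrite -ExE; last exact: bmf_indic.
by rewrite integral_indic// setIT.
Qed.

Lemma Ex_ae f g : measurable_fun setT f -> measurable_fun setT g ->
  {ae P, forall w, f w = g w} -> Ex f = Ex g.
Proof.
move=> mf mg fg; rewrite /Ex /Rintegral; congr fine.
apply: ae_eq_integral => //; [exact/measurable_EFinP..|].
by apply: filterS fg => w /= -> _.
Qed.

End bounded_expectation.

(** * Beta laws and independence *)

Section weighted_law.
Import HBNNSimple.
Context d1 (T1 : measurableType d1) d2 (T2 : measurableType d2) (R : realType).
Context (mu1 : {measure set T1 -> \bar R}) (mu2 : {measure set T2 -> \bar R}).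
Context (X1 Z1 : T1 -> R) (X2 Z2 : T2 -> R).
Hypotheses (mX1 : measurable_fun setT X1) (mZ1 : measurable_fun setT Z1).
Hypotheses (mX2 : measurable_fun setT X2) (mZ2 : measurable_fun setT Z2).
Hypotheses (Z1_ge0 : forall x, 0 <= Z1 x) (Z2_ge0 : forall x, 0 <= Z2 x).
Hypothesis same : forall A, measurable A ->
  (\int[mu1]_x (Z1 x * \1_A (X1 x))%:E = \int[mu2]_x (Z2 x * \1_A (X2 x))%:E)%E.

Let same_simple (g : {nnsfun measurableTypeR R >-> R}) :
  (\int[mu1]_x (Z1 x * g (X1 x))%:E = \int[mu2]_x (Z2 x * g (X2 x))%:E)%E.
Proof.
have step d (T : measurableType d) (mu : {measure set T -> \bar R}) (X Z : T -> R) :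
    measurable_fun setT X -> measurable_fun setT Z -> (forall x, 0 <= Z x) ->
    (\int[mu]_x (Z x * g (X x))%:E =
     \sum_(y \in range g) (y%:E * \int[mu]_x (Z x * \1_(g @^-1` [set y]) (X x))%:E))%E.
  move=> mX mZ Z0.
  have mg y : measurable_fun setT (fun x => Z x * \1_(g @^-1` [set y]) (X x) : R).
    apply: measurable_funM => //.
    by apply: (measurableT_comp (measurable_indic _)).
  under eq_integral => x _.
    rewrite fimfunE mulr_fsumr// -fsumEFin//.
    under eq_fsbigr do rewrite mulrCA EFinM.
    over.
  rewrite ge0_integral_fsum//; last 2 first.
  - by move=> y; apply: emeasurable_funM => //; exact/measurable_EFinP.
  - move=> y x _; rewrite -EFinM lee_fin.
    have [[x' _ <-]|ny] := pselect (range g y).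
      by rewrite !mulr_ge0.
    rewrite indicE (_ : _ \in _ = false) ?mulr0//.
    by apply/memNset => /= h; apply: ny; exists (X x).
  apply: eq_fsbigr => y; rewrite inE => -[x' _ <-].
  rewrite ge0_integralZl//.
  - by apply/measurable_EFinP.
  - by move=> x _; rewrite lee_fin mulr_ge0.
  - by rewrite lee_fin.
rewrite !step//; apply: eq_fsbigr => y _; congr (_ * _)%E; apply: same.
rewrite -[X in measurable X]setTI; have := measurable_funPT g => mg.
by apply: mg.
Qed.

(** Two random variables with weights, on two different spaces, are compared so as
    to serve twice: for the change of variables under a density (the weight of the
    target being the density), and for the passage from independent events to
    independent functions (the weight being a function of the other variables). *)
Lemma weighted_law (h : R -> R) : measurable_fun setT h -> (forall x, 0 <= h x) ->
  (\int[mu1]_x (Z1 x * h (X1 x))%:E = \int[mu2]_x (Z2 x * h (X2 x))%:E)%E.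
Proof.
move=> mh h0.
have [g [ndg gh]] := @approximation _ (measurableTypeR R) R setT measurableT (EFin \o h)
   ((measurable_EFinP _ _).2 mh) (fun x _ => h0 x).
have step d (T : measurableType d) (mu : {measure set T -> \bar R}) (X Z : T -> R) :
    measurable_fun setT X -> measurable_fun setT Z -> (forall x, 0 <= Z x) ->
    (\int[mu]_x (Z x * h (X x))%:E = limn (fun n => \int[mu]_x (Z x * g n (X x))%:E))%E.
  move=> mX mZ Z0.
  rewrite -monotone_convergence//; last 3 first.
  - move=> n; apply/measurable_EFinP; apply: measurable_funM => //.
    exact: (measurableT_comp (measurable_funPT (g n)) mX).
  - by move=> n x _; rewrite lee_fin mulr_ge0.
  - move=> x _ m n mn; rewrite lee_fin ler_wpM2l//.
    by have /lefP := ndg _ _ mn; apply.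
  apply: eq_integral => x _; apply/esym/cvg_lim => //.
  under eq_fun do rewrite EFinM.
  rewrite EFinM; apply: cvgeZl => //.
  exact: gh.
by rewrite !step//; congr (limn _); apply/funext => n; exact: same_simple.
Qed.

End weighted_law.

Section beta_law.
Context d (T : measurableType d) (R : realType) (P : probability T R).
Notation mu := (@lebesgue_measure R).

Lemma measurable_Beta_kernel (a b : R) :
  measurable_fun setT (fun x : R => x `^ (a - 1) * (1 - x) `^ (b - 1)).
Proof.
apply: measurable_funM; first exact: measurable_powR.
apply: (@measurableT_comp _ _ _ _ _ _ (fun y : R => y `^ (b - 1))); first exact: measurable_powR.
exact: measurable_funB.
Qed.

Lemma measurable_Beta_pdf (a b : R) : measurable_fun setT (Beta_pdf a b).
Proof.
apply/(measurable_restrictT _ _).1 => //.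
apply: measurable_funTS; apply: measurable_funM => //.
exact: measurable_Beta_kernel.
Qed.

Lemma Beta_pdf_ge0 (a b x : R) : 0 <= Beta_pdf a b x.
Proof.
rewrite /Beta_pdf patchE; case: ifP => // _.
by rewrite divr_ge0 ?Beta_ge0// mulr_ge0 ?powR_ge0.
Qed.

Lemma integral_Beta_law (X : {RV P >-> R}) (a b : R) (h : R -> R) :
  has_pdf P X (Beta_pdf a b) -> measurable_fun setT h -> (forall x, 0 <= h x) ->
  (\int[P]_w (h (X w))%:E =
   \int[mu]_(x in `]0%R, 1%R[) (x `^ (a - 1) * (1 - x) `^ (b - 1) * h x / Beta_fun a b)%:E)%E.
Proof.
move=> pdfX mh h0.
have mpdf := measurable_Beta_pdf a b.
transitivity (\int[mu]_x (Beta_pdf a b x * h x)%:E)%E.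
  have := @weighted_law _ _ _ _ R P mu X (cst 1) id (Beta_pdf a b) _ _ _ mpdf
    (fun=> ler01) (Beta_pdf_ge0 a b) _ h mh h0.
  under eq_integral do rewrite mul1r.
  apply => //.
  move=> A mA; under eq_integral do rewrite mul1r.
  transitivity (P (X @^-1` A)).
    rewrite (_ : (fun w => _) = (fun w => (\1_(X @^-1` A) w)%:E)).
      rewrite integral_indic ?setIT// -[X in measurable X]setTI.
      by apply: measurable_funPT.
    by apply/funext => w; rewrite !indicE; congr ((_ : bool)%:R%:E); apply/idP/idP; rewrite !inE.
  rewrite pdfX// [LHS]integral_mkcond; congr (integral _ _ _); apply/funext => x.
  by rewrite patchE indicE; case: (x \in A); rewrite ?mulr1 ?mulr0.
transitivity (\int[mu]_(x in `[0%R, 1%R]) (x `^ (a - 1) * (1 - x) `^ (b - 1) * h x / Beta_fun a b)%:E)%E.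
  rewrite [RHS]integral_mkcond; apply: eq_integral => x _.
  rewrite /Beta_pdf !patchE; case: ifPn => _; last by rewrite mul0r.
  by rewrite mulrAC.
have mk : measurable_fun setT (fun x : R => (x `^ (a - 1) * (1 - x) `^ (b - 1) * h x / Beta_fun a b)).
  by apply: measurable_funM => //; apply: measurable_funM => //; exact: measurable_Beta_kernel.
rewrite -integral_itv_obnd_cbnd; last first.
  by apply/measurable_funTS; exact: measurableT_comp.
rewrite -integral_itv_bndo_bndc//.
by apply/measurable_funTS; exact: measurableT_comp.
Qed.

Let Beta_integrable_oo (a b : R) : 0 < a -> 0 < b ->
  mu.-integrable `]0, 1[ (fun x => (x `^ (a - 1) * (1 - x) `^ (b - 1))%:E).
Proof. by move=> a0 b0; apply: integrableS (Beta_integrable a0 b0) => //; exact: subset_itvW. Qed.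

Let integral_Beta (a b : R) : 0 < a -> 0 < b ->
  (\int[mu]_(x in `]0%R, 1%R[) (x `^ (a - 1) * (1 - x) `^ (b - 1))%:E = (Beta_fun a b)%:E)%E.
Proof.
move=> a0 b0; have i1 := Beta_integrable_oo a0 b0.
rewrite /Beta_fun -Rintegral_itv_obnd_cbnd; last first.
  apply: integrableS (Beta_integrable a0 b0) => //.
  by apply: subset_itvr; rewrite bnd_simp.
rewrite -Rintegral_itv_bndo_bndc//.
by rewrite /Rintegral fineK//; exact: integrable_fin_num.
Qed.

Lemma Beta_ae01 (X : {RV P >-> R}) (a b : R) : 0 < a -> 0 < b ->
  has_pdf P X (Beta_pdf a b) -> {ae P, forall w, 0 < X w < 1}.
Proof.
move=> a0 b0 pdfX.
have mA : measurable (X @^-1` `]0, 1[).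
  by rewrite -[X in measurable X]setTI; apply: measurable_funPT.
have B0 := Beta_gt0 a0 b0.
have P1 : P (X @^-1` `]0, 1[) = 1%E.
  transitivity (\int[P]_w (\1_(`]0, 1[ : set R) (X w))%:E)%E.
    rewrite (_ : (fun w => _) = (fun w => (\1_(X @^-1` `]0, 1[) w)%:E)).
      by rewrite integral_indic ?setIT.
    by apply/funext => w; rewrite !indicE; congr ((_ : bool)%:R%:E); apply/idP/idP; rewrite !inE.
  rewrite (integral_Beta_law pdfX)//.
  under eq_integral => x xin do rewrite indicE xin mulr1.
  under eq_integral do rewrite EFinM.
  by rewrite integralZr ?Beta_integrable_oo// integral_Beta// -EFinM divff// gt_eqF.
have P0 : P (~` (X @^-1` `]0, 1[)) = 0%E by rewrite probability_setC// P1 subee.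
exists (~` (X @^-1` `]0, 1[)); split => //; first exact: measurableC.
Qed.

Lemma Ex_Beta (X : {RV P >-> R}) (a b p q : R) (h : R -> R) : 0 < a -> 0 < b -> 0 <= p -> 0 <= q ->
  has_pdf P X (Beta_pdf a b) -> measurable_fun setT h -> (forall x, 0 <= h x) ->
  (forall x, 0 < x < 1 -> h x = x `^ p * (1 - x) `^ q) ->
  Ex P (fun w => h (X w)) = Beta_fun (a + p) (b + q) / Beta_fun a b.
Proof.
move=> a0 b0 p0 q0 pdfX mh h0 hE.
have ap : 0 < a + p by rewrite ltr_wpDr.
have bq : 0 < b + q by rewrite ltr_wpDr.
rewrite /Ex /Rintegral (integral_Beta_law pdfX)//.
under eq_integral => x.
  rewrite inE/= in_itv/= => x01; have /andP[x0 x1] := x01.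
  rewrite hE// mulrACA -powRDp// -powRDp ?subr_gt0// EFinM.
  rewrite (addrAC a) (addrAC b).
  over.
by rewrite integralZr ?Beta_integrable_oo// integral_Beta.
Qed.

End beta_law.

Section clamp.
Context {R : realType}.

(** The sticks have values in [0, 1] only almost surely; clamping them makes the
    bounds hold everywhere at no cost, as almost sure equality preserves
    expectations. *)
Definition clamp (x : R) : R := Num.max 0 (Num.min x 1).

Lemma clamp01 x : 0 <= clamp x <= 1.
Proof. by rewrite /clamp le_max lexx/= ge_max ler01 ge_min lexx orbT. Qed.

Lemma clampE x : 0 <= x <= 1 -> clamp x = x.
Proof. by move=> /andP[x0 x1]; rewrite /clamp (min_idPl x1) (max_idPr x0). Qed.

Lemma measurable_clamp : measurable_fun setT clamp.
Proof. by apply: measurable_maxr => //; exact: measurable_minr. Qed.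

Definition ubm (f : R -> R) := measurable_fun setT f /\
  exists C, forall x, 0 <= x <= 1 -> 0 <= f x <= C.

Lemma ubm_cst c : 0 <= c -> ubm (fun=> c).
Proof. by move=> c0; split; [exact: measurable_cst|exists c => x _; rewrite c0 lexx]. Qed.

Lemma ubm_powC (p : R) : 0 <= p -> ubm (fun x => (1 - x) `^ p).
Proof.
move=> p0; split.
  apply: (@measurableT_comp _ _ _ _ _ _ (fun y : R => y `^ p)); first exact: measurable_powR.
  exact: measurable_funB.
exists 1 => x /andP[x0 x1]; rewrite powR_ge0 powR_le1//.
by rewrite subr_ge0 x1 gerBl.
Qed.

Lemma ubm_id : ubm id.
Proof. by split => //; exists 1. Qed.

Lemma ubm_onem : ubm (fun x => 1 - x).
Proof.
split; first exact: measurable_funB.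
by exists 1 => x /andP[x0 x1]; rewrite subr_ge0 x1 gerBl.
Qed.

Lemma ubmM f g : ubm f -> ubm g -> ubm (fun x => f x * g x).
Proof.
move=> [mf [C fC]] [mg [D gD]]; split; first exact: measurable_funM.
exists (C * D) => x x01; have /andP[f0 f1] := fC x x01; have /andP[g0 g1] := gD x x01.
by rewrite mulr_ge0// ler_pM.
Qed.

Lemma ubm_exp f n : ubm f -> ubm (fun x => f x ^+ n).
Proof.
move=> uf; elim: n => [|n ih]; first by under eq_fun do rewrite expr0; exact: ubm_cst.
by under eq_fun do rewrite exprS; exact: ubmM.
Qed.

End clamp.

Section independence.
Context d (T : measurableType d) (R : realType) (P : probability T R).
Notation Ex := (Ex P).

Lemma ubm_comp (f : R -> R) (U : T -> R) : ubm f -> measurable_fun setT U ->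
  (forall w, 0 <= U w <= 1) -> bmf (fun w => f (U w)).
Proof.
move=> [mf [C fC]] mU U01; split; first exact: measurableT_comp.
by exists C => w; have /andP[f0 f1] := fC _ (U01 w); rewrite ger0_norm.
Qed.

Lemma independent_events (H : nat -> {RV P >-> R}) (k : nat) (A : nat -> set R) :
  mutually_independent P H -> (forall i, measurable (A i)) ->
  Ex (fun w => \prod_(i < k) \1_(A i) (H i w)) = \prod_(i < k) Ex (fun w => \1_(A i) (H i w)).
Proof.
move=> indH mA.
have mHA i : measurable (H i @^-1` A i).
  by rewrite -[X in measurable X]setTI; apply: measurable_funPT.
have e1 i w : \1_(A i) (H i w) = \1_(H i @^-1` A i) w :> R.
  by rewrite !indicE; congr ((_ : bool)%:R); apply/idP/idP; rewrite !inE.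
have := indH [fset i in iota 0 k]%fset A mA.
set B := \bigcap_(i in _) _.
have mB : measurable B.
  by apply: fin_bigcap_measurable => //; exact: finite_fset.
rewrite -(Ex_indic P mB) => -[E].
transitivity (Ex (\1_B)).
  apply: Ex_ext => w.
  rewrite indicE; have [wB|wB] := boolP (w \in B).
    apply: big1 => i _; rewrite e1 indicE (_ : _ \in _ = true)//.
    apply/mem_set; apply: (set_mem wB (i : nat)); rewrite /= inE mem_iota/= add0n.
    exact: ltn_ord.
  have [i ik nwA] : exists2 i, (i < k)%N & ~ (H i @^-1` A i) w.
    apply: contrapT => nex; move: wB; rewrite notin_setE; apply => i /=.
    rewrite inE mem_iota/= add0n => ik; apply: contrapT => nw.
    by apply: nex; exists i.
  rewrite (bigD1 (Ordinal ik))//= e1 indicE (_ : _ \in _ = false) ?mul0r//.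
  exact/memNset.
rewrite E.
transitivity (\prod_(i <- iota 0 k) fine (P (H i @^-1` A i))).
  apply: perm_big; rewrite uniq_perm ?iota_uniq// ?fset_uniq// => x.
  by rewrite !inE.
have -> : iota 0 k = index_iota 0 k by rewrite /index_iota subn0.
rewrite big_mkord.
by apply: eq_bigr => i _; rewrite -Ex_indic//=; apply: Ex_ext => w; rewrite e1.
Qed.

Lemma Ex_weighted (X Z1 Z2 : T -> R) : bmf Z1 -> bmf Z2 -> measurable_fun setT X ->
  (forall w, 0 <= Z1 w) -> (forall w, 0 <= Z2 w) -> (forall w, 0 <= X w <= 1) ->
  (forall A, measurable A -> Ex (fun w => Z1 w * \1_A (X w)) = Ex (fun w => Z2 w * \1_A (X w))) ->
  forall h, ubm h -> Ex (fun w => Z1 w * h (X w)) = Ex (fun w => Z2 w * h (X w)).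
Proof.
move=> b1 b2 mX Z10 Z20 X01 same h uh.
have [mh [C hC]] := uh.
have h'0 x : 0 <= h (clamp x) by have /andP[] := hC _ (clamp01 x).
have mh' : measurable_fun setT (fun x => h (clamp x)).
  by apply: measurableT_comp => //; exact: measurable_clamp.
have bi A : measurable A -> bmf (fun w => \1_A (X w) : R).
  move=> mA; apply: bmf_unit; last by move=> w; rewrite indicE; case: (_ \in _); rewrite ?ler01 lexx.
  exact: measurableT_comp.
have same' A : measurable A -> (\int[P]_x (Z1 x * \1_A (X x))%:E = \int[P]_x (Z2 x * \1_A (X x))%:E)%E.
  by move=> mA; rewrite !ExE ?same//; apply: bmfM => //; exact: bi.
have := @weighted_law _ _ _ _ R P P X Z1 X Z2 mX (bmf_measurable b1) mX (bmf_measurable b2)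
  Z10 Z20 same' _ mh' h'0.
have bh : bmf (fun w => h (X w)) by exact: ubm_comp.
under eq_integral do rewrite clampE//.
under [in X in _ = X -> _]eq_integral do rewrite clampE//.
by rewrite !ExE; [case|exact: bmfM..].
Qed.

(** The functions are replaced by indicators one index at a time: S m is the case
    in which those of index at least m are already indicators, and the step from
    m to m + 1 integrates over the law of the m-th variable, weighted by the
    product of the others. *)
Lemma independent_prod (H : nat -> {RV P >-> R}) (k : nat) (f : nat -> R -> R) :
  mutually_independent P H -> (forall i, ubm (f i)) ->
  Ex (fun w => \prod_(i < k) f i (clamp (H i w))) = \prod_(i < k) Ex (fun w => f i (clamp (H i w))).
Proof.
move=> indH uf.
pose U i w := clamp (H i w).
have mU i : measurable_fun setT (U i).
  by apply: measurableT_comp; [exact: measurable_clamp|exact: measurable_funPT].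
have U01 i w : 0 <= U i w <= 1 by exact: clamp01.
suff S m : forall f : nat -> R -> R, (forall i, ubm (f i)) ->
    (forall i, (m <= i < k)%N -> exists2 A, measurable A & f i = \1_A) ->
    Ex (fun w => \prod_(i < k) f i (U i w)) = \prod_(i < k) Ex (fun w => f i (U i w)).
  by apply: (S k f uf) => i; rewrite leqNgt andNb.
elim: m => [|m ih] {}f {}uf find.
  have /choice[A mA] : forall i, exists A, measurable A /\ ((i < k)%N -> f i = \1_A).
    move=> i; have [ik|ki] := ltnP i k; last by exists setT.
    by have [//|A mA fA] := find i; exists A.
  have mA' i : measurable (clamp @^-1` A i : set R).
    by rewrite -[X in measurable X]setTI; apply: measurable_clamp => //; have [] := mA i.
  have e (i : 'I_k) w : f i (U i w) = \1_(clamp @^-1` A i) (H i w) :> R.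
    have [_ fA] := mA i; rewrite (fA (ltn_ord i)) !indicE.
    by congr ((_ : bool)%:R); apply/idP/idP; rewrite !inE.
  transitivity (Ex (fun w => \prod_(i < k) \1_(clamp @^-1` A i) (H i w))).
    by apply: Ex_ext => w; apply: eq_bigr => i _; rewrite e.
  rewrite (independent_events k indH mA').
  by apply: eq_bigr => i _; apply: Ex_ext => w; rewrite e.
have [mk|km] := ltnP m k; last first.
  by apply: ih => // i /andP[mi]; rewrite ltnNge (leq_trans km mi).
pose Z w := \prod_(i < k | i != m :> nat) f i (U i w).
pose c := \prod_(i < k | i != m :> nat) Ex (fun w => f i (U i w)).
have bfU i : bmf (fun w => f i (U i w)) by apply: ubm_comp.
have fU0 i w : 0 <= f i (U i w) by have [_ [C /(_ _ (U01 i w))/andP[]]] := uf i.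
have bZ : bmf Z by apply: bmf_prod.
have Z0 w : 0 <= Z w by apply: prodr_ge0.
have c0 : 0 <= c by apply: prodr_ge0 => i _; apply: Ex_ge0.
have E1 g : (fun w => \prod_(i < k) (if i == m :> nat then g else f i) (U i w)) =
            (fun w => Z w * g (U m w)).
  apply/funext => w; rewrite (bigD1 (Ordinal mk))//= eqxx mulrC; congr (_ * _).
  apply: eq_big => [i //|i im].
  by rewrite (_ : (i == m :> nat) = false)//; apply: negbTE; move: im; rewrite -val_eqE.
have E2 g : \prod_(i < k) Ex (fun w => (if i == m :> nat then g else f i) (U i w)) =
            c * Ex (fun w => g (U m w)).
  rewrite (bigD1 (Ordinal mk))//= eqxx mulrC; congr (_ * _).
  apply: eq_big => [i //|i im].
  by rewrite (_ : (i == m :> nat) = false)//; apply: negbTE; move: im; rewrite -val_eqE.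
have e3 : f = fun i => if i == m then f m else f i.
  by apply/funext => i; case: eqP => [->|].
rewrite [in LHS]e3 [in RHS]e3 E1 E2 -ExZ//.
apply: (@Ex_weighted (U m) Z (fun=> c)) => //; first exact: bmf_cst.
move=> A mA.
have uA : ubm (\1_A : R -> R).
  split; first exact: measurable_indic.
  by exists 1 => x _; rewrite indicE; case: (_ \in _); rewrite ?ler01 lexx.
have bA : bmf (fun w => \1_A (U m w) : R) by apply: ubm_comp.
rewrite ExZ// -E1 -E2; apply: (ih (fun i => if i == m then \1_A else f i)).
  by move=> i; case: eqP.
move=> i /andP[mi ik]; case: eqP => [_|/eqP im]; first by exists A.
by apply: find; rewrite ltn_neqAle eq_sym im mi.
Qed.

End independence.

(** * Functionals of the first variables *)

Section span.
Context d (T : measurableType d) (R : realType) (P : probability T R).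
Notation Ex := (Ex P).
Context (U : nat -> T -> R).
Hypotheses (mU : forall i, measurable_fun setT (U i)) (U01 : forall i w, 0 <= U i w <= 1).
Hypothesis indU : forall k (f : nat -> R -> R), (forall i, ubm (f i)) ->
  Ex (fun w => \prod_(i < k) f i (U i w)) = \prod_(i < k) Ex (fun w => f i (U i w)).

(** An elementary substitute for measurability with respect to the first k
    variables: sums of products of one-variable functions contain every
    functional of the sticks used below, and factor against the next variable by
    the product form of independence alone. *)
Inductive span (k : nat) : (T -> R) -> Prop :=
| span_prod (c : R) (f : nat -> R -> R) : (forall i, ubm (f i)) ->
    span k (fun w => c * \prod_(i < k) f i (U i w))
| span_add Z1 Z2 : span k Z1 -> span k Z2 -> span k (fun w => Z1 w + Z2 w).

Lemma span_ext k Z1 Z2 : span k Z1 -> (forall w, Z1 w = Z2 w) -> span k Z2.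
Proof. by move=> sZ /funext <-. Qed.

Lemma span_cst k c : span k (fun=> c).
Proof.
apply: (span_ext (span_prod k c (f := fun _ => fun=> 1) _)).
  by move=> i; apply: ubm_cst.
by move=> w; rewrite big1 ?mulr1.
Qed.

Lemma spanZ k c Z : span k Z -> span k (fun w => c * Z w).
Proof.
elim=> [c' f uf|Z1 Z2 _ s1 _ s2].
  by apply: (span_ext (span_prod k (c * c') uf)) => w; rewrite mulrA.
by apply: (span_ext (span_add s1 s2)) => w; rewrite mulrDr.
Qed.

Lemma spanM k Z Z' : span k Z -> span k Z' -> span k (fun w => Z w * Z' w).
Proof.
move=> sZ sZ'; elim: sZ => [c f uf|Z1 Z2 _ s1 _ s2]; last first.
  by apply: (span_ext (span_add s1 s2)) => w; rewrite mulrDl.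
elim: sZ' => [c' f' uf'|Z1 Z2 _ s1 _ s2]; last first.
  by apply: (span_ext (span_add s1 s2)) => w; rewrite mulrDr.
apply: (span_ext (span_prod k (c * c') (f := fun i x => f i x * f' i x) _)).
  by move=> i; exact: ubmM.
by move=> w; rewrite big_split/= mulrACA.
Qed.

Lemma spanB k Z Z' : span k Z -> span k Z' -> span k (fun w => Z w - Z' w).
Proof.
move=> sZ /(spanZ (-1)) sZ'.
by apply: (span_ext (span_add sZ sZ')) => w; rewrite mulN1r.
Qed.

Lemma spanX k Z n : span k Z -> span k (fun w => Z w ^+ n).
Proof.
move=> sZ; elim: n => [|n ih]; first by apply: (span_ext (span_cst k 1)) => w; rewrite expr0.
by apply: (span_ext (spanM sZ ih)) => w; rewrite exprS.
Qed.

Lemma span_sum k (I : Type) (s : seq I) (p : pred I) (F : I -> T -> R) :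
  (forall i, span k (F i)) -> span k (fun w => \sum_(i <- s | p i) F i w).
Proof.
move=> sF; elim: s => [|i s ih].
  by apply: (span_ext (span_cst k 0)) => w; rewrite big_nil.
case pi : (p i).
  by apply: (span_ext (span_add (sF i) ih)) => w; rewrite big_cons pi.
by apply: (span_ext ih) => w; rewrite big_cons pi.
Qed.

Lemma span_proj k i (f : R -> R) : (i < k)%N -> ubm f -> span k (fun w => f (U i w)).
Proof.
move=> ik uf.
apply: (span_ext (span_prod k 1 (f := fun j => if j == i then f else fun=> 1) _)).
  by move=> j; case: eqP => // _; apply: ubm_cst.
move=> w; rewrite mul1r (bigD1 (Ordinal ik))//= eqxx big1 ?mulr1// => j ji.
by rewrite (_ : (j == i :> nat) = false)//; apply: negbTE; move: ji; rewrite -val_eqE.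
Qed.

Lemma spanW k l Z : (k <= l)%N -> span k Z -> span l Z.
Proof.
move=> kl; elim=> [c f uf|Z1 Z2 _ s1 _ s2]; last exact: span_add.
apply: (span_ext (span_prod l c (f := fun j => if (j < k)%N then f j else fun=> 1) _)).
  by move=> j; case: ifP => // _; apply: ubm_cst.
move=> w; congr (_ * _).
rewrite (big_ord_widen l (fun i => f i (U i w)) kl) [RHS]big_mkcond/=.
by apply: eq_bigr => i _; case: ifP.
Qed.

Lemma span_prefix k (f : R -> R) : ubm f -> span k (fun w => \prod_(i < k) f (U i w)).
Proof. by move=> uf; apply: (span_ext (span_prod k 1 (f := fun=> f) _)) => // w; rewrite mul1r. Qed.

Lemma span_bmf k Z : span k Z -> bmf Z.
Proof.
elim=> [c f uf|Z1 Z2 _ s1 _ s2]; last exact: bmfD.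
by apply: bmfZ; apply: bmf_prod => i; exact: ubm_comp.
Qed.

Lemma Ex_span k Z (h : R -> R) : span k Z -> ubm h ->
  Ex (fun w => Z w * h (U k w)) = Ex Z * Ex (fun w => h (U k w)).
Proof.
move=> sZ uh; have bh : bmf (fun w => h (U k w)) by exact: ubm_comp.
elim: sZ => [c f uf|Z1 Z2 s1 ih1 s2 ih2]; last first.
  under Ex_ext do rewrite mulrDl.
  have b1 := span_bmf s1; have b2 := span_bmf s2.
  by rewrite !ExD ?ih1 ?ih2 ?mulrDl//; exact: bmfM.
pose g i := if (i < k)%N then f i else h.
have ug i : ubm (g i) by rewrite /g; case: ifP.
have e (i : 'I_k) : g i = f i by rewrite /g ltn_ord.
have ek : g k = h by rewrite /g ltnn.
have bf : bmf (fun w => \prod_(i < k) f i (U i w)) by apply: bmf_prod => i; exact: ubm_comp.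
under Ex_ext do rewrite -mulrA.
rewrite !ExZ//; last exact: bmfM.
rewrite -mulrA; congr (_ * _).
transitivity (Ex (fun w => \prod_(i < k.+1) g i (U i w))).
  apply: Ex_ext => w; rewrite big_ord_recr/= ek; congr (_ * _).
  by apply: eq_bigr => i _; rewrite e.
rewrite indU// big_ord_recr/= ek indU//; congr (_ * _).
by apply: eq_bigr => i _; rewrite e.
Qed.

End span.

(** * Limits of real sequences *)

Section cvg_helpers.
Context {R : realType}.

Lemma cvgE (u : nat -> R) (l l' : R) : u n @[n --> \oo] --> l -> l = l' ->
  u n @[n --> \oo] --> l'.
Proof. by move=> ul <-. Qed.

Lemma cvg_ext (u v : nat -> R) (l : R) : (forall n, u n = v n) ->
  u n @[n --> \oo] --> l -> v n @[n --> \oo] --> l.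
Proof. by move=> /funext ->. Qed.

Lemma cvg_ext_near (u v : nat -> R) (l : R) : (\forall n \near \oo, u n = v n) ->
  u n @[n --> \oo] --> l -> v n @[n --> \oo] --> l.
Proof. by move=> uv; apply: cvg_trans; exact: near_eq_cvg. Qed.

Lemma cvg_mul (u v : nat -> R) (l l' : R) : u n @[n --> \oo] --> l ->
  v n @[n --> \oo] --> l' -> u n * v n @[n --> \oo] --> l * l'.
Proof. by move=> ul vl; exact: cvgM. Qed.

Lemma cvg_scale (c : R) (u : nat -> R) (l : R) : u n @[n --> \oo] --> l ->
  c * u n @[n --> \oo] --> c * l.
Proof. by move=> ul; apply: cvg_mul => //; exact: cvg_cst. Qed.

Lemma cvg_inv1 (u : nat -> R) : u n @[n --> \oo] --> (1 : R) ->
  (u n)^-1 @[n --> \oo] --> (1 : R).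
Proof. by move=> u1; rewrite -[X in _ --> X]invr1; apply: cvgV => //; exact: oner_neq0. Qed.

Lemma cvgMl1 (u v : nat -> R) (l : R) : u n @[n --> \oo] --> l ->
  v n @[n --> \oo] --> (1 : R) -> u n * v n @[n --> \oo] --> l.
Proof. by move=> ul v1; apply: (cvgE (cvg_mul ul v1)); rewrite mulr1. Qed.

Lemma cvg_powR (u : nat -> R) (l p : R) : 0 < l -> u n @[n --> \oo] --> l ->
  u n `^ p @[n --> \oo] --> l `^ p.
Proof.
by move=> l0 ul; apply: (@continuous_cvg _ _ _ _ _ u (fun x : R => x `^ p)) => //; exact: powR_continuous.
Qed.

Lemma cvg_powR1 (u : nat -> R) (p : R) : u n @[n --> \oo] --> (1 : R) ->
  u n `^ p @[n --> \oo] --> (1 : R).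
Proof.
by move=> /(cvg_powR (p := p) ltr01) h; apply: (cvgE h); rewrite powR1.
Qed.

Lemma cvg_invS : (n.+1%:R : R)^-1 @[n --> \oo] --> (0 : R).
Proof. exact: cvg_harmonic. Qed.

Lemma cvg_inv0 : (n%:R : R)^-1 @[n --> \oo] --> (0 : R).
Proof. rewrite -cvg_shiftS; exact: cvg_harmonic. Qed.

Lemma cvg_affine_ratio (a b : R) : 0 < a ->
  (b + n%:R * a) / (n%:R * a) @[n --> \oo] --> (1 : R).
Proof.
move=> a0; apply: (@cvg_ext_near (fun n => 1 + b / a * n%:R^-1)).
  exists 1%N => // n /= n1; have n0 : 0 < n%:R :> R by rewrite ltr0n.
  by field; rewrite !gt_eqF.
apply: (@cvgE _ (1 + b / a * 0)); last by rewrite mulr0 addr0.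
apply: cvgD; first exact: cvg_cst.
by apply: cvgM; [exact: cvg_cst|exact: cvg_inv0].
Qed.

Lemma cvg_affine_inv (a b : R) : 0 < a -> (b + n%:R * a)^-1 @[n --> \oo] --> (0 : R).
Proof.
move=> a0; apply: (@cvg_ext_near (fun n => ((b + n%:R * a) / (n%:R * a))^-1 * (a^-1 * n%:R^-1))).
  exists 1%N => // n /= n1; have n0 : 0 < n%:R :> R by rewrite ltr0n.
  by rewrite invf_div mulrAC -invfM (mulrC a) mulfV ?mul1r// gt_eqF// mulr_gt0.
apply: (@cvgE _ (1^-1 * (a^-1 * 0))); last by rewrite !mulr0.
apply: cvgM; first by apply: cvgV; [exact: oner_neq0|exact: cvg_affine_ratio].
by apply: cvgM; [exact: cvg_cst|exact: cvg_inv0].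
Qed.

End cvg_helpers.

(** * Moments of the normalised rests *)

Section stick_moments.
Context d (T : measurableType d) (R : realType) (P : probability T R).
Notation Ex := (Ex P).
Notation Gamma := (@Gamma_fun R).
Notation Beta := (@Beta_fun R).
Context (alpha theta : R) (alpha_gt0 : 0 < alpha) (alpha_lt1 : alpha < 1) (theta_gt : - alpha < theta).
Context (U : nat -> T -> R).
Hypotheses (mU : forall i, measurable_fun setT (U i)) (U01 : forall i w, 0 <= U i w <= 1).
Hypothesis indU : forall k (f : nat -> R -> R), (forall i, ubm (f i)) ->
  Ex (fun w => \prod_(i < k) f i (U i w)) = \prod_(i < k) Ex (fun w => f i (U i w)).

Definition stick_b (i : nat) : R := theta + i.+1%:R * alpha.
Let b := stick_b.
Hypothesis momU : forall i (p q : R), 0 <= p -> 0 <= q ->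
  Ex (fun w => U i w `^ p * (1 - U i w) `^ q) = Beta (1 - alpha + p) (b i + q) / Beta (1 - alpha) (b i).

Definition rest (k : nat) (w : T) : R := \prod_(i < k) (1 - U i w).
Notation V := rest.

Lemma stick_b_gt0 i : 0 < b i.
Proof.
rewrite /b /stick_b -natr1 mulrDl mul1r.
have h : 0 <= i%:R * alpha by rewrite mulr_ge0// ltW.
move: alpha_gt0 theta_gt h => h1 h2 h3; lra.
Qed.

Let a1 : 0 < 1 - alpha. Proof. by rewrite subr_gt0. Qed.

Lemma rest01 k w : 0 <= V k w <= 1.
Proof.
have h i : 0 <= 1 - U i w <= 1 by have /andP[? ?] := U01 i w; rewrite subr_ge0 gerBl; apply/andP.
apply/andP; split; first by apply: prodr_ge0 => i _; have /andP[] := h i.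
by apply: prodr_ile1 => i _; exact: h.
Qed.

Lemma restS k w : V k.+1 w = V k w * (1 - U k w).
Proof. by rewrite /V big_ord_recr. Qed.

Lemma rest_powR k w (p : R) : V k w `^ p = \prod_(i < k) (1 - U i w) `^ p.
Proof.
elim: k => [|k ih]; first by rewrite /V !big_ord0 powR1.
rewrite restS powRM ?ih ?big_ord_recr//.
  by have /andP[] := rest01 k w.
by have /andP[_] := U01 k w; rewrite subr_ge0.
Qed.

Lemma span_rest k (p : R) : 0 <= p -> span U k (fun w => V k w `^ p).
Proof.
move=> p0; apply: (span_ext (span_prefix U k (ubm_powC p0))) => w.
by rewrite rest_powR.
Qed.

Lemma span_rest_nat k : span U k (V k).
Proof.
apply: (span_ext (span_rest k (@ler01 R))) => w.
by rewrite powRr1//; have /andP[] := rest01 k w.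
Qed.

Lemma bmf_U (f : R -> R) i : ubm f -> bmf (fun w => f (U i w)).
Proof. by move=> uf; apply: ubm_comp. Qed.

Lemma Ex_1mU i (q : R) : 0 <= q -> Ex (fun w => (1 - U i w) `^ q) =
  Beta (1 - alpha) (b i + q) / Beta (1 - alpha) (b i).
Proof.
move=> q0; have := momU i (lexx 0) q0; rewrite addr0 => <-.
by apply: Ex_ext => w; rewrite powRr0 mul1r.
Qed.

Lemma Ex_restX k (p : R) : 0 <= p -> Ex (fun w => V k w `^ p) =
  \prod_(i < k) (Beta (1 - alpha) (b i + p) / Beta (1 - alpha) (b i)).
Proof.
move=> p0; under Ex_ext do rewrite rest_powR.
rewrite (indU k (f := fun _ x => (1 - x) `^ p)); last by move=> _; exact: ubm_powC.
by apply: eq_bigr => i _; exact: Ex_1mU.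
Qed.

Notation t := (theta / alpha).

Lemma theta1_gt0 : 0 < theta + 1.
Proof. move: alpha_lt1 theta_gt => h1 h2; lra. Qed.
Lemma t1_gt0 : 0 < t + 1.
Proof. by rewrite -ltrBlDr sub0r ltr_pdivlMr// mulN1r. Qed.

Let g (j : R) : R := Gamma (theta + 1 + j * alpha).

Let g_gt0 (j : R) : 0 <= j -> 0 < g j.
Proof. by move=> j0; apply: Gamma_gt0; rewrite ltr_wpDr ?theta1_gt0// mulr_ge0// ltW. Qed.

(** By the Beta-Gamma identity the p alpha-th moment of one factor is a quotient of
    consecutive terms of k |-> g (k + p) / g k, up to a factor affine in i; the
    product over i telescopes, the affine factors giving Gamma functions of
    theta / alpha. *)
Let Beta_ratio i (p : R) : 0 <= p ->
  Beta (1 - alpha) (b i + p * alpha) / Beta (1 - alpha) (b i) =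
  (g i%:R / g (i%:R + p)) * (g (i.+1%:R + p) / g i.+1%:R) * ((t + i.+1%:R) / (t + i.+1%:R + p)).
Proof.
move=> p0.
have b0 := stick_b_gt0 i; have pa : 0 <= p * alpha by rewrite mulr_ge0// ltW.
have bp : 0 < b i + p * alpha by rewrite ltr_wpDr.
rewrite !Beta_Gamma//.
have e1 : 1 - alpha + b i = theta + 1 + i%:R * alpha by rewrite /b /stick_b -natr1; ring.
have e2 : 1 - alpha + (b i + p * alpha) = theta + 1 + (i%:R + p) * alpha.
  by rewrite /b /stick_b -natr1; ring.
rewrite e1 e2 -/(g _) -/(g _).
have e3 : g i.+1%:R = b i * Gamma (b i).
  by rewrite -GammaS// /g /b /stick_b; congr Gamma; ring.
have e4 : g (i.+1%:R + p) = (b i + p * alpha) * Gamma (b i + p * alpha).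
  by rewrite -GammaS// /g /b /stick_b; congr Gamma; ring.
rewrite e3 e4.
have e5 : t + i.+1%:R = b i / alpha by rewrite /b /stick_b; field; rewrite gt_eqF.
have e6 : t + i.+1%:R + p = (b i + p * alpha) / alpha by rewrite e5; field; rewrite gt_eqF.
rewrite e6 e5.
have h1 := Gamma_gt0 a1; have h2 := Gamma_gt0 b0; have h3 := Gamma_gt0 bp.
have h4 := g_gt0 (ler0n R i).
have h5 : 0 < g (i%:R + p) by apply: g_gt0; rewrite addr_ge0.
move: (Gamma (1 - alpha)) (Gamma (b i)) (Gamma (b i + p * alpha)) (g i%:R) (g (i%:R + p)) h1 h2 h3 h4 h5.
move=> G1 G2 G3 G4 G5 h1 h2 h3 h4 h5.
by field; rewrite !gt_eqF.
Qed.

Definition diversity_moment (p : R) : R :=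
  Gamma (theta + 1) / Gamma (t + 1) * (Gamma (p + t + 1) / Gamma (p * alpha + theta + 1)).
Notation c_ := diversity_moment.

Lemma Ex_rest_closed k (p : R) : 0 <= p -> Ex (fun w => V k w `^ (p * alpha)) =
  c_ p * (g (k%:R + p) / g k%:R) / (Gamma (t + 1 + k%:R + p) / Gamma (t + 1 + k%:R)).
Proof.
move=> p0; have pa : 0 <= p * alpha by rewrite mulr_ge0// ltW.
have tk j : 0 < t + 1 + j%:R :> R by rewrite ltr_wpDr// t1_gt0.
have tkp j : 0 < t + 1 + j%:R + p :> R by rewrite ltr_wpDr.
rewrite Ex_restX//; elim: k => [|k ih].
  rewrite big_ord0 /c_ /g mul0r !addr0 add0r.
  have -> : p + t + 1 = t + 1 + p by ring.
  have -> : p * alpha + theta + 1 = theta + 1 + p * alpha by ring.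
  have h1 := Gamma_gt0 theta1_gt0; have h2 := Gamma_gt0 t1_gt0.
  have h3 : 0 < Gamma (t + 1 + p) by apply: Gamma_gt0; rewrite ltr_wpDr// t1_gt0.
  have h4 : 0 < Gamma (theta + 1 + p * alpha) by apply: Gamma_gt0; rewrite ltr_wpDr// theta1_gt0.
  move: (Gamma (theta + 1)) (Gamma (t + 1)) (Gamma (t + 1 + p)) (Gamma (theta + 1 + p * alpha)) h1 h2 h3 h4.
  by move=> G1 G2 G3 G4 h1 h2 h3 h4; field; rewrite !gt_eqF.
rewrite big_ord_recr/= ih Beta_ratio//.
have e1 : Gamma (t + 1 + k.+1%:R) = (t + k.+1%:R) * Gamma (t + 1 + k%:R).
  have -> : t + k.+1%:R = t + 1 + k%:R by rewrite -natr1; ring.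
  by rewrite -GammaS//; congr Gamma; rewrite -natr1; ring.
have e2 : Gamma (t + 1 + k.+1%:R + p) = (t + k.+1%:R + p) * Gamma (t + 1 + k%:R + p).
  have -> : t + k.+1%:R + p = t + 1 + k%:R + p by rewrite -natr1; ring.
  by rewrite -GammaS//; congr Gamma; rewrite -natr1; ring.
rewrite e1 e2.
have h1 := Gamma_gt0 (tk k); have h2 := Gamma_gt0 (tkp k).
have h3 : 0 < t + k.+1%:R by move: (tk k); rewrite -natr1; lra.
have h4 : 0 < t + k.+1%:R + p by rewrite ltr_wpDr.
have h5 := g_gt0 (ler0n R k); have h6 := g_gt0 (ler0n R k.+1).
have h7 : 0 < g (k%:R + p) by apply: g_gt0; rewrite addr_ge0.
move: (Gamma (t + 1 + k%:R)) (Gamma (t + 1 + k%:R + p)) (t + k.+1%:R) h1 h2 h3 h4 => G1 G2 s h1 h2 h3 h4.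
move: (c_ p) (g k%:R) (g k.+1%:R) (g (k%:R + p)) (g (k.+1%:R + p)) h5 h6 h7 => c G3 G4 G5 G6 h5 h6 h7.
by field; rewrite !gt_eqF.
Qed.

(** What remains of the stick determines the diversity: V_k `^ alpha decays like
    k `^ (alpha - 1), and the rescaled sequence tends to D. The constant
    alpha `^ (- alpha) is the one for which the limit of the moments is exactly
    that of D. *)
Definition approx_div (k : nat) (w : T) : R :=
  V k w `^ alpha * k%:R `^ (1 - alpha) * alpha `^ (- alpha).
Notation D_ := approx_div.

Lemma approx_div_ge0 k w : 0 <= D_ k w.
Proof. by rewrite !mulr_ge0 ?powR_ge0. Qed.

Lemma bmf_approx_divX k (p : R) : 0 <= p -> bmf (fun w => D_ k w `^ p).
Proof.
move=> p0; have pa : 0 <= alpha * p by rewrite mulr_ge0// ltW.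
have := bmfZ ((k%:R `^ (1 - alpha) * alpha `^ (- alpha)) `^ p) (span_bmf mU U01 (span_rest k pa)).
congr bmf; apply/funext => w.
have -> : D_ k w `^ p = (V k w `^ alpha) `^ p * (k%:R `^ (1 - alpha) * alpha `^ (- alpha)) `^ p.
  by rewrite /D_ -mulrA powRM ?mulr_ge0 ?powR_ge0.
by rewrite powRrM mulrC.
Qed.

Lemma Ex_approx_divX k (p : R) : 0 <= p -> Ex (fun w => D_ k w `^ p) =
  Ex (fun w => V k w `^ (p * alpha)) * (k%:R `^ (1 - alpha) * alpha `^ (- alpha)) `^ p.
Proof.
move=> p0; have pa : 0 <= p * alpha by rewrite mulr_ge0// ltW.
rewrite [RHS]mulrC -ExZ; last exact: (span_bmf mU U01 (span_rest k pa)).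
apply: Ex_ext => w.
by rewrite /D_ -mulrA (powRM _ (powR_ge0 _ _)) ?mulr_ge0 ?powR_ge0// (mulrC p) powRrM mulrC.
Qed.

Lemma cvg_approx_div_moment (p : R) : 0 <= p -> Ex (fun w => D_ k w `^ p) @[k --> \oo] --> c_ p.
Proof.
move=> p0; have pa : 0 <= p * alpha by rewrite mulr_ge0// ltW.
have y1 n : 0 < theta + 1 + n%:R * alpha by rewrite ltr_wpDr ?theta1_gt0// mulr_ge0// ltW.
have y2 n : 0 < t + 1 + n%:R * 1 by rewrite mulr1 ltr_wpDr// t1_gt0.
have r1 := Gamma_ratio_cvg y1 (cvg_affine_inv (theta + 1) alpha_gt0) pa.
have r2 := Gamma_ratio_cvg y2 (cvg_affine_inv (t + 1) ltr01) p0.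
have s1 := cvg_powR1 (p * alpha) (cvg_affine_ratio (theta + 1) alpha_gt0).
have s2 := cvg_powR1 p (cvg_affine_ratio (t + 1) (@ltr01 R)).
have L := cvgMl1 (cvgMl1 r1 s1) (cvg_inv1 (cvgMl1 r2 s2)).
have {}L := cvgE (@cvg_scale _ (c_ p) _ _ L) (mulr1 _).
apply: cvg_ext_near L; exists 1%N => // n /= n1.
have n0 : 0 < n%:R :> R by rewrite ltr0n.
rewrite Ex_approx_divX// Ex_rest_closed// /g mulr1.
have -> : theta + 1 + (n%:R + p) * alpha = theta + 1 + n%:R * alpha + p * alpha by ring.
have := Gamma_gt0 (y1 n); have := Gamma_gt0 (y2 n); rewrite mulr1 => h1 h2.
have y1p : 0 < theta + 1 + n%:R * alpha + p * alpha by rewrite ltr_wpDr.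
have y2p : 0 < t + 1 + n%:R * 1 + p by rewrite ltr_wpDr.
have := Gamma_gt0 y1p; have := Gamma_gt0 y2p; rewrite mulr1 => h3 h4.
have na : 0 < n%:R * alpha by rewrite mulr_gt0.
have := y2 n; rewrite mulr1 => y2n.
have e1 : ((theta + 1 + n%:R * alpha) / (n%:R * alpha)) `^ (p * alpha) =
   (theta + 1 + n%:R * alpha) `^ (p * alpha) / (n%:R * alpha) `^ (p * alpha).
  by rewrite powRM ?invr_ge0 ?(ltW (y1 n)) ?(ltW na)// powRVp.
have e2 : ((t + 1 + n%:R) / n%:R) `^ p = (t + 1 + n%:R) `^ p / n%:R `^ p.
  by rewrite powRM ?invr_ge0 ?(ltW y2n) ?(ltW n0)// powRVp.
have e3 : (n%:R `^ (1 - alpha) * alpha `^ (- alpha)) `^ p = n%:R `^ p / (n%:R * alpha) `^ (p * alpha).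
  rewrite powRM ?powR_ge0// -!powRrM (powRM (p * alpha) (ltW n0) (ltW alpha_gt0)).
  rewrite mulrBl mul1r powRBp// (mulrC alpha p) mulNr (mulrC alpha p) powRN.
  by rewrite invfM mulrA.
rewrite e1 e2 e3.
have := powR_gt0 (p * alpha) (y1 n); have := powR_gt0 p y2n.
have := powR_gt0 (p * alpha) na; have := powR_gt0 p n0.
move: (Gamma (theta + 1 + n%:R * alpha)) (Gamma (t + 1 + n%:R))
  (Gamma (theta + 1 + n%:R * alpha + p * alpha)) (Gamma (t + 1 + n%:R + p)) h1 h2 h3 h4.
move=> G1 G2 G3 G4 h1 h2 h3 h4.
move: (c_ p) ((theta + 1 + n%:R * alpha) `^ (p * alpha)) ((t + 1 + n%:R) `^ p)
  ((n%:R * alpha) `^ (p * alpha)) (n%:R `^ p) => c q1 q2 q3 q4 k1 k2 k3 k4.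
by field; rewrite !gt_eqF.
Qed.

End stick_moments.

(** * Almost sure convergence from second moments *)

Section interpolation.
Context {R : realType}.

(** Between two consecutive points of the subsequence, x n * y n lies between the two
    crosswise products. One of the factors will be a power of n, whose ratio between
    consecutive j ^ r tends to 1, so that second moment bounds need only be summed
    along a sparse subsequence. *)
Lemma cvg_interpolation (x y : nat -> R) (r : nat) (l : R) : (0 < r)%N ->
  {homo x : m n / (m <= n)%N >-> m <= n} -> {homo y : m n / (m <= n)%N >-> n <= m} ->
  (forall n, 0 <= x n) -> (forall n, 0 <= y n) ->
  x (j ^ r)%N * y (j.+1 ^ r)%N @[j --> \oo] --> l ->
  x (j.+1 ^ r)%N * y (j ^ r)%N @[j --> \oo] --> l ->
  x n * y n @[n --> \oo] --> l.
Proof.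
move=> r0 xnd yni x0 y0 h1 h2.
apply/cvgrPdist_le => e e0.
have /cvgrPdist_le/(_ _ e0)[J1 _ H1] := h1.
have /cvgrPdist_le/(_ _ e0)[J2 _ H2] := h2.
pose J := maxn J1 J2.
exists (J ^ r)%N => // n /= Jn.
have [j [Jj jn nj]] : exists j, [/\ (J <= j)%N, (j ^ r <= n)%N & (n < j.+1 ^ r)%N].
  have ex : exists j, (j ^ r <= n)%N by exists J.
  have ub j : (j ^ r <= n)%N -> (j <= n)%N.
    by apply: leq_trans; case: r r0 {h1 h2 H1 H2 Jn ex} => // r _; rewrite expnS; case: j => // j; rewrite leq_pmulr// expn_gt0.
  case: (ex_maxnP ex ub) => j jn jmax; exists j; split => //; first exact: jmax.
  by rewrite ltnNge; apply/negP => /jmax; rewrite ltnn.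
have {}H1 := H1 j (leq_trans (leq_maxl _ _) Jj).
have {}H2 := H2 j (leq_trans (leq_maxr _ _) Jj).
have lo : x (j ^ r)%N * y (j.+1 ^ r)%N <= x n * y n.
  by apply: ler_pM => //; [exact: xnd|exact/yni/ltnW].
have hi : x n * y n <= x (j.+1 ^ r)%N * y (j ^ r)%N.
  by apply: ler_pM => //; [exact/xnd/ltnW|exact: yni].
move: H1 H2; rewrite !ler_norml => /andP[a1 a2] /andP[a3 a4].
by apply/andP; split; lra.
Qed.

Lemma cvg_sub_pow (u : nat -> R) (r : nat) (l : R) : (0 < r)%N ->
  u n @[n --> \oo] --> l -> u (j ^ r)%N @[j --> \oo] --> l.
Proof.
move=> r0 ul; apply: (cvg_comp _ _ _ ul).
move=> A [N _ NA]; exists N => // n /= Nn; apply: NA => /=.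
apply: (leq_trans Nn); case: r r0 {ul} => // r _; rewrite expnS.
by case: n {Nn} => // n; rewrite leq_pmulr// expn_gt0.
Qed.

Lemma cvg_ratio_pow (r : nat) (p : R) :
  ((j ^ r)%:R / (j.+1 ^ r)%:R : R) `^ p @[j --> \oo] --> (1 : R).
Proof.
apply: cvg_powR1.
have h : (j%:R / j.+1%:R : R) @[j --> \oo] --> (1 : R).
  apply: (@cvg_ext _ (fun j => 1 - j.+1%:R^-1)).
    by move=> n; rewrite -natr1; field; rewrite natr1.
  by apply: (@cvgE _ _ (1 - 0)); [apply: cvgB; [exact: cvg_cst|exact: cvg_harmonic]|rewrite subr0].
elim: r => [|r ih].
  by apply: (@cvg_ext _ (fun=> 1)); [move=> n; rewrite !expn0 divr1|exact: cvg_cst].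
apply: (@cvg_ext _ (fun j => (j%:R / j.+1%:R) * ((j ^ r)%:R / (j.+1 ^ r)%:R))).
  by move=> n; rewrite !expnS !natrM invfM; ring.
exact: cvgMl1.
Qed.

End interpolation.

Section almost_sure.
Context d (T : measurableType d) (R : realType) (P : probability T R).
Notation Ex := (Ex P).

Lemma ae_bounded_sum (Z : nat -> T -> R) (C : R) :
  (forall j, bmf (Z j)) -> (forall j w, 0 <= Z j w) ->
  (forall n, \sum_(0 <= j < n) Ex (Z j) <= C) ->
  {ae P, forall w, exists M : R, forall n, \sum_(0 <= j < n) Z j w <= M}.
Proof.
move=> bZ Z0 ZC.
have mZ j : measurable_fun setT (EFin \o Z j) by apply/measurable_EFinP; exact: bmf_measurable.
pose S w : \bar R := (\sum_(0 <= j <oo) (Z j w)%:E)%E.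
have S0 w : (0 <= S w)%E by apply: nneseries_ge0 => j _ _; rewrite lee_fin.
have mS : measurable_fun setT S.
  have h1 : forall j (w : T), setT w -> xpredT j -> (0%R <= (Z j w)%:E)%E.
    by move=> j w _ _; rewrite lee_fin.
  exact: (@ge0_emeasurable_sum _ _ _ setT (fun j w => (Z j w)%:E) xpredT h1 (fun j _ => mZ j)).
have iS : P.-integrable setT S.
  apply/integrableP; split => //.
  apply: (@le_lt_trans _ _ C%:E); last exact: ltry.
  under eq_integral do rewrite gee0_abs//.
  rewrite /S (@integral_nneseries _ _ _ P setT measurableT (fun j w => (Z j w)%:E))//; last first.
    by move=> j w _; rewrite lee_fin.
  apply: lime_le.
    by apply: is_cvg_nneseries => n _ _; apply: integral_ge0 => w _; rewrite lee_fin.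
  apply: nearW => n; under eq_bigr do rewrite ExE//.
  by rewrite sumEFin lee_fin.
have := integrable_ae measurableT iS; apply: filterS => w /(_ I) Sw.
exists (fine (S w)) => n; rewrite -lee_fin fineK// -sumEFin.
by apply: nneseries_lim_ge => j _ _; rewrite lee_fin.
Qed.

Lemma bounded_sum_cvg (u : nat -> R) (M : R) : (forall j, 0 <= u j) ->
  (forall n, \sum_(0 <= j < n) u j <= M) -> cvgn (series u).
Proof.
move=> u0 uM; apply: nondecreasing_is_cvgn.
  by apply/nondecreasing_seqP => n; rewrite /series/= big_nat_recr//= lerDl.
by exists M => _ [n _ <-]; exact: uM.
Qed.

Lemma sum_invsq_le (k l : nat) : \sum_(k <= i < l) ((i.+2%:R : R) ^- 2) <= k.+1%:R^-1.
Proof.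
have h n : \sum_(k <= i < k + n) ((i.+2%:R : R) ^- 2) <= k.+1%:R^-1 - (k + n).+1%:R^-1.
  elim: n => [|n ih]; first by rewrite addn0 big_geq// subrr.
  rewrite addnS big_nat_recr ?leq_addr//=; apply: le_trans (lerD ih (lexx _)) _.
  rewrite -lerBrDl; set m := (k + n)%N.
  have m1 : 0 < m.+1%:R :> R by [].
  have m2 : 0 < m.+2%:R :> R by [].
  have -> : k.+1%:R^-1 - m.+2%:R^-1 - (k.+1%:R^-1 - m.+1%:R^-1) = (m.+1%:R * m.+2%:R)^-1 :> R.
    have -> : m.+2%:R = m.+1%:R + 1 :> R by rewrite natr1.
    by field; rewrite !gt_eqF// addr_gt0.
  by rewrite lef_pV2 ?posrE ?mulr_gt0 ?exprn_gt0// expr2 ler_pM2r// ler_nat.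
have [kl|lk] := leqP k l.
  by rewrite -(subnKC kl); apply: le_trans (h _) _; rewrite gerBl.
by rewrite big_geq// ltnW.
Qed.

(** This replaces Chebyshev's inequality with the Borel-Cantelli lemma: if the second
    moments are summable then so are almost surely the squares themselves. *)
Lemma ae_cvg0 (Z : nat -> T -> R) (C : R) : (forall j, bmf (Z j)) ->
  (forall n, \sum_(0 <= j < n) Ex (fun w => Z j w ^+ 2) <= C) ->
  {ae P, forall w, Z j w @[j --> \oo] --> (0 : R)}.
Proof.
move=> bZ ZC.
have := @ae_bounded_sum (fun j w => Z j w ^+ 2) C (fun j => bmfX 2 (bZ j))
  (fun j w => sqr_ge0 _) ZC.
apply: filterS => w [M hM].
have /cvg_series_cvg_0 h : cvgn (series (fun j => Z j w ^+ 2)).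
  by apply: bounded_sum_cvg hM => j; exact: sqr_ge0.
apply/norm_cvg0P; apply: (@cvg_ext _ (fun j => Num.sqrt (Z j w ^+ 2))).
  by move=> n; rewrite sqrtr_sqr.
by rewrite -sqrtr0; apply: (continuous_cvg _ _ h); exact: sqrt_continuous.
Qed.

(** The inequality |x| <= j^-2 + j^2 x^2 trades absolute for square summability, at
    the price of a rate. Along a polynomial subsequence the rate is available, and this
    takes the place of the martingale convergence theorem. *)
Lemma ae_cvg_increments (W : nat -> T -> R) (C : R) : (forall j, bmf (W j)) -> 0 <= C ->
  (forall j, Ex (fun w => (W j.+1 w - W j w) ^+ 2) <= C * j.+1%:R ^- 4) ->
  {ae P, forall w, cvgn (W ^~ w)}.
Proof.
move=> bW C0 hW.
have bI j : bmf (fun w => W j.+1 w - W j w) by exact: bmfB.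
have bZ j : bmf (fun w => j.+1%:R ^+ 2 * (W j.+1 w - W j w) ^+ 2) by apply/bmfZ/bmfX.
have := @ae_bounded_sum (fun j w => j.+1%:R ^+ 2 * (W j.+1 w - W j w) ^+ 2) (2 * C) bZ _ _.
have p j : 0 < j.+1%:R :> R by [].
have sumle n : \sum_(0 <= j < n) (j.+1%:R ^- 2 : R) <= 2.
  case: n => [|n]; first by rewrite big_geq.
  rewrite big_nat_recl//= expr1n invr1.
  have := sum_invsq_le 0 n; rewrite invr1 => h; lra.
have Z0 j w : 0 <= j.+1%:R ^+ 2 * (W j.+1 w - W j w) ^+ 2 by rewrite mulr_ge0 ?sqr_ge0.
move=> /(_ Z0) H.
apply: (filterS _ (H _)) => [w [M hM]|n].
  have : cvgn (series (fun j => W j.+1 w - W j w)).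
    apply: normed_cvg; apply: (@bounded_sum_cvg _ (2 + M)) => [j|n]; first exact: normr_ge0.
    apply: le_trans (lerD (sumle n) (hM n)).
    rewrite -big_split/=; apply: ler_sum => j _.
    set x := W j.+1 w - W j w; have q := p j.
    have := sqr_ge0 (j.+1%:R^-1 - j.+1%:R * `|x|).
    have -> : (j.+1%:R^-1 - j.+1%:R * `|x|) ^+ 2 = j.+1%:R ^- 2 - 2 * `|x| + j.+1%:R ^+ 2 * x ^+ 2.
      by rewrite -[x ^+ 2](real_normK (num_real x)); field; rewrite gt_eqF.
    change (0 <= j.+1%:R ^- 2 - 2 * `|x| + j.+1%:R ^+ 2 * x ^+ 2 ->
      `|x| <= j.+1%:R ^- 2 + j.+1%:R ^+ 2 * x ^+ 2).
    have := normr_ge0 x; move: (`|x|) (_ ^- 2) (_ * x ^+ 2) => u v z; lra.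
  move=> /cvg_ex[l hl]; apply/cvg_ex; exists (l + W 0%N w).
  apply: (@cvg_ext _ (fun n => series (fun j => W j.+1 w - W j w) n + W 0%N w)).
    by move=> n; rewrite /series/= telescope_sumr// subrK.
  by apply: cvgD => //; exact: cvg_cst.
apply: (@le_trans _ _ (\sum_(0 <= j < n) (C * j.+1%:R ^- 2))); last first.
  by rewrite -mulr_sumr mulrC ler_wpM2r.
apply: ler_sum => j _; rewrite ExZ; last exact: bmfX.
have q := p j; rewrite -ler_pdivlMl ?exprn_gt0//; apply: le_trans (hW j) _.
by rewrite mulrCA -invfM -exprD lexx.
Qed.

Lemma Ex_variance_le (Y : T -> R) (c : R) : bmf Y ->
  Ex (fun w => (Y w - Ex Y) ^+ 2) <= Ex (fun w => (Y w - c) ^+ 2).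
Proof.
move=> bY; set m := Ex Y.
have b1 : bmf (fun w => (Y w - m) ^+ 2) by apply/bmfX/bmfB => //; exact: bmf_cst.
have b2 : bmf (fun w => 2 * (m - c) * (Y w - m)) by apply/bmfZ/bmfB => //; exact: bmf_cst.
have -> : Ex (fun w => (Y w - c) ^+ 2) =
    Ex (fun w => (Y w - m) ^+ 2 + 2 * (m - c) * (Y w - m) + (m - c) ^+ 2).
  by apply: Ex_ext => w; ring.
rewrite ExD; [|exact: bmfD|exact: bmf_cst].
rewrite ExD// Ex_cst ExZ; last by apply: bmfB => //; exact: bmf_cst.
rewrite ExB//; last exact: bmf_cst.
by rewrite Ex_cst subrr mulr0 addr0 lerDl sqr_ge0.
Qed.

Lemma orthogonal_increments (M : nat -> T -> R) (v : nat -> R) :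
  (forall i, bmf (M i)) ->
  (forall k i, (k <= i)%N -> Ex (fun w => (M i w - M k w) * (M i.+1 w - M i w)) = 0) ->
  (forall i, Ex (fun w => (M i.+1 w - M i w) ^+ 2) <= v i) ->
  forall k l, (k <= l)%N -> Ex (fun w => (M l w - M k w) ^+ 2) <= \sum_(k <= i < l) v i.
Proof.
move=> bM orth hv k l /subnKC <-; elim: (l - k)%N => [|n ih].
  rewrite addn0 big_geq//; under Ex_ext do rewrite subrr expr0n/=.
  by rewrite Ex_cst.
rewrite addnS big_nat_recr ?leq_addr//=; apply: le_trans (lerD ih (hv _)).
set i := (k + n)%N.
have b1 : bmf (fun w => M i w - M k w) by exact: bmfB.
have b2 : bmf (fun w => M i.+1 w - M i w) by exact: bmfB.
rewrite -ExD; [|exact: bmfX..].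
have <- : Ex (fun w => 2 * ((M i w - M k w) * (M i.+1 w - M i w))) +
          Ex (fun w => (M i w - M k w) ^+ 2 + (M i.+1 w - M i w) ^+ 2) =
          Ex (fun w => (M i w - M k w) ^+ 2 + (M i.+1 w - M i w) ^+ 2).
  by rewrite ExZ ?orth ?leq_addr ?mulr0 ?add0r//; exact: bmfM.
rewrite -ExD; [|by apply/bmfZ/bmfM|by apply: bmfD; exact: bmfX].
by rewrite le_eqVlt; apply/orP; left; apply/eqP; apply: Ex_ext => w; ring.
Qed.

(** Bounded second moments give uniform integrability. Concretely, Fatou's lemma for
    X yields one inequality, and Fatou's lemma for the nonnegative functions
    e X^2 + 1 / (4 e) - X, with e arbitrarily small, yields the other. *)
Lemma integral_limit (X : nat -> T -> R) (Y : T -> R) (c C : R) :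
  (forall k, bmf (X k)) -> (forall k w, 0 <= X k w) -> measurable_fun setT Y -> (forall w, 0 <= Y w) ->
  {ae P, forall w, X k w @[k --> \oo] --> Y w} ->
  Ex (X k) @[k --> \oo] --> c -> Ex (fun w => X k w ^+ 2) @[k --> \oo] --> C ->
  (\int[P]_w (Y w)%:E = c%:E)%E.
Proof.
move=> bX X0 mY Y0 XY Xc XC.
have fat (F : nat -> T -> R) (G : T -> R) (m : R) : (forall k, bmf (F k)) ->
    (forall k w, 0 <= F k w) -> measurable_fun setT G ->
    {ae P, forall w, F k w @[k --> \oo] --> G w} ->
    Ex (F k) @[k --> \oo] --> m -> (\int[P]_w (G w)%:E <= m%:E)%E.
  move=> bF F0 mG FG Fm.
  have mF k : measurable_fun setT (fun w => (F k w)%:E).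
    by apply/measurable_EFinP; exact: bmf_measurable.
  have := @fatou _ _ _ P setT measurableT (fun k w => (F k w)%:E) mF _.
  have -> : limn_einf (fun k => \int[P]_w (F k w)%:E)%E = m%:E.
    have h : (fun k => \int[P]_w (F k w)%:E)%E @ \oo --> m%:E.
      under eq_fun do rewrite ExE//.
      by apply: cvg_EFin => //; exact: nearW.
    by have [] := cvg_limn_einf_sup h.
  have -> : (\int[P]_w (limn_einf (fun k => (F k w)%:E)))%E = (\int[P]_w (G w)%:E)%E.
    apply: ae_eq_integral => //.
    - rewrite (_ : (fun x => _) = (fun x => - limn_esup (fun k => - (F k x)%:E))%E).
        apply: measurableT_comp => //; apply: measurable_fun_limn_esup => k.
        exact: measurableT_comp.
      apply/funext => w; rewrite -limn_einfN; congr limn_einf; apply/funext => k /=.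
      by rewrite opprK.
    - exact/measurable_EFinP.
    apply: filterS FG => w FGw _.
    have h : (fun k => (F k w)%:E) @ \oo --> (G w)%:E.
      by apply: cvg_EFin => //; exact: nearW.
    by have [] := cvg_limn_einf_sup h.
  by apply => k w _; rewrite lee_fin.
have ub : (\int[P]_w (Y w)%:E <= c%:E)%E by apply: (fat X).
have Yfin : (\int[P]_w (Y w)%:E)%E \is a fin_num.
  rewrite ge0_fin_numE; first by apply: le_lt_trans ub _; exact: ltry.
  by apply: integral_ge0 => w _; rewrite lee_fin.
apply/eqP; rewrite eq_le ub/=.
rewrite -(fineK Yfin) lee_fin; set y := fine _.
have C0 : 0 <= C.
  apply: (ler_cvg_to (cvg_cst (0 : R)) XC); apply: nearW => k; apply: Ex_ge0 => w; exact: sqr_ge0.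
suff key (e : R) : 0 < e -> c <= y + e * C.
  apply/ler_addgt0Pr => e e0.
  apply: le_trans (key (e / (C + 1)) _) _; first by rewrite divr_gt0// ltr_wpDl.
  by rewrite lerD2l mulrAC ler_pdivrMr ?ltr_wpDl// ler_wpM2l ?(ltW e0)// lerDl.
move=> e0.
pose q := (4 * e)^-1.
have sq (x : R) : 0 <= e * x ^+ 2 + q - x.
  have -> : e * x ^+ 2 + q - x = e * (x - (2 * e)^-1) ^+ 2 by rewrite /q; field; rewrite gt_eqF.
  by rewrite mulr_ge0 ?sqr_ge0 ?ltW.
have bF k : bmf (fun w => e * X k w ^+ 2 + q - X k w).
  by apply: bmfB => //; apply: bmfD; [exact/bmfZ/bmfX|exact: bmf_cst].
have mG : measurable_fun setT (fun w => e * Y w ^+ 2 + q - Y w).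
  apply: measurable_funB => //; apply: measurable_funD => //.
  by apply: measurable_funM => //; exact: measurable_funX.
have FG : {ae P, forall w, e * X k w ^+ 2 + q - X k w @[k --> \oo] --> e * Y w ^+ 2 + q - Y w}.
  apply: filterS XY => w XYw; apply: cvgB => //; apply: cvgD; last exact: cvg_cst.
  apply: cvgM; first exact: cvg_cst.
  under eq_fun do rewrite expr2; rewrite expr2; exact: cvgM.
have Fm : Ex (fun w => e * X k w ^+ 2 + q - X k w) @[k --> \oo] --> e * C + q - c.
  apply: (@cvg_ext _ (fun k => e * Ex (fun w => X k w ^+ 2) + q - Ex (X k))).
    move=> k; have b1 := bmfX 2 (bX k).
    rewrite ExB//; last by apply: bmfD; [exact: bmfZ|exact: bmf_cst].
    by rewrite ExD ?ExZ ?Ex_cst//; [exact: bmfZ|exact: bmf_cst].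
  apply: cvgB => //; apply: cvgD; last exact: cvg_cst.
  by apply: cvgM; first exact: cvg_cst.
have := fat _ _ _ bF (fun k w => sq (X k w)) mG FG Fm.
have iY : P.-integrable setT (EFin \o Y).
  apply/integrableP; split; first exact/measurable_EFinP.
  under eq_integral do rewrite /= ger0_norm//.
  by apply: le_lt_trans ub _; exact: ltry.
have : (q%:E <= \int[P]_w (e * Y w ^+ 2 + q - Y w)%:E + \int[P]_w (Y w)%:E)%E.
  rewrite -ge0_integralD//=; last 4 first.
  - by move=> w _; rewrite lee_fin.
  - exact/measurable_EFinP.
  - by move=> w _; rewrite lee_fin.
  - exact/measurable_EFinP.
  have -> : (q%:E = \int[P]_w (cst q%:E) w)%E.
    by rewrite integral_cst//= probability_setT mule1.
  apply: ge0_le_integral => //=.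
  - by move=> w _; rewrite lee_fin /q invr_ge0 mulr_ge0 ?ltW.
  - by apply/measurable_EFinP; exact: measurable_funD.
  - by move=> w _; rewrite lee_fin subrK lerDr mulr_ge0 ?sqr_ge0 ?ltW.
move=> h1 h2; have := le_trans h1 (leeD2r _ h2).
rewrite -(fineK Yfin) -/y -EFinD lee_fin; move: (e * C) => v; lra.
Qed.

End almost_sure.

Section more_helpers.
Context {R : realType}.

Lemma cvg_bounded (u : nat -> R) (l : R) : u n @[n --> \oo] --> l ->
  exists2 B, 0 < B & forall n, `|u n| <= B.
Proof.
move=> /cvgP/cvg_seq_bounded[B [_ hB]].
exists (Num.max B 0 + 1); first by rewrite ltr_wpDl// le_max lexx orbT.
by move=> n; apply: hB => //; rewrite ltr_pwDr// le_max lexx.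
Qed.

Lemma cvg_powR_ge0 (u : nat -> R) (l p : R) : 0 < p -> (forall n, 0 <= u n) -> 0 <= l ->
  u n @[n --> \oo] --> l -> u n `^ p @[n --> \oo] --> l `^ p.
Proof.
move=> p0 u0; rewrite le_eqVlt => /predU1P[<-|l0] ul; last exact: cvg_powR.
rewrite powR0 ?gt_eqF//; apply/cvgrPdist_le => e e0.
have e1 : 0 < e `^ p^-1 by rewrite powR_gt0.
have /cvgrPdist_le/(_ _ e1) := ul; apply: filterS => n.
rewrite !sub0r !normrN !ger0_norm ?powR_ge0// => h.
have -> : e = (e `^ p^-1) `^ p by rewrite -powRrM mulVf ?gt_eqF// powRr1// ltW.
by rewrite ge0_ler_powR ?nnegrE ?powR_ge0// ltW.
Qed.

Lemma powR_ge_id (x s : R) : 0 <= x <= 1 -> 0 < s <= 1 -> x <= x `^ s.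
Proof.
move=> /andP[]; rewrite le_eqVlt => /predU1P[<- _ /andP[s0 _]|x0 x1 /andP[s0 s1]].
  by rewrite powR0// gt_eqF.
by apply: ger1_powR => //; rewrite x0.
Qed.

Lemma cvg_powR_exp0 (z : R) (p : nat -> R) : 0 < z -> p n @[n --> \oo] --> (0 : R) ->
  z `^ p n @[n --> \oo] --> (1 : R).
Proof.
move=> z0 p0; apply: (@cvg_ext _ (fun n => expR (p n * ln z))).
  by move=> n; rewrite /powR gt_eqF.
rewrite -expR0; apply: continuous_cvg; first exact: continuous_expR.
by apply: (cvgE (@cvg_mul _ _ _ _ _ p0 (cvg_cst (ln z)))); rewrite mul0r.
Qed.

End more_helpers.

(** * The diversity as the limit of the normalised rests *)

Section stick_limit.
Context d (T : measurableType d) (R : realType) (P : probability T R).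
Notation Ex := (Ex P).
Notation Gamma := (@Gamma_fun R).
Notation Beta := (@Beta_fun R).
Context (alpha theta : R) (alpha_gt0 : 0 < alpha) (alpha_lt1 : alpha < 1) (theta_gt : - alpha < theta).
Context (U : nat -> T -> R).
Hypotheses (mU : forall i, measurable_fun setT (U i)) (U01 : forall i w, 0 <= U i w <= 1).
Hypothesis indU : forall k (f : nat -> R -> R), (forall i, ubm (f i)) ->
  Ex (fun w => \prod_(i < k) f i (U i w)) = \prod_(i < k) Ex (fun w => f i (U i w)).
Notation b := (stick_b alpha theta).
Hypothesis momU : forall i (p q : R), 0 <= p -> 0 <= q ->
  Ex (fun w => U i w `^ p * (1 - U i w) `^ q) = Beta (1 - alpha + p) (b i + q) / Beta (1 - alpha) (b i).
Notation V := (rest U).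
Notation t := (theta / alpha).
Notation D_ := (approx_div alpha U).
Notation c_ := (diversity_moment alpha theta).

Let a1 : 0 < 1 - alpha. Proof. by rewrite subr_gt0. Qed.
Let b0 i : 0 < b i. Proof. exact: stick_b_gt0. Qed.

Let c0 : R := Num.min (theta + alpha) alpha.

Let c0_gt0 : 0 < c0.
Proof. by rewrite /c0 lt_min alpha_gt0 andbT -ltrBlDr sub0r. Qed.

Lemma stick_b_ge i : c0 * i.+1%:R <= b i.
Proof.
rewrite /stick_b.
have h1 : c0 <= theta + alpha by rewrite /c0 ge_min lexx.
have h2 : c0 * i%:R <= alpha * i%:R by rewrite ler_wpM2r// /c0 ge_min lexx orbT.
by rewrite -natr1; lra.
Qed.

Lemma Ex_U1 i : Ex (U i) = (1 - alpha) / (1 - alpha + b i).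
Proof.
have := momU i (@ler01 R) (lexx 0); rewrite addr0 BetaS// mulfK ?gt_eqF ?Beta_gt0// => <-.
by apply: Ex_ext => w; rewrite powRr0 mulr1 powRr1//; have /andP[] := U01 i w.
Qed.

Lemma Ex_U2_le i : Ex (fun w => U i w ^+ 2) <= (2 / c0 ^+ 2) * i.+1%:R ^- 2.
Proof.
have -> : Ex (fun w => U i w ^+ 2) = ((1 - alpha + 1) / (1 - alpha + 1 + b i)) * ((1 - alpha) / (1 - alpha + b i)).
  have := momU i (ler0n R 2) (lexx 0); rewrite addr0 (_ : 1 - alpha + 2 = 1 - alpha + 1 + 1); last by ring.
  rewrite (BetaS (addr_gt0 a1 ltr01) (b0 i)) (BetaS a1 (b0 i)) mulrA mulfK ?gt_eqF ?Beta_gt0// => <-.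
  by apply: Ex_ext => w; rewrite powRr0 mulr1 powR_mulrn//; have /andP[] := U01 i w.
have bi := b0 i; have p1 : 0 < c0 * i.+1%:R by rewrite mulr_gt0.
have -> : 2 / c0 ^+ 2 * i.+1%:R ^- 2 = (2 / (c0 * i.+1%:R)) * (1 / (c0 * i.+1%:R)).
  by field; rewrite !gt_eqF.
have le1 : c0 * i.+1%:R <= 1 - alpha + b i by rewrite (le_trans (stick_b_ge i))// lerDr ltW.
have n1 : 0 < 1 - alpha + b i by rewrite addr_gt0.
have n2 : 0 < 1 - alpha + 1 + b i by rewrite addrAC addr_gt0.
have a2 : 0 < 1 - alpha + 1 by rewrite addr_gt0.
apply: ler_pM.
- by rewrite divr_ge0 ?(ltW n2) ?(ltW a2).
- by rewrite divr_ge0 ?(ltW n1) ?(ltW a1).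
- apply: ler_pM; [exact: ltW|by rewrite invr_ge0 ltW|move: alpha_gt0 => ?; lra|].
  by rewrite lef_pV2 ?posrE// (le_trans le1)// lerD2r lerDl.
- apply: ler_pM; [exact: ltW|by rewrite invr_ge0 ltW|move: alpha_gt0 => ?; lra|].
  by rewrite lef_pV2 ?posrE.
Qed.

Let m i : R := Ex (fun w => (1 - U i w) `^ alpha).

Let onem01 i w : 0 <= 1 - U i w <= 1.
Proof. by have /andP[h1 h2] := U01 i w; rewrite subr_ge0 h2 gerBl. Qed.

Let bmf_pow i (p : R) : 0 <= p -> bmf (fun w => (1 - U i w) `^ p).
Proof. by move=> p0; apply: (bmf_U mU U01 i (ubm_powC p0)). Qed.

Let bmfU i : bmf (U i).
Proof. exact: (bmf_U mU U01 i ubm_id). Qed.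

Let m_ge i : c0 / (1 + c0) <= m i.
Proof.
have h1 : Ex (fun w => 1 - U i w) <= m i.
  apply: Ex_le; [by apply: bmfB => //; exact: bmf_cst|exact/bmf_pow/ltW|].
  by move=> w; apply: powR_ge_id => //; rewrite alpha_gt0 ltW.
apply: le_trans h1; rewrite ExB ?Ex_cst ?Ex_U1//; last exact: bmf_cst.
have bi := b0 i.
have h2 : c0 <= b i.
  by apply: le_trans (stick_b_ge i); rewrite ler_peMr ?(ltW c0_gt0)// ler1n.
have -> : 1 - (1 - alpha) / (1 - alpha + b i) = b i / (1 - alpha + b i).
  by move: (b i) bi => z bi; field; rewrite gt_eqF// addr_gt0.
have n1 : 0 < 1 - alpha + b i by rewrite addr_gt0.
have n2 : 0 < 1 + c0 by rewrite addr_gt0.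
rewrite ler_pdivrMr// mulrAC ler_pdivlMr//.
move: (b i) bi h2 alpha_gt0 c0_gt0 => z bi h2 h4 h5; nra.
Qed.

Let m_gt0 i : 0 < m i.
Proof. by apply: lt_le_trans (m_ge i); rewrite divr_gt0 ?addr_gt0. Qed.

Let e k : R := Ex (fun w => V k w `^ alpha).

Let eS k : e k.+1 = e k * m k.
Proof.
rewrite /e /m -(Ex_span mU U01 indU (span_rest U01 k (ltW alpha_gt0)) (ubm_powC (ltW alpha_gt0))).
by apply: Ex_ext => w; rewrite restS powRM//; [have /andP[] := rest01 U01 k w|have /andP[] := onem01 k w].
Qed.

Let e_gt0 k : 0 < e k.
Proof.
elim: k => [|k ih]; last by rewrite eS mulr_gt0.
rewrite /e; under Ex_ext do rewrite /rest big_ord0 powR1.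
by rewrite Ex_cst.
Qed.

(** The powers of the rests divided by their means form a product martingale; it is
    shown to converge almost surely, and the ratio of the two normalisations
    tends to a constant. *)
Let W k w : R := (e k)^-1 * V k w `^ alpha.

Let span_W k : span U k (W k).
Proof. exact/spanZ/(span_rest U01 k (ltW alpha_gt0)). Qed.

Let bmfW k : bmf (W k). Proof. exact: (span_bmf mU U01 (span_W k)). Qed.

Let WS k w : W k.+1 w = W k w * ((m k)^-1 * (1 - U k w) `^ alpha).
Proof.
rewrite /W eS restS powRM; first by rewrite invfM; ring.
  by have /andP[] := rest01 U01 k w.
by have /andP[] := onem01 k w.
Qed.

Let W_orth k Z : span U k Z -> Ex (fun w => Z w * (W k.+1 w - W k w)) = 0.
Proof.
move=> sZ; have sZW := spanM sZ (span_W k).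
have bZW := span_bmf mU U01 sZW.
have E w : Z w * (W k.+1 w - W k w) =
    (m k)^-1 * (Z w * W k w * (1 - U k w) `^ alpha) - Z w * W k w by rewrite WS; ring.
under Ex_ext do rewrite E.
have b1 : bmf (fun w => Z w * W k w * (1 - U k w) `^ alpha) by apply: bmfM => //; exact/bmf_pow/ltW.
rewrite ExB//; last exact: bmfZ.
rewrite ExZ// (Ex_span mU U01 indU sZW (ubm_powC (ltW alpha_gt0))) -/(m k).
by rewrite mulrCA mulVf ?mulr1 ?subrr// gt_eqF.
Qed.

Let W2_bounded : exists2 B, 0 < B & forall k, Ex (fun w => W k w ^+ 2) <= B.
Proof.
have h2 := cvg_approx_div_moment alpha_gt0 alpha_lt1 theta_gt mU U01 indU momU (ler0n R 2).
have h1 := cvg_approx_div_moment alpha_gt0 alpha_lt1 theta_gt mU U01 indU momU (ler01 : 0 <= (1:R)).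
have c1 : 0 < c_ 1.
  rewrite /diversity_moment !mulr_gt0 ?invr_gt0 ?Gamma_gt0//.
  - exact: theta1_gt0 alpha_lt1 theta_gt.
  - exact: t1_gt0.
  - by rewrite -addrA ltr_wpDl//; exact: t1_gt0.
  - by rewrite mul1r -addrA ltr_wpDl// ?(ltW alpha_gt0)//; exact: theta1_gt0 alpha_lt1 theta_gt.
have h3 : (Ex (fun w => D_ k w `^ 1))^-1 @[k --> \oo] --> (c_ 1)^-1.
  by apply: cvgV => //; rewrite gt_eqF.
have [B B0 hB] := cvg_bounded (cvg_mul h2 (cvg_mul h3 h3)).
exists (B + 1); first by rewrite addr_gt0.
case=> [|k].
  have E w : W 0 w ^+ 2 = 1.
    rewrite /W /rest big_ord0 powR1 mulr1 /e; under Ex_ext do rewrite /rest big_ord0 powR1.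
    by rewrite Ex_cst invr1 expr1n.
  by under Ex_ext do rewrite E; rewrite Ex_cst lerDr ltW.
apply: le_trans (_ : B <= B + 1); last by rewrite lerDl.
apply: le_trans (le_trans (ler_norm _) (hB k.+1)).
rewrite !Ex_approx_divX// mul1r.
have k0 : 0 < k.+1%:R `^ (1 - alpha) * alpha `^ (- alpha) by rewrite mulr_gt0 ?powR_gt0.
rewrite powRr1 ?(ltW k0)// powR_mulrn ?(ltW k0)// -/(e k.+1).
have -> : Ex (fun w => W k.+1 w ^+ 2) = (e k.+1) ^- 2 * Ex (fun w => V k.+1 w `^ (2 * alpha)).
  rewrite -ExZ; last by apply: (span_bmf mU U01 (span_rest U01 k.+1 _)); rewrite mulr_ge0// ltW.
  apply: Ex_ext => w; rewrite /W exprMn exprVn; congr (_ * _).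
  by rewrite mulrC powRrM powR_mulrn// powR_ge0.
have e0 := e_gt0 k.+1.
move: (e k.+1) (Ex _) (_ * _) e0 k0 => u v z u0 z0.
by rewrite le_eqVlt; apply/orP; left; apply/eqP; field; rewrite !gt_eqF.
Qed.

Let W_increment : exists2 K, 0 < K &
  forall k, Ex (fun w => (W k.+1 w - W k w) ^+ 2) <= K * k.+1%:R ^- 2.
Proof.
have [B B0 hB] := W2_bounded.
exists (B * (((c0 / (1 + c0)) ^- 2) * (2 / c0 ^+ 2))).
  by rewrite !mulr_gt0// ?invr_gt0 ?exprn_gt0 ?divr_gt0 ?addr_gt0.
move=> k; pose h x : R := ((m k)^-1 * (1 - x) `^ alpha - 1) ^+ 2.
have uh : ubm h.
  split.
    apply: measurable_funX; apply: measurable_funB => //; apply: measurable_funM => //.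
    by have [] := ubm_powC (ltW alpha_gt0).
  exists (((m k)^-1 + 1) ^+ 2) => x x01; rewrite sqr_ge0/=.
  have /andP[x0 x1] := x01.
  have y1 : (1 - x) `^ alpha <= 1 by apply: powR_le1; [rewrite subr_ge0 x1 gerBl|exact: ltW].
  have y0 := powR_ge0 (1 - x) alpha.
  have mi : 0 < (m k)^-1 by rewrite invr_gt0.
  rewrite -[leLHS]real_normK ?num_real// ler_sqr ?nnegrE ?addr_ge0 ?(ltW mi)//.
  apply: le_trans (ler_normB _ _) _; rewrite normr1 lerD2r ger0_norm ?mulr_ge0 ?(ltW mi)//.
  by rewrite ler_piMr// ltW.
have E w : (W k.+1 w - W k w) ^+ 2 = W k w ^+ 2 * h (U k w) by rewrite WS /h; ring.
under Ex_ext do rewrite E.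
rewrite (Ex_span mU U01 indU (spanX 2 (span_W k)) uh) -mulrA.
apply: ler_pM => //; [by apply: Ex_ge0 => w; exact: sqr_ge0|by apply: Ex_ge0 => w; exact: sqr_ge0|].
have bp := bmf_pow k (ltW alpha_gt0).
(* the variance is at most the second moment around 1, and 1 - (1 - x) `^ alpha <= x *)
have v1 : Ex (fun w => h (U k w)) <= (m k) ^- 2 * Ex (fun w => U k w ^+ 2).
  have E2 w : h (U k w) = (m k) ^- 2 * ((1 - U k w) `^ alpha - m k) ^+ 2.
    by rewrite /h; have := m_gt0 k; move: (m k) (_ `^ _) => u v u0; field; rewrite gt_eqF.
  under Ex_ext do rewrite E2.
  rewrite ExZ; last by apply/bmfX/bmfB => //; exact: bmf_cst.
  rewrite ler_wpM2l ?invr_ge0 ?sqr_ge0//.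
  apply: le_trans (Ex_variance_le P 1 bp) _.
  apply: Ex_le; [by apply/bmfX/bmfB => //; exact: bmf_cst|exact: bmfX|move=> w].
  have /andP[u0 u1] := U01 k w.
  have l1 : 1 - U k w <= (1 - U k w) `^ alpha by apply: powR_ge_id => //; rewrite alpha_gt0 ltW.
  have l2 : (1 - U k w) `^ alpha <= 1 by apply: powR_le1 => //; exact: ltW.
  rewrite -sqrrN ler_sqr ?nnegrE; move: (_ `^ _) l1 l2 => z l1 l2; lra.
apply: le_trans v1 _; rewrite -mulrA; apply: ler_pM.
- by rewrite invr_ge0 sqr_ge0.
- by apply: Ex_ge0 => w; exact: sqr_ge0.
- rewrite lef_pV2 ?posrE ?exprn_gt0 ?divr_gt0 ?addr_gt0//.
  by rewrite ler_sqr ?nnegrE ?m_ge// ltW// divr_gt0 ?addr_gt0.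
- exact: Ex_U2_le.
Qed.

Let W_block : exists2 K, 0 < K & forall k l, (0 < k <= l)%N ->
  Ex (fun w => (W l w - W k w) ^+ 2) <= K * k%:R^-1.
Proof.
have [K K0 hK] := W_increment; exists K => // k l /andP[k0 kl].
have := @orthogonal_increments _ _ _ P W (fun k => K * k.+1%:R ^- 2) bmfW _ hK k l kl.
move=> H; apply: le_trans (H _) _.
  move=> k' i k'i; apply: W_orth; apply: spanB => //.
  exact: (spanW k'i (span_W k')).
rewrite -mulr_sumr ler_pM2l//.
case: k k0 kl {H} => // k _; case: l => // l kl.
by rewrite big_add1/=; exact: sum_invsq_le.
Qed.

Let De k : Ex (fun w => D_ k w `^ 1) = e k * (k%:R `^ (1 - alpha) * alpha `^ (- alpha)).
Proof.
rewrite (Ex_approx_divX P alpha_gt0 mU U01)// mul1r powRr1//.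
by rewrite mulr_ge0 ?powR_ge0.
Qed.

(** The martingale W converges along the fourth powers, where its increments have
    second moments of order j^-4. Since V_k is nonincreasing, monotonicity
    recovers the other indices. *)
Lemma approx_div_ae_cvg : {ae P, forall w, cvgn (D_ ^~ w)}.
Proof.
have [K K0 hK] := W_block.
have h1 := cvg_approx_div_moment alpha_gt0 alpha_lt1 theta_gt mU U01 indU momU (ler01 : 0 <= (1:R)).
have := @ae_cvg_increments _ _ _ P (fun j w => W (j.+1 ^ 4)%N w) K (fun j => bmfW _) (ltW K0) _.
move=> H; apply: (filterS _ (H _)); last first.
  move=> j; rewrite -natrX; apply: hK.
  by rewrite expn_gt0/= leq_exp2r.
move=> w /cvg_ex[l hl].
have {}hl : W (j ^ 4)%N w @[j --> \oo] --> l by rewrite -cvg_shiftS.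
have hD : D_ (j ^ 4)%N w @[j --> \oo] --> l * c_ 1.
  apply: (@cvg_ext _ (fun j => W (j ^ 4)%N w * Ex (fun w => D_ (j ^ 4)%N w `^ 1))).
    move=> n; rewrite De /W /approx_div; have := e_gt0 (n ^ 4); move: (e _) => u u0.
    by move: (V _ w `^ _) (_%:R `^ _) (alpha `^ _) => x y z; field; rewrite gt_eqF.
  have h4 := @cvg_sub_pow _ (fun k => Ex (fun w => D_ k w `^ 1)) 4 _ isT h1.
  exact: (cvg_mul hl h4).
apply/cvg_ex; exists (l * c_ 1).
pose x n : R := n%:R `^ (1 - alpha).
pose y n : R := V n w `^ alpha * alpha `^ (- alpha).
have Dxy n : D_ n w = x n * y n by rewrite /approx_div /x /y; ring.
apply: (@cvg_ext _ (fun n => x n * y n)) => //.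
have V0 n : 0 <= V n w by have /andP[] := rest01 U01 n w.
have xr n m' : (0 < m')%N -> x n = x m' * (n%:R / m'%:R) `^ (1 - alpha).
  move=> m0; have m0' : 0 < m'%:R :> R by rewrite ltr0n.
  by rewrite /x powRM ?invr_ge0// powRVp// mulrCA mulfV ?mulr1// gt_eqF// powR_gt0.
apply: (@cvg_interpolation _ x y 4) => //.
- by move=> p q pq; rewrite /x ge0_ler_powR ?nnegrE ?ler_nat ?(ltW a1).
- apply/nonincreasing_seqP => n; rewrite /y ler_wpM2r ?powR_ge0//.
  rewrite ge0_ler_powR ?nnegrE ?(ltW alpha_gt0)//.
  by rewrite restS ler_piMr//; have /andP[] := onem01 n w.
- by move=> n; rewrite powR_ge0.
- by move=> n; rewrite mulr_ge0 ?powR_ge0.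
- apply: (@cvg_ext _ (fun j => D_ (j.+1 ^ 4)%N w * ((j ^ 4)%:R / (j.+1 ^ 4)%:R) `^ (1 - alpha))).
    by move=> n; rewrite (xr (n ^ 4)%N (n.+1 ^ 4)%N) ?expn_gt0// Dxy mulrAC.
  apply: cvgMl1; last exact: cvg_ratio_pow.
  by move: hD; rewrite -cvg_shiftS.
- have h2 := cvg_inv1 (@cvg_ratio_pow R 4 (1 - alpha)).
  have h3 := cvgMl1 hD h2.
  apply: cvg_ext_near h3; exists 1%N => // n /= n1.
  have n0 : (0 < n ^ 4)%N by rewrite expn_gt0 n1.
  rewrite (xr (n.+1 ^ 4)%N (n ^ 4)%N)// Dxy mulrAC; congr (_ * _ * _).
  by rewrite -powRVp ?divr_gt0 ?ltr0n ?expn_gt0 ?n1// invf_div.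
Qed.

(** The upper limit is measurable without exception; truncation makes it nonnegative
    also on the null set where the limit fails to exist. *)
Definition diversity (w : T) : R := Num.max 0 (fine (limn_esup (fun k => (D_ k w)%:E))).

Lemma measurable_diversity : measurable_fun setT diversity.
Proof.
apply: measurable_maxr => //; apply: measurableT_comp => //.
apply: measurable_fun_limn_esup => k; apply/measurable_EFinP.
have := bmf_approx_divX alpha_gt0 mU U01 k (@ler01 R).
rewrite (_ : (fun w => _) = D_ k); first by case.
by apply/funext => w; rewrite powRr1// approx_div_ge0.
Qed.

Lemma diversity_ge0 w : 0 <= diversity w.
Proof. by rewrite /diversity le_max lexx. Qed.

Lemma approx_div_cvg_diversity : {ae P, forall w, D_ k w @[k --> \oo] --> diversity w}.
Proof.
apply: filterS approx_div_ae_cvg => w /cvg_ex[l hl].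
have h : (fun k => (D_ k w)%:E) @ \oo --> l%:E.
  by apply: cvg_EFin => //; exact: nearW.
have [_ E] := cvg_limn_einf_sup h.
have l0 : 0 <= l.
  by apply: (ler_cvg_to (cvg_cst (0 : R)) hl); apply: nearW => k; exact: approx_div_ge0.
by rewrite /diversity E/= (max_idPr l0).
Qed.

(** The moments of order 2 p converge as well, hence are bounded, which allows the
    passage to the limit in the moments of order p. *)
Lemma diversity_momentE (p : R) : 0 < p -> (\int[P]_w (diversity w `^ p)%:E = (c_ p)%:E)%E.
Proof.
move=> p0; have p2 : 0 <= p * 2 by rewrite mulr_ge0 ?ltW.
have h1 := cvg_approx_div_moment alpha_gt0 alpha_lt1 theta_gt mU U01 indU momU (ltW p0).
have h2 := cvg_approx_div_moment alpha_gt0 alpha_lt1 theta_gt mU U01 indU momU p2.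
apply: (@integral_limit _ _ _ P (fun k w => D_ k w `^ p) _ (c_ p) (c_ (p * 2))) => //.
- by move=> k; apply: bmf_approx_divX => //; exact: ltW.
- by move=> k w; exact: powR_ge0.
- apply: (@measurableT_comp _ _ _ _ _ _ (fun y : R => y `^ p)); first exact: measurable_powR.
  exact: measurable_diversity.
- by move=> w; exact: powR_ge0.
- apply: filterS approx_div_cvg_diversity => w h.
  apply: cvg_powR_ge0 => //; first by move=> k; exact: approx_div_ge0.
  exact: diversity_ge0.
- apply: cvg_ext h2 => k; apply: Ex_ext => w.
  by rewrite powRrM powR_mulrn// powR_ge0.
Qed.

Lemma diversity_moment_ge (p : R) : 0 <= p <= 1 ->
  (t + 1) / (t + 1 + p) * ((t + 1) / (theta + 1) `^ alpha) `^ p <= c_ p.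
Proof.
move=> /andP[p0 p1].
have t1 := t1_gt0 alpha_gt0 theta_gt; have th1 := theta1_gt0 alpha_lt1 theta_gt.
have tp : 0 < t + 1 + p by rewrite ltr_wpDr.
have pa : 0 <= p * alpha <= 1.
  by rewrite mulr_ge0 ?(ltW alpha_gt0)//= mulr_ile1// ltW.
have p01 : 0 <= p <= 1 by rewrite p0.
have w1 := wendel_ge gamma_like_Gamma t1 p01.
have w2 := wendel_le gamma_like_Gamma th1 pa.
rewrite /diversity_moment.
have -> : p + t + 1 = t + 1 + p by ring.
have -> : p * alpha + theta + 1 = theta + 1 + p * alpha by ring.
have g1 := Gamma_gt0 t1; have g2 := Gamma_gt0 th1; have g3 := Gamma_gt0 tp.
have /andP[pa0 _] := pa.
have g4 : 0 < Gamma (theta + 1 + p * alpha) by rewrite Gamma_gt0// ltr_wpDr.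
have q1 := powR_gt0 p t1; have q2 := powR_gt0 (p * alpha) th1.
rewrite powRM ?invr_ge0 ?powR_ge0 ?(ltW t1)// powRVp ?powR_gt0// -powRrM (mulrC alpha).
have w3 : (t + 1) / (t + 1 + p) * (t + 1) `^ p * Gamma (t + 1) <= Gamma (t + 1 + p).
  apply: le_trans w1; rewrite ler_pM2r// -mulrA ler_pM2l// powRB1// mulrC.
  rewrite ler_pM2r ?invr_gt0//.
  by rewrite ge0_ler_powR ?nnegrE ?(ltW t1) ?(ltW tp)// lerDl.
move: (Gamma (t + 1)) (Gamma (t + 1 + p)) (Gamma (theta + 1)) (Gamma (theta + 1 + p * alpha))
  g1 g3 g2 g4 w2 w3 => G1 G3 G2 G4 g1 g3 g2 g4 w2 w3.
have r0 : 0 < (t + 1) / (t + 1 + p) by rewrite divr_gt0.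
move: ((t + 1) / (t + 1 + p)) ((t + 1) `^ p) ((theta + 1) `^ (p * alpha)) r0 q1 q2 w2 w3 =>
  r z1 z2 r0 q1 q2 w2 w3.
have -> : G2 / G1 * (G3 / G4) = (G3 / G1) * (G2 / G4) by ring.
rewrite mulrA; apply: ler_pM.
- by rewrite mulr_ge0 ?(ltW r0) ?(ltW q1).
- by rewrite invr_ge0 ltW.
- by rewrite ler_pdivlMr.
- by rewrite ler_pdivlMr// mulrC ler_pdivrMr// mulrC.
Qed.

(** By concavity D `^ p <= 1 + p D on the event D > 0, while D `^ p = 0 off it. So the
    moment of order p is at most P (D > 0) + p E D; it tends to 1 with p -> 0 by the
    explicit formula. *)
Lemma diversity_gt0 : {ae P, forall w, 0 < diversity w}.
Proof.
pose A : set T := [set w | 0 < diversity w].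
have mA : measurable A.
  rewrite (_ : A = diversity @^-1` `]0, +oo[).
    by rewrite -[X in measurable X]setTI; apply: measurable_diversity.
  by apply/seteqP; split => w /=; rewrite /A/= in_itv/= andbT.
have bA := bmf_indic R mA.
suff PA : P A = 1%E.
  exists (~` A); split; [exact: measurableC|by rewrite probability_setC// PA subee|].
  by move=> w /= nw.
apply/eqP; rewrite eq_le probability_le1//= -Ex_indic// lee_fin.
set q := Ex (\1_A).
have key (p : R) : 0 < p -> p <= 1 ->
    (t + 1) / (t + 1 + p) * ((t + 1) / (theta + 1) `^ alpha) `^ p <= q + p * c_ 1.
  move=> p0 p1; apply: le_trans (diversity_moment_ge _) _; first by rewrite ltW.
  rewrite -lee_fin -diversity_momentE//.
  have mD1 : measurable_fun setT (fun w => diversity w) by exact: measurable_diversity.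
  have H1 : (\int[P]_w (p * diversity w)%:E = (p * c_ 1)%:E)%E.
    rewrite EFinM -diversity_momentE// -ge0_integralZl//=; last 3 first.
    - by apply/measurable_EFinP; apply: (@measurableT_comp _ _ _ _ _ _ (fun y : R => y `^ 1)) => //; exact: measurable_powR.
    - by move=> w _; rewrite lee_fin powR_ge0.
    - by rewrite lee_fin ltW.
    by apply: eq_integral => w _; rewrite powRr1// diversity_ge0.
  rewrite EFinD -H1 -(ExE P bA) -ge0_integralD//=; last 3 first.
  - by apply/measurable_EFinP; exact: measurable_indic.
  - by move=> w _; rewrite lee_fin mulr_ge0 ?(ltW p0) ?diversity_ge0.
  - by apply/measurable_EFinP; exact: measurable_funM.
  apply: ge0_le_integral => //=.
  - by move=> w _; rewrite lee_fin powR_ge0.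
  - by apply/measurable_EFinP; apply: (@measurableT_comp _ _ _ _ _ _ (fun y : R => y `^ p)) => //; exact: measurable_powR.
  - by apply/measurable_EFinP; apply: measurable_funD; [exact: measurable_indic|exact: measurable_funM].
  move=> w _; rewrite lee_fin indicE.
  have [wA|wA] := boolP (w \in A).
    have D0 : 0 < diversity w by move: wA; rewrite inE.
    have := @powR_tangent _ (diversity w) 1 p D0 ltr01 _; rewrite !powR1 !mulr1 ltW//= p1 => /(_ isT) h.
    apply: le_trans h _; move: (p * diversity w) => z; rewrite mulr1n; lra.
  have -> : diversity w = 0.
    by apply/eqP; rewrite eq_le diversity_ge0 andbT leNgt; apply: contraNN wA; rewrite inE.
  by rewrite powR0 ?gt_eqF// mulr0 addr0.
have t1 := t1_gt0 alpha_gt0 theta_gt; have th1 := theta1_gt0 alpha_lt1 theta_gt.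
have z0 : 0 < (t + 1) / (theta + 1) `^ alpha by rewrite divr_gt0 ?powR_gt0.
have p0 := @cvg_harmonic R.
have L : (t + 1) / (t + 1 + n.+1%:R^-1) * ((t + 1) / (theta + 1) `^ alpha) `^ (n.+1%:R^-1)
    @[n --> \oo] --> (1 : R).
  apply: cvgMl1; last exact: (cvg_powR_exp0 z0 p0).
  apply: (@cvgE _ _ ((t + 1) * (t + 1 + 0)^-1)); last by rewrite addr0 divff// gt_eqF.
  apply: cvg_scale; apply: cvgV; first by rewrite addr0 gt_eqF.
  by apply: cvgD; first exact: cvg_cst.
have L2 : q + n.+1%:R^-1 * c_ 1 @[n --> \oo] --> q.
  apply: (@cvgE _ _ (q + 0 * c_ 1)); last by rewrite mul0r addr0.
  apply: cvgD; first exact: cvg_cst.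
  by apply: cvg_mul => //; exact: cvg_cst.
apply: (ler_cvg_to L L2); apply: nearW => n; apply: key; first by rewrite invr_gt0.
by rewrite invf_le1// ler1n.
Qed.

End stick_limit.

(** * Binomial means *)

Section binomial_mixtures.
Context {R : realType}.
Implicit Types (h : nat -> R) (x y : R).

(** The expectation of h under the binomial law with n trials and success
    probability y, by conditioning on the first trial. Every property needed follows
    from this recursion, without binomial coefficients. *)
Fixpoint binomial_mean n y h : R :=
  if n is m.+1 then y * binomial_mean m y (fun k => h k.+1) + (1 - y) * binomial_mean m y h
  else h 0%N.

Lemma binomial_mean_ext n y h h' : (forall k, h k = h' k) -> binomial_mean n y h = binomial_mean n y h'.
Proof. by move=> /funext ->. Qed.

Lemma binomial_mean_cst n y c : binomial_mean n y (fun=> c) = c.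
Proof. by elim: n => //= n ->; ring. Qed.

Lemma binomial_meanD n y h h' :
  binomial_mean n y (fun k => h k + h' k) = binomial_mean n y h + binomial_mean n y h'.
Proof. by elim: n h h' => //= n ih h h'; rewrite !ih; ring. Qed.

Lemma binomial_meanZ n y c h : binomial_mean n y (fun k => c * h k) = c * binomial_mean n y h.
Proof. by elim: n h => //= n ih h; rewrite !ih; ring. Qed.

Lemma binomial_meanB n y h h' :
  binomial_mean n y (fun k => h k - h' k) = binomial_mean n y h - binomial_mean n y h'.
Proof. by elim: n h h' => //= n ih h h'; rewrite !ih; ring. Qed.

Lemma binomial_mean_le n y h h' : 0 <= y <= 1 -> (forall k, h k <= h' k) ->
  binomial_mean n y h <= binomial_mean n y h'.
Proof.
move=> /andP[y0 y1]; elim: n h h' => [|n ih] h h' hh' //=.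
by rewrite lerD// ler_wpM2l ?subr_ge0// ih.
Qed.

Lemma binomial_mean_sqr n y c :
  binomial_mean n y (fun k => (k%:R - c) ^+ 2) = (n%:R * y - c) ^+ 2 + n%:R * (y * (1 - y)).
Proof.
elim: n c => [|n ih] c /=; first by ring.
have E k : (k.+1%:R - c) ^+ 2 = (k%:R - (c - 1)) ^+ 2 by rewrite -natr1; ring.
by under binomial_mean_ext do rewrite E; rewrite !ih -natr1; ring.
Qed.

Lemma binomial_mean_poly n h : exists p : {poly R}, forall y, binomial_mean n y h = p.[y].
Proof.
elim: n h => [|n ih] h; first by exists (h 0%N)%:P => y; rewrite hornerC.
have [p hp] := ih (fun k => h k.+1); have [q hq] := ih h.
by exists ('X * p + (1 - 'X) * q) => y; rewrite /= hp hq !hornerE.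
Qed.

(** Bernstein's proof of the Weierstrass theorem: the variance of the binomial law
    bounds the mean deviation, through a <= e + a^2 / e. *)
Lemma bernstein_approx (f : R -> R) (L e y : R) (n : nat) : 0 <= L -> 0 < e -> (0 < n)%N ->
  0 <= y <= 1 -> (forall a b, `|f a - f b| <= L * `|a - b|) ->
  `|binomial_mean n y (fun k => f (k%:R / n%:R)) - f y| <= L * (e + (n%:R * e)^-1).
Proof.
move=> L0 e0 n0 y01 fL; have n0' : 0 < n%:R :> R by rewrite ltr0n.
have /andP[y0 y1] := y01.
pose q k := L * (e + (k%:R - n%:R * y) ^+ 2 / (n%:R ^+ 2 * e)).
have fq k : `|f (k%:R / n%:R) - f y| <= q k.
  apply: le_trans (fL _ _) _; rewrite ler_wpM2l//.
  have -> : (k%:R - n%:R * y) ^+ 2 / (n%:R ^+ 2 * e) = `|k%:R / n%:R - y| ^+ 2 / e.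
    by rewrite real_normK ?num_real//; field; rewrite !gt_eqF.
  have := normr_ge0 (k%:R / n%:R - y); move: `|_| => a a0.
  rewrite -(ler_pM2r e0) mulrDl mulfVK ?gt_eqF//; nra.
have Eq : binomial_mean n y q <= L * (e + (n%:R * e)^-1).
  rewrite /q binomial_meanZ binomial_meanD binomial_mean_cst ler_wpM2l// lerD2l.
  under binomial_mean_ext do rewrite mulrC.
  rewrite binomial_meanZ binomial_mean_sqr subrr expr0n add0r.
  have -> : (n%:R ^+ 2 * e)^-1 * (n%:R * (y * (1 - y))) = y * (1 - y) * (n%:R * e)^-1.
    by field; rewrite !gt_eqF.
  rewrite ler_piMl// ?invr_ge0 ?mulr_ge0 ?(ltW e0)//; nra.
apply: le_trans Eq.
rewrite -[f y in leLHS](binomial_mean_cst n y) -binomial_meanB ler_norml; apply/andP; split.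
  rewrite -[leLHS]mulN1r -binomial_meanZ; apply: binomial_mean_le => // k.
  by rewrite mulN1r; have /ler_normlP[] := fq k; rewrite lerNl.
by apply: binomial_mean_le => // k; have /ler_normlP[] := fq k.
Qed.

End binomial_mixtures.

(** * Laplace transforms and determinacy *)

Section laplace.
Context {R : realType}.

Let rem (n : nat) (y : R) : R := expR (- y) - \sum_(k < n) (- y) ^+ k / k`!%:R.

Let is_derive_monomial (f : R -> R) n (y df : R) : is_derive y 1 f df ->
  is_derive y 1 (fun z => f z ^+ n.+1 / n.+1`!%:R) (f y ^+ n / n`!%:R * df).
Proof.
move=> Hf; have := @is_deriveX _ _ f n.+1 y 1 df Hf; rewrite exprfctE => H.
apply: is_derive_eq; rewrite /GRing.scale/= factS natrM.
have := fact_gt0 n; rewrite -(ltr0n R) => f0.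
by field; rewrite !gt_eqF//= ltr_wpDl.
Qed.

Let is_derive_rem n (y : R) : is_derive y 1 (rem n.+1) (- rem n y).
Proof.
elim: n => [|n ih].
  rewrite (_ : rem 1 = fun y => expR (- y) - 1); last first.
    by apply/funext => z; rewrite /rem big_ord1 expr0 fact0 divr1.
  rewrite /rem big_ord0 subr0.
  by apply: is_derive_eq; rewrite subr0 mulrN1.
rewrite (_ : rem n.+2 = fun y => rem n.+1 y - (- y) ^+ n.+1 / n.+1`!%:R); last first.
  by apply/funext => z; rewrite /rem [in LHS]big_ord_recr/= opprD addrA.
rewrite (_ : - rem n.+1 y = - rem n y - (- y) ^+ n / n`!%:R * -1).
  by apply: is_deriveB; apply: is_derive_monomial; exact: is_derive_eq.
by rewrite /rem [in LHS]big_ord_recr/=; ring.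
Qed.

(** At a nonpositive argument the remainder of order n is at most the n-th term; no
    factor exp y appears. This is why moments growing almost like factorials still
    determine the Laplace transform on the whole half-line. *)
Lemma expRN_taylor n (y : R) : 0 <= y ->
  `|expR (- y) - \sum_(k < n) (- y) ^+ k / k`!%:R| <= y ^+ n / n`!%:R.
Proof.
rewrite -/(rem n y); elim: n y => [|n ih] y y0.
  by rewrite /rem big_ord0 subr0 expr0 fact0 divr1 ger0_norm ?expR_ge0// -expR0 ler_expR oppr_le0.
have key (s : R) : s = 1 \/ s = -1 -> 0 <= y ^+ n.+1 / n.+1`!%:R - s * rem n.+1 y.
  move=> s1; pose f (z : R) := z ^+ n.+1 / n.+1`!%:R - s * rem n.+1 z.
  have df (z : R) : is_derive z 1 f (z ^+ n / n`!%:R + s * rem n z).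
    have H1 : is_derive z 1 (fun z => s * rem n.+1 z) (s * - rem n z).
      by apply: is_deriveZ; exact: is_derive_rem.
    have H2 := @is_derive_monomial id n z 1 _.
    by rewrite -[s * rem n z]opprK -mulrN -[_ / _]mulr1; apply: is_deriveB.
  have f0 : f 0 = 0.
    rewrite /f /rem big_ord_recl/= big1 => [|i _]; last by rewrite oppr0 expr0n/= mul0r.
    by rewrite oppr0 expR0 !expr0 fact0 divr1 addr0 subrr mulr0 subr0 expr0n/= mul0r.
  rewrite -/(f y) -f0; apply: (@ger0_derive1_ndecry _ f 0) => //.
  - by move=> z; rewrite in_itv/= andbT => z0; rewrite derive1E; have [_ ->] := df z;
      have := ih z (ltW z0); rewrite ler_norml => /andP[h1 h2]; case: s1 => ->; move: h1 h2; move: (z ^+ n / _) (rem n z) => a b; lra.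
  - apply: continuous_subspaceT => z.
    by apply: differentiable_continuous; apply/derivable1_diffP.
rewrite ler_norml; have := key 1 (or_introl erefl); have := key (-1) (or_intror erefl).
by move: (y ^+ _ / _) (rem _ _) => a b; lra.
Qed.

Variables (c : nat -> R).

Section one_measure.
Variable (mu : probability R R).
Hypothesis moments : forall k, (\int[mu]_x (`|x| ^+ k)%:E = (c k)%:E)%E.

Let integrable_moment k : mu.-integrable setT (EFin \o (fun x : R => `|x| ^+ k)).
Proof.
apply/integrableP; split; first by apply/measurable_EFinP; exact: measurable_funX.
under eq_integral do rewrite /= ger0_norm ?exprn_ge0//.
by rewrite moments ltry.
Qed.

Let moment k : \int[mu]_x (`|x| ^+ k) = c k.
Proof. by rewrite /Rintegral moments. Qed.

Let taylor (l : R) n (x : R) : R := \sum_(k < n) (- (l * `|x|)) ^+ k / k`!%:R.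

Let taylor_integral (l : R) n : mu.-integrable setT (EFin \o taylor l n) /\
  \int[mu]_x (taylor l n x) = \sum_(k < n) ((- l) ^+ k / k`!%:R) * c k.
Proof.
elim: n => [|n [ih1 ih2]].
  have -> : taylor l 0 = (fun=> 0) by apply/funext => x; rewrite /taylor big_ord0.
  rewrite big_ord0 -/(Ex mu (fun=> 0)) Ex_cst; split => //.
  by apply: bmf_integrable; exact: bmf_cst.
have -> : taylor l n.+1 = (fun x => taylor l n x + ((- l) ^+ n / n`!%:R) * `|x| ^+ n).
  by apply/funext => x; rewrite /taylor big_ord_recr/= -mulNr exprMn mulrAC.
have iZ := integrable_ZR ((- l) ^+ n / n`!%:R) measurableT (integrable_moment n).
split; first exact: integrable_DR.
by rewrite (@RintegralD _ _ _ mu _ _ _ measurableT ih1 iZ) ih2 big_ord_recr/= RintegralZl// moment.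
Qed.

(** The absolute value makes sense of the moments for a probability on the whole line;
    it disappears for one carried by the positive half-line. *)
Lemma laplace_taylor (l : R) n : 0 <= l ->
  `|Ex mu (fun x => expR (- (l * `|x|))) - \sum_(k < n) ((- l) ^+ k / k`!%:R) * c k|
    <= l ^+ n / n`!%:R * c n.
Proof.
move=> l0; have [iT <-] := taylor_integral l n.
have bE : bmf (fun x : R => expR (- (l * `|x|))).
  split; first by apply: measurableT_comp => //; apply: measurableT_comp => //; exact: measurable_funM.
  by exists 1 => x; rewrite ger0_norm ?expR_ge0// -expR0 ler_expR oppr_le0 mulr_ge0.
have iE := bmf_integrable mu bE.
have iB : mu.-integrable setT (EFin \o (fun x => expR (- (l * `|x|)) - taylor l n x)).
  by have := integrableB measurableT iE iT; apply: eq_integrable => // x _; rewrite /= EFinB.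
rewrite -(@RintegralB _ _ _ mu _ _ _ measurableT iE iT).
apply: le_trans (le_normr_Rintegral measurableT iB) _.
rewrite -(moment n) -RintegralZl//; apply: le_Rintegral => //.
- by have := integrable_abse iB; apply: eq_integrable.
- exact: (integrable_ZR (l ^+ n / n`!%:R) measurableT (integrable_moment n)).
move=> x _; have := @expRN_taylor n (l * `|x|) (mulr_ge0 l0 (normr_ge0 _)).
by rewrite exprMn mulrAC.
Qed.

End one_measure.

Lemma laplace_unique (mu nu : probability R R) (l : R) : 0 <= l ->
  (forall k, (\int[mu]_x (`|x| ^+ k)%:E = (c k)%:E)%E) ->
  (forall k, (\int[nu]_x (`|x| ^+ k)%:E = (c k)%:E)%E) ->
  l ^+ n / n`!%:R * c n @[n --> \oo] --> (0 : R) ->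
  Ex mu (fun x => expR (- (l * `|x|))) = Ex nu (fun x => expR (- (l * `|x|))).
Proof.
move=> l0 mmu mnu c0.
apply/eqP; rewrite -subr_eq0 -normr_le0; set a := `| _ |.
have h : 2 * (l ^+ n / n`!%:R * c n) @[n --> \oo] --> (0 : R).
  by have := cvg_scale (c := 2) c0; rewrite mulr0.
apply: (ler_cvg_to (cvg_cst a) h); apply: nearW => n.
have := laplace_taylor mmu n l0; have := laplace_taylor mnu n l0; rewrite /a.
move: (\sum_(k < n) _) (Ex mu _) (Ex nu _) (_ * c n) => s u v e h1 h2.
by apply: le_trans (ler_distD s _ _) _; rewrite (distrC s) mulr_natl mulr2n lerD.
Qed.

End laplace.

Section bounded_convergence.
Context d (T : measurableType d) (R : realType) (P : probability T R).

Lemma probability1_setI (A B : set T) : measurable A -> P A = 1%E -> measurable B ->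
  P B = P (B `&` A).
Proof.
move=> mA PA mB; have mcA := measurableC mA.
have P0 : P (~` A) = 0%E by rewrite probability_setC// PA subee.
rewrite -[in LHS](setIT B) -(setUv A) setIUr measureU.
- rewrite [X in (_ + X)%E](_ : _ = 0%E) ?adde0//.
  apply/eqP; rewrite eq_le measure_ge0 andbT -P0; apply: le_measure; rewrite ?inE//.
  exact: measurableI.
- exact: measurableI.
- exact: measurableI.
- by rewrite setIACA setICr setI0.
Qed.

Lemma Ex_cvg (X : nat -> T -> R) (Y : T -> R) (C : R) :
  (forall k, measurable_fun setT (X k)) -> measurable_fun setT Y ->
  (forall k w, `|X k w| <= C) -> {ae P, forall w, X k w @[k --> \oo] --> Y w} ->
  Ex P (X k) @[k --> \oo] --> Ex P Y.
Proof.
move=> mX mY XC XY.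
have H : {ae P, forall w, setT w -> (X k w)%:E @[k --> \oo] --> (Y w)%:E}.
  by apply: filterS XY => w h _; apply: cvg_EFin => //; exact: nearW.
have [iY _ h] := @dominated_convergence _ _ _ P setT measurableT (fun k w => (X k w)%:E)
  (fun w => (Y w)%:E) (fun=> C%:E) (fun k => (measurable_EFinP _ _).2 (mX k))
  ((measurable_EFinP _ _).2 mY)
  H
  (bmf_integrable P (bmf_cst T C)) (aeW _ (fun w n _ => XC n w)).
apply: (@fine_cvg _ _ _ _ (fun k => (\int[P]_w (X k w)%:E)%E)).
by rewrite fineK//; exact: integrable_fin_num.
Qed.

End bounded_convergence.

Section determinacy.
Context {R : realType}.

Lemma clampP (x : R) :
  [\/ x <= 0 /\ clamp x = 0, 0 <= x <= 1 /\ clamp x = x | 1 <= x /\ clamp x = 1].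
Proof.
have [x0|x0] := leP x 0.
  by apply: Or31; rewrite /clamp (min_idPl (le_trans x0 ler01)) (max_idPl x0).
have [x1|x1] := leP x 1.
  by apply: Or32; rewrite (ltW x0) clampE// (ltW x0).
by apply: Or33; rewrite /clamp (min_idPr (ltW x1)) (max_idPr ler01) (ltW x1).
Qed.

Lemma clamp_homo (x y : R) : y <= x -> clamp y <= clamp x.
Proof.
by move=> yx; rewrite /clamp le_max2// le_min2.
Qed.

Lemma clamp_lip (x y : R) : `|clamp x - clamp y| <= `|x - y|.
Proof.
wlog xy : x y / y <= x => [H|].
  by have [/H//|/ltW/H] := leP y x; rewrite distrC (distrC x).
rewrite ger0_norm ?subr_ge0 ?clamp_homo// ger0_norm ?subr_ge0//.
by have [[x0 ->]|[/andP[x0 x1] ->]|[x1 ->]] := clampP x;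
  have [[y0 ->]|[/andP[y0 y1] ->]|[y1 ->]] := clampP y; lra.
Qed.

Variables (mu nu : probability R R).
Hypothesis laplace : forall n : nat,
  Ex mu (fun x => expR (- (n%:R * `|x|))) = Ex nu (fun x => expR (- (n%:R * `|x|))).

Let Y (x : R) := expR (- `|x|).

Let mY : measurable_fun setT Y.
Proof. by apply: measurableT_comp => //; apply: measurableT_comp => //; exact: measurableT_comp. Qed.

Let Y01 x : 0 <= Y x <= 1.
Proof. by rewrite expR_ge0/= -expR0 ler_expR oppr_le0. Qed.

Let bY : bmf Y. Proof. exact: bmf_unit. Qed.

(** The Laplace transform at the integers gives the moments of Y = exp (- |x|), which
    has values in [0, 1]. *)
Let same_poly (p : {poly R}) : Ex mu (fun x => p.[Y x]) = Ex nu (fun x => p.[Y x]).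
Proof.
have E (P : probability R R) : Ex P (fun x => p.[Y x]) =
    \sum_(i < size p) p`_i * Ex P (fun x => expR (- (i%:R * `|x|))).
  under Ex_ext do rewrite horner_coef.
  rewrite Ex_sum; last by move=> i; apply/bmfZ/bmfX.
  apply: eq_bigr => i _; rewrite ExZ; last exact: bmfX.
  by congr (_ * _); apply: Ex_ext => x; rewrite /Y -expRM_natl mulrN mulr_natl.
by rewrite !E; apply: eq_bigr => i _; rewrite laplace.
Qed.

Let same_lip (f : R -> R) (L : R) : 0 <= L -> measurable_fun setT f ->
  (forall x, 0 <= f x <= 1) ->
  (forall a b, `|f a - f b| <= L * `|a - b|) -> Ex mu (fun x => f (Y x)) = Ex nu (fun x => f (Y x)).
Proof.
move=> L0 mf f01 fL.
have bf : bmf (fun x => f (Y x)) by apply: bmf_unit => //; exact: measurableT_comp.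
apply/eqP; rewrite -subr_eq0 -normr_le0; apply/ler_addgt0Pr => e' e'0; rewrite add0r.
pose e := e' / (4 * (L + 1)).
have L1 : 0 < L + 1 by rewrite ltr_wpDl.
have e0 : 0 < e by rewrite divr_gt0 ?mulr_gt0.
pose n := (Num.truncn (e ^- 2)).+1.
have n0 : 0 < n%:R :> R by rewrite ltr0n.
have ne : (n%:R * e)^-1 <= e.
  have h : e ^- 2 <= n%:R by rewrite ltW// truncnS_gt// .
  have h1 : 1 <= n%:R * e ^+ 2 by rewrite -ler_pdivrMr ?exprn_gt0// div1r.
  have z0 := n0; move: (n%:R) z0 h1 => z z0 h1.
  have -> : (z * e)^-1 = (z * e ^+ 2)^-1 * e by field; rewrite !gt_eqF.
  by rewrite ler_piMl ?(ltW e0)// invf_le1// mulr_gt0// exprn_gt0.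
have [p hp] := binomial_mean_poly n (fun k => f (k%:R / n%:R)).
have bp : bmf (fun x => p.[Y x]).
  have -> : (fun x => p.[Y x]) = (fun x => \sum_(i < size p) p`_i * Y x ^+ i).
    by apply/funext => x; rewrite horner_coef.
  by apply: bmf_sum => i; apply/bmfZ/bmfX.
have close (P : probability R R) : `|Ex P (fun x => f (Y x)) - Ex P (fun x => p.[Y x])| <= e' / 2.
  have pt x : `|p.[Y x] - f (Y x)| <= e' / 2.
    rewrite -hp; apply: le_trans (bernstein_approx L0 e0 (ltn0Sn _) (Y01 x) fL) _.
    have -> : e' / 2 = 2 * (L + 1) * e by rewrite /e; field; rewrite gt_eqF.
    rewrite -/n; move: ((_ * e)^-1) ne => z ne; nra.
  rewrite -ExB// ler_norml; apply/andP; split.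
    rewrite -[leLHS](Ex_cst P); apply: Ex_le; [exact: bmf_cst|exact: bmfB|move=> x].
    by have /ler_normlP[] := pt x; lra.
  rewrite -[leRHS](Ex_cst P); apply: Ex_le; [exact: bmfB|exact: bmf_cst|move=> x].
  by have /ler_normlP[] := pt x; lra.
have := close mu; have := close nu; rewrite (same_poly p).
move=> h1 h2; apply: le_trans (ler_distD (Ex nu (fun x => p.[Y x])) _ _) _.
by rewrite (splitr e') lerD// distrC.
Qed.

(** The event is a lower interval for Y, and its indicator is the bounded limit of
    Lipschitz ramps. *)
Lemma laplace_tail (a : R) : mu [set x | a < `|x|] = nu [set x | a < `|x|].
Proof.
set A := [set x | _].
have mA : measurable A.
  rewrite (_ : A = (fun x : R => `|x|) @^-1` `]a, +oo[).
    by rewrite -[X in measurable X]setTI; apply: (measurableT_comp (f := fun x : R => x)) => //.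
  by apply/seteqP; split => x /=; rewrite /A/= in_itv/= andbT.
rewrite -!Ex_indic//; congr EFin.
pose c := expR (- a).
pose f m y : R := clamp (m%:R * (c - y)).
have mf m : measurable_fun setT (f m).
  apply: measurableT_comp; first exact: measurable_clamp.
  by apply: measurable_funM => //; exact: measurable_funB.
have f01 m x : 0 <= f m x <= 1 by exact: clamp01.
have fA x : f m (Y x) @[m --> \oo] --> (\1_A x : R).
  rewrite indicE; have [xA|xA] := boolP (x \in A).
    have cY : 0 < c - Y x by rewrite subr_gt0 ltr_expR ltrN2; move: xA; rewrite inE.
    apply: (@cvg_ext_near _ (fun=> 1)); last exact: cvg_cst.
    exists (Num.truncn (c - Y x)^-1).+1 => // m /= hm.
    have h1 : 1 <= m%:R * (c - Y x).
      rewrite -ler_pdivrMr// div1r; apply: le_trans (ltW (truncnS_gt _)) _.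
      by rewrite ler_nat.
    by rewrite /f /clamp (min_idPr h1) (max_idPr ler01).
  have cY : c - Y x <= 0.
    by rewrite subr_le0 ler_expR lerN2 leNgt; apply: contraNN xA; rewrite inE.
  apply: (@cvg_ext_near _ (fun=> 0)); last exact: cvg_cst.
  apply: nearW => m; have h : m%:R * (c - Y x) <= 0 by rewrite mulr_ge0_le0.
  by rewrite /f /clamp (min_idPl (le_trans h ler01)) (max_idPl h).
have lim (P : probability R R) : Ex P (fun x => f m (Y x)) @[m --> \oo] --> Ex P (\1_A).
  apply: (@Ex_cvg _ _ _ P _ _ 1).
  - by move=> m; exact: measurableT_comp.
  - exact: measurable_indic.
  - by move=> m x; have /andP[h1 h2] := f01 m (Y x); rewrite ger0_norm.
  - exact: aeW.
have E m : Ex mu (fun x => f m (Y x)) = Ex nu (fun x => f m (Y x)).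
  apply: (@same_lip _ m%:R) => // x y; apply: le_trans (clamp_lip _ _) _.
  by rewrite -mulrBr normrM ger0_norm// opprB addrC addrA subrK distrC.
apply: (cvg_unique _ (lim mu)); first exact: Rhausdorff.
by apply: cvg_ext (lim nu) => m; rewrite E.
Qed.

Lemma laplace_determines (A : set R) : mu [set x | 0 < x] = 1%E -> nu [set x | 0 < x] = 1%E ->
  measurable A -> mu A = nu A.
Proof.
move=> mu1 nu1.
have pos : measurable [set x : R | 0 < x].
  by rewrite (_ : [set x : R | 0 < x] = `]0, +oo[%classic)//; apply/seteqP; split => x /=; rewrite in_itv/= andbT.
have tail (P : probability R R) (a : R) : P [set x | 0 < x] = 1%E ->
    P `]a, +oo[%classic = if 0 <= a then P [set x | a < `|x|] else 1%E.
  move=> P1; case: ifPn => [a0|]; last first.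
    rewrite -ltNge => a0; apply/eqP; rewrite eq_le probability_le1//= -P1.
    by apply: le_measure; rewrite ?inE// => x /=; rewrite in_itv/= andbT; exact: lt_trans.
  have mabs : measurable [set x : R | a < `|x|].
    rewrite (_ : [set x | _] = (fun x : R => `|x|) @^-1` `]a, +oo[).
      by rewrite -[X in measurable X]setTI; apply: (measurableT_comp (f := fun x : R => x)) => //.
    by apply/seteqP; split => x /=; rewrite in_itv/= andbT.
  have I B : measurable B -> P B = P (B `&` [set x : R | 0 < x]) by exact: probability1_setI.
  rewrite I// [RHS]I//; congr (P _); apply/seteqP; split => x /=; rewrite in_itv/= andbT => -[h1 h2]; split => //.
    by rewrite gtr0_norm.
  by move: h1; rewrite gtr0_norm.
move=> mA; apply: (@measure_unique _ _ _ [set B | exists a : R, B = `]a, +oo[%classic]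
  (fun n => `](- n%:R), +oo[%classic)) => //.
- exact: RGenOInfty.measurableE.
- move=> _ _ [a ->] [b ->]; exists (Num.max a b).
  by apply/seteqP; split => x /=; rewrite !in_itv/= !andbT gt_max => /andP.
- by move=> i; exists (- i%:R).
- apply/seteqP; split => // x _; exists (Num.truncn `|x|).+1 => //=.
  rewrite in_itv/= andbT ltrNl; apply: le_lt_trans (truncnS_gt _).
  by rewrite -normrN ler_norm.
- move=> _ [a ->]; have h1 := tail mu a mu1; have h2 := tail nu a nu1.
  by move: h1; rewrite laplace_tail => h1; exact: etrans h1 (esym h2).
- by move=> k; apply: le_lt_trans (probability_le1 _ _) _; rewrite ?ltry.
Qed.

End determinacy.

Section diversity_law.
Context {R : realType} (alpha theta : R).
Context (alpha_gt0 : 0 < alpha) (alpha_lt1 : alpha < 1) (theta_gt : - alpha < theta).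
Notation Gamma := (@Gamma_fun R).
Notation c_ := (diversity_moment alpha theta).
Notation t := (theta / alpha).

Lemma ratio_test0 (u : nat -> R) : (forall n, 0 < u n) ->
  u n.+1 / u n @[n --> \oo] --> (0 : R) -> u n @[n --> \oo] --> (0 : R).
Proof.
move=> u0 /cvgrPdist_le/(_ (1/2)) [//|N _ hN].
have h k : u (N + k)%N <= u N * (1/2) ^+ k.
  elim: k => [|k ih]; first by rewrite addn0 expr0 mulr1.
  rewrite addnS; have := hN (N + k)%N (leq_addr _ _).
  rewrite sub0r normrN ger0_norm ?divr_ge0 ?(ltW (u0 _))// ler_pdivrMr// => h.
  apply: le_trans h _; rewrite exprS mulrCA ler_wpM2l//.
have : u (k + N)%N @[k --> \oo] --> (0 : R).
  apply: (@squeeze_cvgr _ _ _ _ (fun=> 0) (fun k => u N * (1/2) ^+ k)).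
  - by apply: nearW => k; rewrite (ltW (u0 _))/= addnC.
  - exact: cvg_cst.
  - apply: (cvgE (@cvg_scale _ (u N) (fun k => (1/2) ^+ k) 0 _)); last by rewrite mulr0.
    by apply: cvg_expr; rewrite ger0_norm; lra.
by rewrite (cvg_shiftn N u).
Qed.

Lemma diversity_moment_gt0 (p : R) : 0 <= p -> 0 < c_ p.
Proof.
move=> p0; have t1 := t1_gt0 alpha_gt0 theta_gt; have th1 := theta1_gt0 alpha_lt1 theta_gt.
by rewrite /diversity_moment !mulr_gt0 ?invr_gt0 ?Gamma_gt0// -addrA ltr_wpDl// mulr_ge0// ltW.
Qed.

(** By the ratio test: c_ (n + 1) / c_ n is of order n `^ (1 - alpha). *)
Lemma diversity_moment_growth (l : R) : 0 < l ->
  l ^+ n / n`!%:R * c_ n%:R @[n --> \oo] --> (0 : R).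
Proof.
move=> l0; have t1 := t1_gt0 alpha_gt0 theta_gt; have th1 := theta1_gt0 alpha_lt1 theta_gt.
have f0 n : 0 < n`!%:R :> R by rewrite ltr0n fact_gt0.
apply: ratio_test0 => [n|].
  by rewrite mulr_gt0 ?diversity_moment_gt0// divr_gt0// exprn_gt0.
pose y n : R := theta + 1 + n%:R * alpha.
have y0 n : 0 < y n by rewrite ltr_wpDr// mulr_ge0// ltW.
have yoo : (y n)^-1 @[n --> \oo] --> (0 : R) by exact: cvg_affine_inv.
have g := cvg_inv1 (Gamma_ratio_cvg y0 yoo (ltW alpha_gt0)).
have ya : (y n)^-1 `^ alpha @[n --> \oo] --> (0 : R).
  by apply: (cvgE (cvg_powR_ge0 alpha_gt0 _ (lexx 0) yoo)) => [n|]; rewrite ?invr_ge0 ?(ltW (y0 n))// powR0// gt_eqF.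
have r : (t + 1 + n%:R * 1) / (1 + n%:R * 1) @[n --> \oo] --> (1 : R).
  have r1 := @cvg_affine_ratio R 1 (t + 1) ltr01; have r2 := cvg_inv1 (@cvg_affine_ratio R 1 1 ltr01).
  apply: cvg_ext_near (cvgMl1 r1 r2); exists 1%N => // n /= n1.
  have n0 : 0 < n%:R :> R by rewrite ltr0n.
  have n2 : 0 < 1 + n%:R :> R by rewrite addr_gt0.
  by field; rewrite !gt_eqF.
apply: (@cvg_ext _ (fun n => l * (((t + 1 + n%:R * 1) / (1 + n%:R * 1)) *
   ((y n)^-1 `^ alpha * (Gamma (y n + alpha) / Gamma (y n) / (y n) `^ alpha)^-1)))); last first.
  by have := cvg_scale (c := l) (cvg_mul r (cvgMl1 ya g)); rewrite !mulr0.
move=> n; rewrite /diversity_moment.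
have -> : n.+1%:R + t + 1 = (n%:R + t + 1) + 1 by rewrite -natr1; ring.
have nt : 0 < n%:R + t + 1 by rewrite -addrA ltr_wpDl.
rewrite (GammaS nt).
have -> : n.+1%:R * alpha + theta + 1 = y n + alpha by rewrite /y -natr1; ring.
have -> : n%:R * alpha + theta + 1 = y n by rewrite /y; ring.
have g1 : 0 < Gamma (y n + alpha) by rewrite Gamma_gt0// addr_gt0.
have g2 := Gamma_gt0 (y0 n); have g3 := Gamma_gt0 nt; have g4 := Gamma_gt0 t1; have g5 := Gamma_gt0 th1.
rewrite powRVp//; have p0 := powR_gt0 alpha (y0 n).
have n0 : 0 < n%:R + 1 :> R by rewrite ltr_wpDl.
have := exprn_gt0 n l0; rewrite factS natrM -natr1 exprS.
move: (y n `^ alpha) (Gamma (y n + alpha)) (Gamma (y n)) (Gamma (n%:R + t + 1)) (Gamma (t + 1)) (Gamma (theta + 1)) (l ^+ n)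
  (n`!%:R) (f0 n) g1 g2 g3 g4 g5 p0 => a b c' d' e f g' h h0 b0 c0 d0 e0 f0' a0 g0.
have := nt; have := n0; move: t => t'; move: (n%:R : R) => m m0 mt.
by field; rewrite !gt_eqF// -?addrA addrC.
Qed.

Theorem diversity_law_determined (mu : probability R R) : mu [set x | 0 < x] = 1%E ->
  (forall p : R, 0 < p -> (\int[mu]_x (x `^ p)%:E = (c_ p)%:E)%E) -> determined_by_moments mu.
Proof.
move=> mu1 cmu nu nu1 same A mA.
have cnu (p : R) : 0 < p -> (\int[nu]_x (x `^ p)%:E = (c_ p)%:E)%E.
  by move=> p0; rewrite same// cmu.
have pos : measurable [set x : R | 0 < x].
  by rewrite (_ : [set x : R | 0 < x] = `]0, +oo[%classic)//; apply/seteqP; split => x /=; rewrite in_itv/= andbT.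
have abs (P : probability R R) : P [set x | 0 < x] = 1%E ->
    (forall p : R, 0 < p -> (\int[P]_x (x `^ p)%:E = (c_ p)%:E)%E) ->
    forall k, (\int[P]_x (`|x| ^+ k)%:E = (if k is 0%N then 1 else c_ k%:R)%:E)%E.
  move=> P1 cP [|k].
    by rewrite (ExE P (f := fun x => `|x| ^+ 0)) ?expr0 ?Ex_cst//; exact: bmf_cst.
  rewrite -cP//; apply: ae_eq_integral => //.
  - by apply/measurable_EFinP; apply: (measurable_funX (f := fun x : R => `|x|)); exact: measurableT_comp.
  - by apply/measurable_EFinP; exact: measurable_powR.
  exists (~` [set x | 0 < x]); split; first exact: measurableC.
    by have := @probability_setC _ _ _ P _ pos; rewrite P1 subee.
  move=> x /= h x0; apply: h => _; rewrite gtr0_norm// powR_mulrn//; exact: ltW.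
symmetry; apply: laplace_determines => // n; case: n => [|n].
  by under Ex_ext do rewrite mul0r oppr0 expR0; under [RHS]Ex_ext do rewrite mul0r oppr0 expR0; rewrite !Ex_cst.
apply: (laplace_unique (ler0n _ _) (abs _ mu1 cmu) (abs _ nu1 cnu)).
apply: cvg_ext_near (diversity_moment_growth (l := n.+1%:R) _); last by rewrite ltr0n.
by exists 1%N => // -[].
Qed.

End diversity_law.

(** * Numbers of occupied classes *)

Section occupancy_polynomials.
Context {R : realType}.
Implicit Types (x y v : R).

(** The probability 1 - (1 - x) ^ n that n trials hit a class of mass x, divided by x.
    If x is the mass of the class of a random individual, the expectation of this
    quotient is the expected number of classes hit. *)
Fixpoint occ (n : nat) : {poly R} := if n is m.+1 then 1 + (1 - 'X) * occ m else 0.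

Lemma occS n x : (occ n.+1).[x] = 1 + (1 - x) * (occ n).[x].
Proof. by rewrite /= !hornerE. Qed.

Lemma occ0 x : (occ 0).[x] = 0. Proof. by rewrite /= horner0. Qed.

Lemma mul_occ n x : x * (occ n).[x] = 1 - (1 - x) ^+ n.
Proof.
elim: n => [|n ih]; first by rewrite occ0 expr0 mulr0 subrr.
by rewrite occS mulrDr mulrCA ih exprS; ring.
Qed.

Lemma occSr n x : (occ n.+1).[x] = (occ n).[x] + (1 - x) ^+ n.
Proof.
elim: n => [|n ih]; first by rewrite occS !occ0 expr0; ring.
by rewrite [LHS]occS {1}ih [in RHS]occS exprS; ring.
Qed.

Lemma hit01 n x : 0 <= x <= 1 -> 0 <= 1 - (1 - x) ^+ n <= 1.
Proof.
move=> /andP[x0 x1]; rewrite subr_ge0 gerBl exprn_ge0 ?subr_ge0// andbT.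
by rewrite exprn_ile1 ?subr_ge0// gerBl.
Qed.

Lemma hit_le n x : 0 <= x <= 1 -> 1 - (1 - x) ^+ n <= n%:R * x.
Proof.
move=> /andP[x0 x1]; elim: n => [|n ih]; first by rewrite expr0 subrr mul0r.
rewrite exprS -natr1; have : (1 - x) ^+ n <= 1 by rewrite exprn_ile1 ?subr_ge0// gerBl.
have : 0 <= (1 - x) ^+ n by rewrite exprn_ge0// subr_ge0.
move: ((1 - x) ^+ n) ih => z ih; nra.
Qed.

(** The function of v is (1 - (1 - v x) ^ n) / x, whose derivative n (1 - v x) ^ (n - 1)
    lies between 0 and n; the division by x is avoided by induction on n. *)
Lemma occ_lip n x v v' : 0 <= x <= 1 -> 0 <= v' <= v -> v <= 1 ->
  0 <= v * (occ n).[v * x] - v' * (occ n).[v' * x] <= n%:R * (v - v').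
Proof.
move=> /andP[x0 x1] /andP[v0 vv] v1; elim: n => [|n /andP[ih1 ih2]].
  by rewrite !occ0 !mulr0 subrr mul0r lexx.
have vx : 0 <= v' * x <= 1 by rewrite mulr_ge0//= mulr_ile1//; exact: le_trans v1.
have /andP[h1 h2] := hit01 n vx.
have E : v * (occ n.+1).[v * x] - v' * (occ n.+1).[v' * x] =
    (v - v') * (1 - (v' * x) * (occ n).[v' * x]) +
    (1 - v * x) * (v * (occ n).[v * x] - v' * (occ n).[v' * x]).
  by rewrite !occS; ring.
rewrite E mul_occ.
have w1 : 0 <= v - v' by rewrite subr_ge0.
have vx1 : 0 <= 1 - v * x <= 1.
  by rewrite subr_ge0 gerBl mulr_ge0 ?andbT ?mulr_ile1//; exact: le_trans vv.
have /andP[u0 u1] := vx1.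
rewrite -natr1; move: (_ - v' * _) ((1 - v' * x) ^+ n) (1 - v * x) (v - v') ih1 ih2 h1 h2 w1 u0 u1.
move=> a c e f ih1 ih2 h1 h2 w1 u0 u1; apply/andP; split; first by rewrite addr_ge0// mulr_ge0//; lra.
nra.
Qed.

(** Thinning: n trials hit a class of mass v x through those among them, binomial in
    number, that fall into a part of mass v, within which the class has mass x. *)
Lemma occ_thinning n v x :
  v * (occ n).[v * x] = binomial_mean n v (fun j => (occ j).[x]).
Proof.
elim: n => [|n ih]; first by rewrite /= !horner0 mulr0.
have -> : binomial_mean n.+1 v (fun j => (occ j).[x]) =
    v * binomial_mean n v (fun j => (occ j.+1).[x]) + (1 - v) * binomial_mean n v (fun j => (occ j).[x]).
  by [].
have -> : (fun j => (occ j.+1).[x]) = (fun j => 1 + (1 - x) * (occ j).[x]).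
  by apply/funext => j; rewrite occS.
rewrite binomial_meanD binomial_mean_cst binomial_meanZ -ih occS.
by ring.
Qed.

End occupancy_polynomials.

(** * The martingale of hits *)

Section occupancy_martingale.
Context d (T : measurableType d) (R : realType) (P : probability T R).
Notation Ex := (Ex P).
Notation Gamma := (@Gamma_fun R).
Notation Beta := (@Beta_fun R).
Context (alpha theta : R) (alpha_gt0 : 0 < alpha) (alpha_lt1 : alpha < 1) (theta_gt : - alpha < theta).
Context (U : nat -> T -> R).
Hypotheses (mU : forall i, measurable_fun setT (U i)) (U01 : forall i w, 0 <= U i w <= 1).
Hypothesis indU : forall k (f : nat -> R -> R), (forall i, ubm (f i)) ->
  Ex (fun w => \prod_(i < k) f i (U i w)) = \prod_(i < k) Ex (fun w => f i (U i w)).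
Notation b := (stick_b alpha theta).
Hypothesis momU : forall i (p q : R), 0 <= p -> 0 <= q ->
  Ex (fun w => U i w `^ p * (1 - U i w) `^ q) = Beta (1 - alpha + p) (b i + q) / Beta (1 - alpha) (b i).
Notation V := (rest U).

Let a1 : 0 < 1 - alpha. Proof. by rewrite subr_gt0. Qed.
Let b0 i : 0 < b i. Proof. exact: stick_b_gt0. Qed.
Let bmfU i : bmf (U i). Proof. exact: (bmf_U mU U01 i ubm_id). Qed.

Let U0 i w : 0 <= U i w. Proof. by have /andP[] := U01 i w. Qed.
Let U1 i w : 0 <= 1 - U i w. Proof. by have /andP[_] := U01 i w; rewrite subr_ge0. Qed.
Let V0 k w : 0 <= V k w. Proof. by have /andP[] := rest01 U01 k w. Qed.
Let V1 k w : V k w <= 1. Proof. by have /andP[] := rest01 U01 k w. Qed.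

Let mom k m : R := Ex (fun w => U k w ^+ m).

Let momE k m : mom k m = Beta (1 - alpha + m%:R) (b k) / Beta (1 - alpha) (b k).
Proof.
have := momU k (ler0n R m) (lexx 0); rewrite addr0 => <-.
by apply: Ex_ext => w; rewrite powRr0 mulr1 powR_mulrn.
Qed.

Let momCE k m : Ex (fun w => (1 - U k w) ^+ m) = Beta (1 - alpha) (b k + m%:R) / Beta (1 - alpha) (b k).
Proof.
have := momU k (lexx 0) (ler0n R m); rewrite addr0 => <-.
by apply: Ex_ext => w; rewrite powRr0 mul1r powR_mulrn.
Qed.

(** As the classes come in size-biased order, E U_k ^ m is the expected sum of the
    powers of order m + 1 of the masses of the classes from k on, in units of the mass
    they share. Separating class k from the others gives the recursion, which amounts to
    an identity between Beta functions. *)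
Let mom_rec k m : mom k m.+1 + Ex (fun w => (1 - U k w) ^+ m.+1) * mom k.+1 m = mom k m.
Proof.
rewrite !momE momCE.
have b1 : b k.+1 = b k + alpha by rewrite /stick_b -[k.+2%:R]natr1; ring.
have am : 0 < 1 - alpha + m%:R by rewrite ltr_wpDr.
have -> : 1 - alpha + m.+1%:R = (1 - alpha + m%:R) + 1 by rewrite -natr1 addrA.
have z0 := b0 k.
have p1 : 0 < b k + alpha by exact: addr_gt0.
have p2 : 0 < b k + m.+1%:R by exact: addr_gt0.
rewrite BetaS// b1 !Beta_Gamma//.
have e1 : 1 - alpha + (b k + alpha) = b k + 1 by ring.
have e2 : 1 - alpha + m%:R + (b k + alpha) = b k + m.+1%:R by rewrite -natr1; ring.
have e3 : 1 - alpha + (b k + m.+1%:R) = (1 - alpha + m%:R + b k) + 1 by rewrite -natr1; ring.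
have n0 : 0 < 1 - alpha + m%:R + b k by rewrite addr_gt0.
rewrite e1 e2 e3 !GammaS//.
have g1 := Gamma_gt0 a1; have g2 := Gamma_gt0 (b0 k); have g3 := Gamma_gt0 am.
have g4 : 0 < Gamma (b k + m.+1%:R) by rewrite Gamma_gt0// addr_gt0.
have g5 : 0 < Gamma (1 - alpha + b k) by rewrite Gamma_gt0// addr_gt0.
have g6 := Gamma_gt0 n0.
have g7 : 0 < Gamma (b k + alpha) by rewrite Gamma_gt0// addr_gt0.
move: (Gamma (1 - alpha)) (Gamma (b k)) (Gamma (1 - alpha + m%:R)) (Gamma (b k + m.+1%:R)) (Gamma (1 - alpha + b k))
  (Gamma (1 - alpha + m%:R + b k)) (Gamma (b k + alpha)) g1 g2 g3 g4 g5 g6 g7 => G1 G2 G3 G4 G5 G6 G7 g1 g2 g3 g4 g5 g6 g7.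
move: n0 am (b0 k); move: (b k) (m%:R : R) => z y n0 y0 z0'.
by field; rewrite !gt_eqF.
Qed.

(** The expected number of classes hit by n trials among those from index k on, when
    they share the mass v. The sum is the expectation of v (occ n).[v U_k], expanded so
    that it is visibly a polynomial in v. *)
Definition hits_left n k v : R :=
  v * \sum_(m < size (occ n : {poly R})) (occ n)`_m * v ^+ m * Ex (fun w => U k w ^+ m).
Notation g := hits_left.

Lemma hits_leftE n k v : g n k v = v * Ex (fun w => (occ n).[v * U k w]).
Proof.
rewrite /g; congr (_ * _); under [RHS]Ex_ext do rewrite horner_coef.
rewrite Ex_sum; last by move=> i; apply/bmfZ/bmfX/bmfZ.
apply: eq_bigr => m _; rewrite -ExZ; last exact: bmfX.
by apply: Ex_ext => w; rewrite exprMn mulrA.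
Qed.

Lemma bmf_occ n k v : bmf (fun w => (occ n).[v * U k w]).
Proof.
under eq_fun do rewrite horner_coef.
by apply: bmf_sum => i; apply/bmfZ/bmfX/bmfZ.
Qed.

Lemma hits_left_lip n k v v' : 0 <= v' <= v -> v <= 1 ->
  0 <= g n k v - g n k v' <= n%:R * (v - v').
Proof.
move=> v01 v1; rewrite !hits_leftE -!ExZ -?ExB; try exact: bmf_occ; try exact/bmfZ/bmf_occ.
have h w := occ_lip n (U01 k w) v01 v1.
have bB : bmf (fun w => v * (occ n).[v * U k w] - v' * (occ n).[v' * U k w]).
  by apply: bmfB; exact/bmfZ/bmf_occ.
apply/andP; split; first by apply: Ex_ge0 => w; have /andP[] := h w.
rewrite -[leRHS](Ex_cst P); apply: Ex_le => //; first exact: bmf_cst.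
by move=> w; have /andP[] := h w.
Qed.

Lemma hits_left_ge0 n k v : 0 <= v <= 1 -> 0 <= g n k v <= n%:R * v.
Proof.
move=> /andP[v0 v1]; have v00 : (0 : R) <= 0 <= v by rewrite lexx.
by have := hits_left_lip n k v00 v1; rewrite subr0 (_ : g n k 0 = 0) ?subr0// /g mul0r.
Qed.

Definition hits_full k m : R := Ex (fun w => (occ m).[U k w]).

Lemma hits_left_thinning n k v : g n k v = binomial_mean n v (hits_full k).
Proof.
rewrite hits_leftE -ExZ; last exact: bmf_occ.
under Ex_ext do rewrite occ_thinning.
have bo j : bmf (fun w => (occ j).[U k w]).
  by have := bmf_occ j k 1; under eq_fun do rewrite mul1r.
rewrite /hits_full.
have H F : (forall j : nat, bmf (F j)) ->
    bmf (fun w => binomial_mean n v (F ^~ w)) /\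
    Ex (fun w => binomial_mean n v (F ^~ w)) = binomial_mean n v (fun j => Ex (F j)).
  elim: n F => [|n ih] F bF //=.
  have [h1 h2] := ih (fun j => F j.+1) (fun j => bF j.+1); have [h3 h4] := ih F bF.
  split; first by apply: bmfD; exact: bmfZ.
  by rewrite ExD ?ExZ ?h2 ?h4//; exact: bmfZ.
by have [] := H (fun j w => (occ j).[U k w]) bo.
Qed.

Definition hits n i w : R := \sum_(j < i) (1 - (1 - V j w * U j w) ^+ n).
(** The conditional expectation, given the first i classes, of the number of classes
    hit. *)
Definition hits_mart n i w : R := hits n i w + g n i (V i w).

Lemma span_hits_left n k i : span U i (fun w => g n k (V i w)).
Proof.
rewrite /g; apply: spanM; first exact: span_rest_nat.
apply: span_sum => m.
apply: (span_ext (spanZ ((occ n)`_m * Ex (fun w => U k w ^+ m)) (spanX m (span_rest_nat U01 i)))) => w.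
by rewrite mulrAC.
Qed.

Lemma span_hits n i : span U i (hits n i).
Proof.
apply: (@span_sum _ _ _ U i _ _ xpredT (fun (j : 'I_i) w => 1 - (1 - V j w * U j w) ^+ n)) => j.
apply: spanB; first exact: span_cst.
apply: spanX; apply: spanB; first exact: span_cst.
apply: spanM; first by apply: spanW (span_rest_nat U01 j); exact: ltnW.
exact: (@span_proj _ _ _ U i j id (ltn_ord j) ubm_id).
Qed.

Lemma span_hits_mart n i : span U i (hits_mart n i).
Proof. by apply: span_add; [exact: span_hits|exact: span_hits_left]. Qed.

Lemma bmf_hits_mart n i : bmf (hits_mart n i).
Proof. exact: (span_bmf mU U01 (span_hits_mart n i)). Qed.

Let hits_martS n i w : hits_mart n i.+1 w - hits_mart n i w =
  (1 - (1 - V i w * U i w) ^+ n) + g n i.+1 (V i w * (1 - U i w)) - g n i (V i w).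
Proof. by rewrite /hits_mart /hits big_ord_recr/= restS; ring. Qed.

(** The martingale property. It is checked coefficient by coefficient in V_i, each
    coefficient vanishing by mom_rec. *)
Lemma hits_mart_orth n i Z : span U i Z ->
  Ex (fun w => Z w * (hits_mart n i.+1 w - hits_mart n i w)) = 0.
Proof.
move=> sZ.
pose A m w := Z w * V i w ^+ m.+1.
have sA m : span U i (A m) by apply: spanM => //; apply: spanX; exact: span_rest_nat.
pose q m := (occ n : {poly R})`_m.
have E w : Z w * (hits_mart n i.+1 w - hits_mart n i w) =
    \sum_(m < size (occ n : {poly R})) q m * (A m w * U i w ^+ m.+1 + A m w * (1 - U i w) ^+ m.+1 * mom i.+1 m
        - A m w * mom i m).
  rewrite hits_martS -mul_occ horner_coef /g !mulr_sumr -big_split/= -sumrB mulr_sumr.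
  by apply: eq_bigr => m _; rewrite /A /q -!/(mom _ _) !exprS !exprMn; ring.
under Ex_ext do rewrite E.
have u1 m : ubm (fun x : R => x ^+ m) by apply: (ubm_exp m ubm_id).
have u2 m : ubm (fun x : R => (1 - x) ^+ m) by apply: (ubm_exp m ubm_onem).
have bA m := span_bmf mU U01 (sA m).
have b1 m : bmf (fun w => A m w * U i w ^+ m.+1) by apply: bmfM => //; exact: bmfX.
have bU1 : bmf (fun w => 1 - U i w) by apply: bmfB => //; exact: bmf_cst.
have b2 m : bmf (fun w => A m w * (1 - U i w) ^+ m.+1) by apply: bmfM => //; exact: bmfX.
have b2' m : bmf (fun w => A m w * (1 - U i w) ^+ m.+1 * mom i.+1 m) by apply: bmfM => //; exact: bmf_cst.
have b3 m : bmf (fun w => A m w * mom i m) by apply: bmfM => //; exact: bmf_cst.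
rewrite Ex_sum; last by move=> m; apply/bmfZ/bmfB => //; exact: bmfD.
rewrite big1// => m _; rewrite ExZ; last by apply/bmfB => //; exact: bmfD.
rewrite ExB//; last exact: bmfD.
rewrite ExD//.
have Zr (f : T -> R) c : bmf f -> Ex (fun w => f w * c) = Ex f * c.
  by move=> bf; under Ex_ext do rewrite mulrC; rewrite ExZ// mulrC.
rewrite !Zr// (Ex_span mU U01 indU (sA m) (u1 m.+1)) (Ex_span mU U01 indU (sA m) (u2 m.+1)).
by rewrite -mulrA -mulrDr -/(mom i m.+1) mom_rec subrr mulr0.
Qed.

(** Centring only decreases second moments, so g n i (V_i) may be replaced in the
    increment by g n (i + 1) (V_i). The increment becomes a difference of two numbers
    between 0 and n V_i U_i. *)
Lemma hits_mart_increment n i :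
  Ex (fun w => (hits_mart n i.+1 w - hits_mart n i w) ^+ 2) <=
  n%:R ^+ 2 * (Ex (fun w => V i w ^+ 2) * Ex (fun w => U i w ^+ 2)).
Proof.
pose A w := hits_mart n i.+1 w - hits_mart n i w.
pose B w := g n i.+1 (V i w) - g n i (V i w).
have sB : span U i B by apply: spanB; exact: span_hits_left.
have bA : bmf A by apply: bmfB; exact: bmf_hits_mart.
have bB := span_bmf mU U01 sB.
have AB := hits_mart_orth n sB.
have bV := span_bmf mU U01 (span_rest_nat U01 i).
have h1 : Ex (fun w => (A w) ^+ 2) <= Ex (fun w => (A w - B w) ^+ 2).
  have E w : (A w - B w) ^+ 2 = A w ^+ 2 + B w ^+ 2 - 2 * (B w * A w) by ring.
  under [leRHS]Ex_ext do rewrite E.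
  have bAB : bmf (fun w => B w * A w) by exact: bmfM.
  have b2 := bmfX 2 bA; have b3 := bmfX 2 bB.
  rewrite ExB; [|exact: bmfD|exact: bmfZ].
  rewrite ExD// ExZ// AB mulr0 subr0 lerDl.
  by apply: Ex_ge0 => w; exact: sqr_ge0.
apply: le_trans h1 _.
have -> : n%:R ^+ 2 * (Ex (fun w => V i w ^+ 2) * Ex (fun w => U i w ^+ 2)) =
    Ex (fun w => n%:R ^+ 2 * (V i w ^+ 2 * U i w ^+ 2)).
  rewrite ExZ; last by apply: bmfM; exact: bmfX.
  by rewrite -(Ex_span mU U01 indU (spanX 2 (span_rest_nat U01 i)) (ubm_exp 2 ubm_id)).
apply: Ex_le => [||w]; first exact/bmfX/bmfB.
  by apply/bmfZ/bmfM; exact: bmfX.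
have -> : A w - B w = (1 - (1 - V i w * U i w) ^+ n) -
    (g n i.+1 (V i w) - g n i.+1 (V i w * (1 - U i w))) by rewrite /A hits_martS /B; ring.
have VU : 0 <= V i w * U i w <= 1.
  by rewrite mulr_ge0//= mulr_ile1//; have /andP[] := U01 i w.
have /andP[h1 h2] := hit01 n VU; have h3 := hit_le n VU.
have vv : 0 <= V i w * (1 - U i w) <= V i w.
  by rewrite mulr_ge0//= ler_piMr// gerBl.
have /andP[h4 h5] := hits_left_lip n i.+1 vv (V1 i w).
have e : V i w - V i w * (1 - U i w) = V i w * U i w by ring.
rewrite e in h5; rewrite -!exprMn mulrA in h3 h5 *.
move: (g n _ _ - _) (1 - (1 - _) ^+ n) h1 h2 h3 h4 h5 => x y; move: (n%:R * _ * _) => z h1 h2 h3 h4 h5.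
by nra.
Qed.

End occupancy_martingale.

Section occupied_classes.
Context {R : realType}.

Lemma sum_mem_uniq (s : seq nat) L : uniq s ->
  (\sum_(j < L) (j.+1 \in s : nat) = count (fun v => 0 < v <= L) s)%N.
Proof.
elim: s => [_|x s ih /= /andP[xs us]]; first by rewrite big1.
rewrite -ih//.
have E (j : 'I_L) : (j.+1 \in x :: s : nat) = ((j.+1 == x) + (j.+1 \in s))%N.
  by rewrite in_cons; case: eqP => //= ->; rewrite (negbTE xs).
under eq_bigr do rewrite E.
rewrite big_split/=; congr (_ + _)%N.
have [/andP[x0 xL]|xn] := boolP (0 < x <= L)%N.
  case: x x0 xL {xs E} => // x _ xL.
  rewrite (bigD1 (Ordinal xL))//= eqxx big1// => i; rewrite eqSS -val_eqE/=.
  by move=> /negbTE ->.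
rewrite big1// => i _; case: eqP => // ix.
by move: xn; rewrite -ix /= ltn_ord.
Qed.

End occupied_classes.

(** * Distinct values against their conditional expectation *)

Section sample.
Context d (T : measurableType d) (R : realType) (P : probability T R).
Notation Ex := (Ex P).
Notation Gamma := (@Gamma_fun R).
Notation Beta := (@Beta_fun R).
Context (alpha theta : R) (alpha_gt0 : 0 < alpha) (alpha_lt1 : alpha < 1) (theta_gt : - alpha < theta).
Context (U : nat -> T -> R).
Hypotheses (mU : forall i, measurable_fun setT (U i)) (U01 : forall i w, 0 <= U i w <= 1).
Hypothesis indU : forall k (f : nat -> R -> R), (forall i, ubm (f i)) ->
  Ex (fun w => \prod_(i < k) f i (U i w)) = \prod_(i < k) Ex (fun w => f i (U i w)).
Notation b := (stick_b alpha theta).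
Hypothesis momU : forall i (p q : R), 0 <= p -> 0 <= q ->
  Ex (fun w => U i w `^ p * (1 - U i w) `^ q) = Beta (1 - alpha + p) (b i + q) / Beta (1 - alpha) (b i).
Notation V := (rest U).
Notation g := (hits_left P U).
Notation M_ := (hits_mart P U).
Notation kappa := (hits_full P U).

Let b0 i : 0 < b i. Proof. exact: stick_b_gt0. Qed.
Let bmfU i : bmf (U i). Proof. exact: (bmf_U mU U01 i ubm_id). Qed.
Let U0 i w : 0 <= U i w. Proof. by have /andP[] := U01 i w. Qed.
Let U1 i w : 0 <= 1 - U i w. Proof. by have /andP[_] := U01 i w; rewrite subr_ge0. Qed.
Let V0 k w : 0 <= V k w. Proof. by have /andP[] := rest01 U01 k w. Qed.
Let V1 k w : V k w <= 1. Proof. by have /andP[] := rest01 U01 k w. Qed.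
Let bmfV k : bmf (V k). Proof. exact: (span_bmf mU U01 (span_rest_nat U01 k)). Qed.

Lemma stick_bB_gt0 k : (0 < k)%N -> 0 < b k - alpha.
Proof.
case: k => // k _; rewrite /stick_b -[k.+2%:R]natr1 -natr1.
have h : 0 <= k%:R * alpha by rewrite mulr_ge0// ltW.
by move: alpha_gt0 theta_gt h; move: (k%:R : R) => z *; nra.
Qed.

(** Adding a trial adds E (1 - U_k) ^ m, a quotient of Gamma functions which is the
    increment of another such quotient; the sum telescopes. *)
Lemma hits_full_closed k m : (0 < k)%N -> kappa k m =
  (Gamma (b k - alpha + 1) / Gamma (b k) * (Gamma (b k + m%:R) / Gamma (b k - alpha + m%:R)) - (b k - alpha)) / alpha.
Proof.
move=> k0; have y0 := stick_bB_gt0 k0; have z0 := b0 k.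
elim: m => [|m ih].
  rewrite /hits_full; under Ex_ext do rewrite occ0.
  rewrite Ex_cst !addr0 (GammaS y0).
  have := Gamma_gt0 z0; have := Gamma_gt0 y0.
  move: (Gamma (b k)) (Gamma (b k - alpha)) => G1 G2 g2 g1.
  have -> : (b k - alpha) * G2 / G1 * (G1 / G2) = b k - alpha by field; rewrite !gt_eqF.
  by rewrite subrr mul0r.
have bo : bmf (fun w => (occ m).[U k w]).
  by have := bmf_occ mU U01 m k 1; under eq_fun do rewrite mul1r.
have bU : bmf (fun w => (1 - U k w) ^+ m) by apply: bmfX; apply: bmfB => //; exact: bmf_cst.
have -> : kappa k m.+1 = kappa k m + Ex (fun w => (1 - U k w) ^+ m).
  by rewrite /hits_full; under Ex_ext do rewrite occSr; rewrite ExD.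
rewrite ih.
have -> : Ex (fun w => (1 - U k w) ^+ m) = Beta (1 - alpha) (b k + m%:R) / Beta (1 - alpha) (b k).
  have := momU k (lexx 0) (ler0n R m); rewrite addr0 => <-.
  by apply: Ex_ext => w; rewrite powRr0 mul1r powR_mulrn.
have ym : 0 < b k - alpha + m%:R by rewrite ltr_wpDr.
have zm : 0 < b k + m%:R by rewrite ltr_wpDr.
have a1 : 0 < 1 - alpha by rewrite subr_gt0.
rewrite !Beta_Gamma//.
have -> : 1 - alpha + b k = b k - alpha + 1 by ring.
have -> : 1 - alpha + (b k + m%:R) = b k - alpha + m%:R + 1 by ring.
have -> : b k + m.+1%:R = b k + m%:R + 1 by rewrite -natr1 addrA.
have -> : b k - alpha + m.+1%:R = b k - alpha + m%:R + 1 by rewrite -natr1 addrA.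
have y1 : 0 < Gamma (b k - alpha + 1) by rewrite Gamma_gt0// addr_gt0.
rewrite (GammaS ym) (GammaS zm).
have := Gamma_gt0 a1; have := Gamma_gt0 z0; have := Gamma_gt0 ym; have := Gamma_gt0 zm; move: y1 ym.
move: (Gamma (1 - alpha)) (Gamma (b k)) (Gamma (b k - alpha + m%:R)) (Gamma (b k + m%:R)) (Gamma (b k - alpha + 1)).
move: (b k) (m%:R : R) alpha_gt0 => z x al0 G1 G2 G3 G4 G5 g5 ym g4 g3 g2 g1.
by field; rewrite !gt_eqF.
Qed.

Lemma hits_full_le k m : (0 < k)%N ->
  kappa k m <= b k `^ (1 - alpha) * (b k - alpha + m%:R) `^ alpha / alpha.
Proof.
move=> k0; have y0 := stick_bB_gt0 k0; have z0 := b0 k.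
have a01 : 0 <= alpha <= 1 by rewrite !ltW.
have a01' : 0 <= 1 - alpha <= 1 by move: a01 => /andP[? ?]; apply/andP; split; lra.
have ym : 0 < b k - alpha + m%:R by rewrite ltr_wpDr.
have w1 := wendel_le (@gamma_like_Gamma R) z0 a01'.
have w2 := wendel_le (@gamma_like_Gamma R) ym a01.
rewrite hits_full_closed// ler_pM2r ?invr_gt0//.
apply: (@le_trans _ _ (Gamma (b k - alpha + 1) / Gamma (b k) * (Gamma (b k + m%:R) / Gamma (b k - alpha + m%:R)))).
  by rewrite gerBl ltW.
have e1 : b k + (1 - alpha) = b k - alpha + 1 by ring.
have e2 : b k - alpha + m%:R + alpha = b k + m%:R by ring.
rewrite e1 in w1; rewrite e2 in w2.
have g1 : 0 < Gamma (b k - alpha + 1) by rewrite Gamma_gt0// addr_gt0.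
have g2 : 0 < Gamma (b k + m%:R) by rewrite Gamma_gt0// ltr_wpDr.
apply: ler_pM.
- exact: divr_ge0 (ltW g1) (ltW (Gamma_gt0 z0)).
- exact: divr_ge0 (ltW g2) (ltW (Gamma_gt0 ym)).
- rewrite (ler_pdivrMr _ _ (Gamma_gt0 z0)); exact: w1.
- rewrite (ler_pdivrMr _ _ (Gamma_gt0 ym)); exact: w2.
Qed.

(** All that is used of the conditional law of the sample: the class of index j, being
    the value j + 1, is missed by n trials with conditional probability
    (1 - p_j) ^ n, and two classes are both missed with conditional probability
    (1 - p_j - p_l) ^ n. *)
Context (X : nat -> T -> nat).
Definition miss n j w : R := \prod_(i < n) (X i w != j.+1)%:R.
Notation p_ j w := (V j w * U j w).
Hypothesis X_gt0 : forall i w, (0 < X i w)%N.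
Hypothesis bmf_miss : forall n j, bmf (miss n j).
Hypothesis miss1 : forall n j, Ex (miss n j) = Ex (fun w => (1 - p_ j w) ^+ n).
Hypothesis missM : forall n j l, Ex (fun w => miss n j w * (1 - p_ l w) ^+ n) =
  Ex (fun w => (1 - p_ j w) ^+ n * (1 - p_ l w) ^+ n).
Hypothesis miss2 : forall n j l, j != l -> Ex (fun w => miss n j w * miss n l w) =
  Ex (fun w => (1 - p_ j w - p_ l w) ^+ n).

Definition hit_count n L w : R := \sum_(j < L) (1 - miss n j w).

Let missE n j w : miss n j w = (j.+1 \notin mkseq (X ^~ w) n)%:R.
Proof.
elim: n => [|n ih]; first by rewrite /miss big_ord0.
rewrite /miss big_ord_recr/= -/(miss n j w) ih mkseqS mem_rcons in_cons negb_or mulrC -natrM mulnb.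
by rewrite eq_sym.
Qed.

Let hit_countE n L w :
  hit_count n L w = (count (fun v => 0 < v <= L)%N (undup (mkseq (X ^~ w) n)))%:R.
Proof.
rewrite -sum_mem_uniq ?undup_uniq// natr_sum; apply: eq_bigr => j _.
by rewrite missE mem_undup; case: (_ \in _); rewrite ?subr0 ?subrr.
Qed.

(** The hits are counted among the first L classes only, so that all sums are finite;
    L is sent to infinity in the end. *)
Lemma hit_count_cvg n w : hit_count n L w @[L --> \oo] --> ((num_distinct X n w)%:R : R).
Proof.
apply: (@cvg_ext_near _ (fun=> (num_distinct X n w)%:R)); last exact: cvg_cst.
exists (\max_(i < n) X i w) => // L /= hL.
rewrite hit_countE /num_distinct -[in LHS](@count_predT _ (undup _)); congr (_%:R).
apply: eq_in_count => v; rewrite mem_undup => /mapP[i].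
rewrite mem_iota add0n => /andP[_ i_n] ->; rewrite X_gt0/=.
by symmetry; apply: leq_trans hL; exact: (@leq_bigmax_cond _ xpredT (fun i : 'I_n => X i w) (Ordinal i_n)).
Qed.

Lemma hit_count_le n L w : 0 <= hit_count n L w <= n%:R.
Proof.
rewrite hit_countE ler0n ler_nat/=; apply: leq_trans (count_size _ _) _.
by apply: leq_trans (size_undup _) _; rewrite size_mkseq.
Qed.

Lemma bmf_hit_count n L : bmf (hit_count n L).
Proof. by apply: bmf_sum => j; apply: bmfB => //; exact: bmf_cst. Qed.

Lemma bmf_num_distinct n : bmf (fun w => (num_distinct X n w)%:R : R).
Proof.
split.
  apply: (@measurable_fun_cvg _ _ _ setT (fun L w => hit_count n L w)) => //.
    by move=> L; exact: (bmf_measurable (bmf_hit_count n L)).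
  by move=> w _; exact: hit_count_cvg.
exists n%:R => w; rewrite ger0_norm// ler_nat.
by apply: leq_trans (size_undup _) _; rewrite size_mkseq.
Qed.

Let p01 j w : 0 <= p_ j w <= 1.
Proof. by rewrite mulr_ge0//= mulr_ile1//; have /andP[] := U01 j w. Qed.

Let p_disjoint j l w : (j < l)%N -> p_ j w + p_ l w <= 1.
Proof.
move=> jl; have Vni : nonincreasing_seq (V ^~ w).
  by apply/nonincreasing_seqP => n; rewrite restS ler_piMr// gerBl.
have h1 : p_ l w <= V l w by rewrite ler_piMr//; have /andP[] := U01 l w.
have h2 : V l w <= V j w * (1 - U j w) by rewrite -restS; exact: Vni.
have h3 := V1 j w; lra.
Qed.

Let p_disjoint' j l w : j != l -> p_ j w + p_ l w <= 1.
Proof. by rewrite neq_ltn => /orP[|/p_disjoint]; [exact: p_disjoint|rewrite addrC]. Qed.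

Let bmfp j : bmf (fun w => p_ j w). Proof. exact: bmfM. Qed.

Let q n j w := (1 - p_ j w) ^+ n.
Let bmfq n j : bmf (q n j).
Proof. by apply: bmfX; apply: bmfB => //; exact: bmf_cst. Qed.

(** Given the sticks the events of missing two distinct classes are negatively
    correlated, as 1 - p_j - p_l <= (1 - p_j) (1 - p_l). So the conditional variance of
    the count is at most the sum of the individual variances, hence at most its
    mean. *)
Lemma hit_count_variance n L :
  Ex (fun w => (hit_count n L w - hits U n L w) ^+ 2) <= Ex (hits U n L).
Proof.
pose D j w := q n j w - miss n j w.
have bD j : bmf (D j) by exact: bmfB.
have E w : (hit_count n L w - hits U n L w) ^+ 2 = \sum_(j < L) \sum_(l < L) D j w * D l w.
  rewrite /hit_count /hits -sumrB expr2 mulr_suml; apply: eq_bigr => j _.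
  by rewrite mulr_sumr; apply: eq_bigr => l _; rewrite /D /q; ring.
under Ex_ext do rewrite E.
have bDD j l : bmf (fun w => D j w * D l w) by exact: bmfM.
have EH : Ex (hits U n L) = \sum_(j < L) Ex (fun w => 1 - q n j w).
  by rewrite -Ex_sum// => j; apply: bmfB => //; exact: bmf_cst.
rewrite EH Ex_sum; last by move=> j; exact: bmf_sum.
apply: ler_sum => j _; rewrite Ex_sum// (bigD1 j)//= -[leRHS]addr0; apply: lerD.
  have E2 w : D j w * D j w = q n j w * q n j w - 2 * (miss n j w * q n j w) + miss n j w.
    have m2 : miss n j w * miss n j w = miss n j w by rewrite missE; case: (_ \notin _); rewrite ?mulr1 ?mulr0.
    by rewrite /D -{4}m2; ring.
  under Ex_ext do rewrite E2.
  have bqq : bmf (fun w => q n j w * q n j w) by exact: bmfM.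
  have bmq : bmf (fun w => miss n j w * q n j w) by exact: bmfM.
  have bmq2 : bmf (fun w => 2 * (miss n j w * q n j w)) by exact: bmfZ.
  rewrite ExD//; last exact: bmfB.
  rewrite ExB// ExZ// missM miss1 -/(q n j).
  have -> : Ex (fun w => q n j w * q n j w) - 2 * Ex (fun w => q n j w * q n j w) + Ex (q n j) =
      Ex (fun w => q n j w - q n j w * q n j w) by rewrite ExB//; ring.
  apply: Ex_le => [||w]; [exact: bmfB|by apply: bmfB => //; exact: bmf_cst|].
  have /andP[h1 h2] := hit01 n (p01 j w); rewrite -/(q n j w) in h1 h2 *.
  by move: (q n j w) h1 h2 => z h1 h2; nra.
apply: sumr_le0 => l lj.
have jl : j != l :> nat by rewrite eq_sym.
have E2 w : D j w * D l w = q n j w * q n l w - miss n l w * q n j w - miss n j w * q n l w + miss n j w * miss n l w.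
  by rewrite /D; ring.
under Ex_ext do rewrite E2.
have bqq : bmf (fun w => q n j w * q n l w) by exact: bmfM.
have b1 : bmf (fun w => miss n l w * q n j w) by exact: bmfM.
have b2 : bmf (fun w => miss n j w * q n l w) by exact: bmfM.
have b3 : bmf (fun w => miss n j w * miss n l w) by exact: bmfM.
have b4 : bmf (fun w => q n j w * q n l w - miss n l w * q n j w) by exact: bmfB.
rewrite ExD//; last exact: bmfB.
rewrite !ExB// !missM miss2//.
have -> : Ex (fun w => (1 - p_ l w) ^+ n * (1 - p_ j w) ^+ n) = Ex (fun w => q n j w * q n l w).
  by apply: Ex_ext => w; rewrite mulrC.
rewrite -/(q n j) -/(q n l) subrr sub0r addrC subr_le0.
apply: Ex_le => // [|w]; first by apply: bmfX; apply: bmfB => //; apply: bmfB => //; exact: bmf_cst.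
have h := p_disjoint' w jl; have /andP[h1 _] := p01 j w; have /andP[h2 _] := p01 l w.
rewrite /q -exprMn; apply: lerXn2r; rewrite ?nnegrE; move: (p_ j w) (p_ l w) h h1 h2 => x y h h1 h2.
- by lra.
- by nra.
- by nra.
Qed.

(** The martingale of hits has constant expectation, which is read off at i = 1. *)
Lemma Ex_hits_le n L : (0 < L)%N -> Ex (hits U n L) <= 1 + kappa 1 n.
Proof.
move=> L0.
have bM i : bmf (M_ n i) by exact: bmf_hits_mart.
have step i : Ex (M_ n i.+1) = Ex (M_ n i).
  have := hits_mart_orth alpha_gt0 alpha_lt1 theta_gt mU U01 indU momU n (span_cst U i 1).
  under Ex_ext do rewrite mul1r.
  by rewrite (ExB P (bM i.+1) (bM i)) => /eqP; rewrite subr_eq0 => /eqP.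
have -> : 1 + kappa 1 n = Ex (fun=> 1 + kappa 1 n) by rewrite Ex_cst.
have bh i : bmf (hits U n i) by exact: (span_bmf mU U01 (span_hits U01 n i)).
apply: (@le_trans _ _ (Ex (M_ n L))).
  apply: Ex_le => // w; rewrite /hits_mart lerDl.
  by have /andP[] := @hits_left_ge0 _ _ _ P _ mU U01 n L (V L w) (rest01 U01 L w).
have -> : Ex (M_ n L) = Ex (M_ n 1).
  case: L L0 => [|L _]; first by rewrite ltnn.
  by elim: L => [|L ih]; [reflexivity|rewrite step].
apply: Ex_le => // [|w]; first exact: bmf_cst.
rewrite /hits_mart /hits big_ord1; apply: lerD.
  by have /andP[] := hit01 n (p01 0 w).
have := @hits_left_lip _ _ _ P _ mU U01 n 1 1 (V 1 w) (rest01 U01 1 w) (lexx _).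
rewrite subr_ge0 => /andP[h _]; apply: le_trans h _.
by rewrite hits_leftE// mul1r /hits_full; under Ex_ext do rewrite mul1r.
Qed.

Let e2 : R := 2 * (1 - alpha) / alpha.

Let Ex_V2 : exists2 C, 0 < C & forall k, (0 < k)%N ->
  Ex (fun w => V k w ^+ 2) <= C * k%:R `^ (- e2).
Proof.
have p0 : 0 <= 2 / alpha by rewrite divr_ge0// ltW.
have [B B0 hB] := cvg_bounded (cvg_approx_div_moment alpha_gt0 alpha_lt1 theta_gt mU U01 indU momU p0).
exists (B * alpha ^+ 2); first by rewrite mulr_gt0// exprn_gt0.
move=> k k0; have k0' : 0 < k%:R :> R by rewrite ltr0n.
have := le_trans (ler_norm _) (hB k).
rewrite Ex_approx_divX// divfK ?gt_eqF//.
have -> : Ex (fun w => V k w `^ 2) = Ex (fun w => V k w ^+ 2).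
  by apply: Ex_ext => w; rewrite powR_mulrn.
rewrite powRM ?powR_ge0// -!powRrM.
have -> : (1 - alpha) * (2 / alpha) = e2 by rewrite /e2; ring.
have -> : - alpha * (2 / alpha) = - 2 by field; rewrite gt_eqF.
rewrite !powRN powR_mulrn ?(ltW alpha_gt0)// => h.
have x0 := powR_gt0 e2 k0'.
by rewrite (ler_pdivlMr _ _ x0); move: h; rewrite mulrA (ler_pdivrMr _ _ (exprn_gt0 2 alpha_gt0)).
Qed.

(** After k classes the increments are small, since V_k is already of order
    k `^ (- (1 - alpha) / alpha) in mean square. *)
Lemma hits_mart_block : exists2 C, 0 < C & forall n k L, (0 < k <= L)%N ->
  Ex (fun w => (M_ n L w - M_ n k w) ^+ 2) <= C * (n%:R ^+ 2 * (k%:R `^ (- e2) * k%:R^-1)).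
Proof.
have [C C0 hC] := Ex_V2.
pose c0 := Num.min (theta + alpha) alpha.
have c0_gt0 : 0 < c0 by rewrite /c0 lt_min alpha_gt0 andbT -ltrBlDr sub0r.
have e20 : 0 <= e2 by rewrite /e2 !mulr_ge0 ?invr_ge0 ?subr_ge0 ?(ltW alpha_gt0) ?(ltW alpha_lt1).
pose c1 := 2 / c0 ^+ 2.
have c1_gt0 : 0 < c1 by rewrite divr_gt0// exprn_gt0.
exists (C * c1); first by rewrite mulr_gt0.
move=> n k L /andP[k0 kL]; have k0' : 0 < k%:R :> R by rewrite ltr0n.
pose Mk i := M_ n (maxn k i).
have bM i : bmf (M_ n i) by exact: bmf_hits_mart.
pose v i : R := n%:R ^+ 2 * ((C * k%:R `^ (- e2)) * (c1 * i.+1%:R ^- 2)).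
have v0 i : 0 <= v i.
  by rewrite /v !mulr_ge0 ?powR_ge0 ?(ltW C0) ?(ltW c1_gt0) ?invr_ge0 ?sqr_ge0.
have step i : Ex (fun w => (Mk i.+1 w - Mk i w) ^+ 2) <= v i.
  rewrite /Mk; have [ki|ik] := leqP k i; last first.
    rewrite (maxn_idPl ik).
    by under Ex_ext do rewrite subrr expr0n/=; rewrite Ex_cst.
  rewrite (maxn_idPr (leqW ki)).
  apply: le_trans (hits_mart_increment alpha_gt0 alpha_lt1 theta_gt mU U01 indU momU n i) _.
  rewrite ler_wpM2l ?sqr_ge0//.
  apply: ler_pM; try by apply: Ex_ge0 => w; exact: sqr_ge0.
    apply: le_trans (hC i (leq_trans k0 ki)) _; rewrite ler_pM2l//.
    rewrite !powRN lef_pV2 ?posrE ?powR_gt0 ?ltr0n ?(leq_trans k0 ki)//.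
    by rewrite ge0_ler_powR ?nnegrE// ler_nat.
  exact: (Ex_U2_le alpha_gt0 alpha_lt1 theta_gt U01 momU).
have orth i j : (i <= j)%N -> Ex (fun w => (Mk j w - Mk i w) * (Mk j.+1 w - Mk j w)) = 0.
  move=> ij; rewrite /Mk; have [kj|jk] := leqP k j; last first.
    rewrite (maxn_idPl jk).
    by under Ex_ext do rewrite subrr mulr0; rewrite Ex_cst.
  rewrite (maxn_idPr (leqW kj)).
  apply: (hits_mart_orth alpha_gt0 alpha_lt1 theta_gt mU U01 indU momU).
  apply: spanB; first exact: span_hits_mart.
  by apply: spanW (span_hits_mart _ U01 n _); rewrite geq_max kj.
have := orthogonal_increments (fun i => bM (maxn k i)) orth step kL.
rewrite /Mk maxnn (maxn_idPr kL) => h; apply: le_trans h _.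
rewrite /v -!mulr_sumr.
have -> : C * c1 * (n%:R ^+ 2 * (k%:R `^ (- e2) / k%:R)) =
   n%:R ^+ 2 * (C * k%:R `^ (- e2) * (c1 * k%:R^-1)) by ring.
rewrite ler_wpM2l ?sqr_ge0// ler_wpM2l ?mulr_ge0 ?powR_ge0 ?(ltW C0)// ler_pM2l//.
case: k k0 kL {k0' Mk v v0 step orth} => // k _; case: L => // L kL.
by rewrite big_add1/=; exact: sum_invsq_le.
Qed.

(** Up to the hits among the first k classes, at most k in number, the expected number
    of hits given those classes is g n k (V_k), an explicit function of what remains of
    the stick. The three error terms come from the fluctuation of the sample given the sticks, from
    the martingale beyond index k, and from the first k classes themselves. *)
Lemma num_distinct_error : exists2 C, 0 < C & forall n k, (0 < n)%N -> (0 < k)%N ->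
  Ex (fun w => ((num_distinct X n w)%:R - g n k (V k w)) ^+ 2) <=
  C * (n%:R `^ alpha + n%:R ^+ 2 * (k%:R `^ (- e2) * k%:R^-1) + k%:R ^+ 2).
Proof.
have [C1 C10 hC1] := hits_mart_block; have [C2 C20 hC2] := Ex_V2.
have z0 := b0 1; have y0 := @stick_bB_gt0 1 isT.
pose C3 := 1 + b 1 `^ (1 - alpha) * (b 1 - alpha + 1) `^ alpha / alpha.
have C30 : 0 < C3 by rewrite /C3 ltr_wpDr// !mulr_ge0 ?powR_ge0 ?invr_ge0 ?(ltW alpha_gt0).
have hC3 n : (0 < n)%N -> 1 + kappa 1 n <= C3 * n%:R `^ alpha.
  move=> n0; have n1 : 1 <= n%:R :> R by rewrite ler1n.
  have n0' : 0 < n%:R :> R by rewrite ltr0n.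
  rewrite /C3 mulrDl mul1r; apply: lerD.
    have e : (1 : R) `^ alpha = 1 by rewrite powR1.
    by rewrite -{1}e ge0_ler_powR ?nnegrE ?(ltW alpha_gt0).
  apply: le_trans (hits_full_le n (isT : (0 < 1)%N)) _.
  rewrite [leRHS]mulrAC ler_pM2r ?invr_gt0// -mulrA ler_wpM2l ?powR_ge0//.
  have y10 : 0 <= b 1 - alpha + 1 by rewrite addr_ge0// ltW.
  rewrite -(powRM alpha y10 (ler0n R n)) ge0_ler_powR ?nnegrE ?(ltW alpha_gt0) ?mulr_ge0//.
    by rewrite addr_ge0// ltW.
  by rewrite mulrDl mul1r lerD2r ler_peMr// ltW.
move: C3 C30 hC3 => C3 C30 hC3.
have C4 : 0 < C1 + C3 + 1 by rewrite !addr_gt0.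
exists (4 * (C1 + C3 + 1)); first exact: mulr_gt0.
move=> n k n0 k0.
pose K w : R := (num_distinct X n w)%:R.
have bV := span_bmf mU U01 (span_hits_left P U01 n k k).
pose A := n%:R `^ alpha + n%:R ^+ 2 * (k%:R `^ (- e2) * k%:R^-1) + k%:R ^+ 2.
have e20 : 0 < e2 by rewrite /e2 !mulr_gt0 ?invr_gt0 ?subr_gt0.
have lim1 : Ex (fun w => (hit_count n L w - g n k (V k w)) ^+ 2) @[L --> \oo] -->
    Ex (fun w => (K w - g n k (V k w)) ^+ 2).
  have bound w (x : R) : 0 <= x <= n%:R -> (x - g n k (V k w)) ^+ 2 <= n%:R ^+ 2.
    move=> /andP[x0 x1].
    have /andP[h1 h2] := @hits_left_ge0 _ _ _ P _ mU U01 n k (V k w) (rest01 U01 k w).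
    have h3 : g n k (V k w) <= n%:R by apply: le_trans h2 _; rewrite ler_piMr.
    rewrite -[leLHS]real_normK ?num_real// ler_sqr ?nnegrE// ler_norml.
    by move: (g n k _) h1 h3 => z h1 h3; apply/andP; split; lra.
  apply: (@Ex_cvg _ _ _ P _ _ (n%:R ^+ 2)).
  - move=> L; apply: bmf_measurable; apply/bmfX/bmfB => //; exact: bmf_hit_count.
  - by apply: bmf_measurable; apply/bmfX/bmfB => //; exact: bmf_num_distinct.
  - by move=> L w; rewrite ger0_norm ?sqr_ge0// bound// hit_count_le.
  - apply: aeW => w; rewrite [X in _ --> X]expr2.
    have h : hit_count n L w - g n k (V k w) @[L --> \oo] --> K w - g n k (V k w).
      by apply: cvgB; [exact: hit_count_cvg|exact: cvg_cst].
    exact: (cvg_mul h h).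
have lim2 : 4 * (C1 + C3 + 1) * A + 4 * (n%:R ^+ 2 * (C2 * (L%:R^-1) `^ e2)) @[L --> \oo] -->
    4 * (C1 + C3 + 1) * A + 4 * (n%:R ^+ 2 * (C2 * 0)).
  apply: cvgD; first exact: cvg_cst.
  apply: cvg_scale; apply: cvg_scale; apply: cvg_scale.
  apply: (cvgE (cvg_powR_ge0 e20 _ (lexx 0) (@cvg_inv0 R))); last by rewrite powR0// gt_eqF.
  by move=> L; rewrite invr_ge0.
rewrite !mulr0 addr0 in lim2.
apply: (ler_cvg_to lim1 lim2); exists k => // L /= kL.
have L0 := leq_trans k0 kL.
have bh i : bmf (hits U n i) by exact: (span_bmf mU U01 (span_hits U01 n i)).
have bgL := span_bmf mU U01 (span_hits_left P U01 n L L).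
have bM i : bmf (M_ n i) by exact: bmf_hits_mart.
have bc := bmf_hit_count n L.
pose t1 w := hit_count n L w - hits U n L w.
pose t2 w := M_ n L w - M_ n k w.
have b1 : bmf (fun w => t1 w ^+ 2) by apply/bmfX/bmfB.
have b2 : bmf (fun w => t2 w ^+ 2) by apply/bmfX/bmfB.
have b3 : bmf (fun w => g n L (V L w) ^+ 2) by exact: bmfX.
have b4 : bmf (fun w => hits U n k w ^+ 2) by exact: bmfX.
have b12 : bmf (fun w => t1 w ^+ 2 + t2 w ^+ 2) by exact: bmfD.
have b123 : bmf (fun w => t1 w ^+ 2 + t2 w ^+ 2 + g n L (V L w) ^+ 2) by exact: bmfD.
have b1234 : bmf (fun w => t1 w ^+ 2 + t2 w ^+ 2 + g n L (V L w) ^+ 2 + hits U n k w ^+ 2) by exact: bmfD.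
apply: (@le_trans _ _ (4 * Ex (fun w => t1 w ^+ 2 + t2 w ^+ 2 + g n L (V L w) ^+ 2 + hits U n k w ^+ 2))).
  rewrite -ExZ//; apply: Ex_le => [||w]; [by apply/bmfX/bmfB|exact: bmfZ|].
  have -> : hit_count n L w - g n k (V k w) = t1 w + t2 w - g n L (V L w) + hits U n k w.
    by rewrite /t1 /t2 /hits_mart; ring.
  move: (t1 w) (t2 w) (g n L _) (hits U n k w) => x1 x2 x3 x4.
  (* Lagrange's identity *)
  rewrite -subr_ge0.
  have -> : 4 * (x1 ^+ 2 + x2 ^+ 2 + x3 ^+ 2 + x4 ^+ 2) - (x1 + x2 - x3 + x4) ^+ 2 =
     (x1 - x2) ^+ 2 + (x1 + x3) ^+ 2 + (x1 - x4) ^+ 2 + (x2 + x3) ^+ 2 + (x2 - x4) ^+ 2 + (x3 + x4) ^+ 2 by ring.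
  by rewrite !addr_ge0 ?sqr_ge0.
rewrite -mulrA -mulrDr ler_pM2l// !ExD//.
have h1 := le_trans (hit_count_variance n L) (le_trans (Ex_hits_le n L0) (hC3 n n0)).
have h2 := hC1 n k L; rewrite k0 kL in h2; have {}h2 := h2 isT.
have h3 : Ex (fun w => g n L (V L w) ^+ 2) <= n%:R ^+ 2 * (C2 * (L%:R^-1) `^ e2).
  apply: (@le_trans _ _ (n%:R ^+ 2 * Ex (fun w => V L w ^+ 2))).
    rewrite -ExZ; last exact: bmfX.
    apply: Ex_le => // [|w]; first by apply: bmfZ; exact: bmfX.
    have /andP[u1 u2] := @hits_left_ge0 _ _ _ P _ mU U01 n L (V L w) (rest01 U01 L w).
    by rewrite -exprMn ler_sqr ?nnegrE// mulr_ge0.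
  rewrite ler_wpM2l ?sqr_ge0// powRVp ?ltr0n// -powRN; exact: hC2.
have h4 : Ex (fun w => hits U n k w ^+ 2) <= k%:R ^+ 2.
  rewrite -[leRHS](Ex_cst P); apply: Ex_le => // [|w]; first exact: bmf_cst.
  have u j : 0 <= 1 - (1 - p_ j w) ^+ n <= 1 := hit01 n (p01 j w).
  have hk : hits U n k w <= k%:R.
    rewrite -[k in leRHS]card_ord -sumr_const; apply: ler_sum => j _.
    by have /andP[] := u j.
  by rewrite ler_sqr ?nnegrE//; apply: sumr_ge0 => j _; have /andP[] := u j.
have a0 : 0 <= n%:R `^ alpha by exact: powR_ge0.
have a1 : 0 <= n%:R ^+ 2 * (k%:R `^ (- e2) * k%:R^-1) by rewrite !mulr_ge0 ?sqr_ge0 ?powR_ge0 ?invr_ge0.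
have a2 : 0 <= k%:R ^+ 2 :> R by exact: sqr_ge0.
move: h1 h2 h3 h4 a0 a1 a2; rewrite /A.
move: (Ex _) (Ex _) (Ex _) (Ex _) (n%:R `^ alpha) (n%:R ^+ 2 * (_ * _^-1)) (k%:R ^+ 2) (_ * (C2 * _)).
by move: C10 C30 => ? ? *; nra.
Qed.

End sample.

(** * Asymptotics of the expected number of hits *)

Section hits_left_asymptotics.
Context d (T : measurableType d) (R : realType) (P : probability T R).
Notation Ex := (Ex P).
Notation Beta := (@Beta_fun R).
Context (alpha theta : R) (alpha_gt0 : 0 < alpha) (alpha_lt1 : alpha < 1) (theta_gt : - alpha < theta).
Context (U : nat -> T -> R).
Hypotheses (mU : forall i, measurable_fun setT (U i)) (U01 : forall i w, 0 <= U i w <= 1).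
Notation b := (stick_b alpha theta).
Hypothesis momU : forall i (p q : R), 0 <= p -> 0 <= q ->
  Ex (fun w => U i w `^ p * (1 - U i w) `^ q) = Beta (1 - alpha + p) (b i + q) / Beta (1 - alpha) (b i).
Notation g := (hits_left P U).
Notation kappa := (hits_full P U).

Let b0 i : 0 < b i. Proof. exact: stick_b_gt0. Qed.
Let a01 : 0 <= alpha <= 1. Proof. by rewrite !ltW. Qed.

Lemma binomial_mean_id n (y : R) : binomial_mean n y (fun k => k%:R) = n%:R * y.
Proof.
elim: n => [|n ih] /=; first by rewrite mul0r.
under binomial_mean_ext do rewrite -natr1.
by rewrite binomial_meanD binomial_mean_cst ih -[in RHS]natr1; ring.
Qed.

(** Jensen's inequality: the tangent line at the mean is integrated. *)
Lemma binomial_mean_powR_le n (v z : R) : 0 <= v <= 1 -> 0 < z ->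
  binomial_mean n v (fun j => (z + j%:R) `^ alpha) <= (z + n%:R * v) `^ alpha.
Proof.
move=> v01 z0; have /andP[v0 v1] := v01; pose l := z + n%:R * v.
have l0 : 0 < l by rewrite ltr_wpDr// mulr_ge0.
apply: (@le_trans _ _ (binomial_mean n v (fun j =>
    (alpha * l `^ (alpha - 1)) * j%:R + (alpha * z * l `^ (alpha - 1) + (1 - alpha) * l `^ alpha)))).
  apply: binomial_mean_le => // j.
  have zj : 0 < z + j%:R by rewrite ltr_wpDr.
  by apply: le_trans (powR_tangent zj l0 a01) _; rewrite le_eqVlt; apply/orP; left; apply/eqP; ring.
rewrite binomial_meanD binomial_mean_cst binomial_meanZ binomial_mean_id -/l.
have -> : alpha * l `^ (alpha - 1) * (n%:R * v) + (alpha * z * l `^ (alpha - 1) + (1 - alpha) * l `^ alpha) =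
   alpha * (l * l `^ (alpha - 1)) + (1 - alpha) * l `^ alpha by rewrite /l; ring.
rewrite powRB1//; move: (l `^ alpha) => x.
by rewrite le_eqVlt; apply/orP; left; apply/eqP; field; rewrite gt_eqF.
Qed.

(** Conversely u `^ alpha >= 1 - |u - 1|, and |u - 1| <= e / 2 + (u - 1)^2 / (2 e), with
    mean at most e by the binomial variance for e = z `^ (- 1/2). Here z is a
    parameter tending to infinity, so the loss is negligible. *)
Lemma binomial_mean_powR_ge n (v z : R) : 0 <= v <= 1 -> 0 < z ->
  (z + n%:R * v) `^ alpha * (1 - (Num.sqrt z)^-1) <=
  binomial_mean n v (fun j => (z + j%:R) `^ alpha).
Proof.
move=> v01 z0; have /andP[v0 v1] := v01; pose l := z + n%:R * v.
have nv : 0 <= n%:R * v by rewrite mulr_ge0.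
have l0 : 0 < l by rewrite ltr_wpDr.
pose e := (Num.sqrt z)^-1.
have e0 : 0 < e by rewrite invr_gt0 sqrtr_gt0.
have e2 : e ^+ 2 = z^-1 by rewrite exprVn sqr_sqrtr// ltW.
apply: (@le_trans _ _ (binomial_mean n v (fun j => l `^ alpha *
   ((1 - e / 2) - (j%:R - n%:R * v) ^+ 2 / (2 * e * l ^+ 2))))); last first.
  apply: binomial_mean_le => // j.
  have zj : 0 < z + j%:R by rewrite ltr_wpDr.
  pose u := (z + j%:R) / l; have u0 : 0 < u by rewrite divr_gt0.
  have -> : (z + j%:R) `^ alpha = l `^ alpha * u `^ alpha.
    by rewrite -powRM ?(ltW l0) ?(ltW u0)// /u mulrC divfK// gt_eqF.
  rewrite ler_pM2l ?powR_gt0//.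
  have -> : (j%:R - n%:R * v) ^+ 2 / (2 * e * l ^+ 2) = (u - 1) ^+ 2 / (2 * e).
    have -> : u - 1 = (j%:R - n%:R * v) / l by rewrite /u /l; field; rewrite gt_eqF.
    by field; rewrite !gt_eqF.
  have h1 : 1 - `|u - 1| <= u `^ alpha.
    have [u1|u1] := leP u 1.
      rewrite ler0_norm ?subr_le0// opprB opprB addrC subrK.
      by apply: powR_ge_id; rewrite ?(ltW u0)// alpha_gt0 ltW.
    apply: (@le_trans _ _ 1); first by rewrite gerBl.
    have e1 : (1 : R) `^ alpha = 1 by rewrite powR1.
    by rewrite -{1}e1 ge0_ler_powR ?nnegrE ?(ltW alpha_gt0) ?(ltW u0) ?(ltW u1).
  apply: le_trans h1; rewrite -(real_normK (num_real (u - 1))).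
  move: `|u - 1| => a; rewrite -subr_ge0.
  have -> : 1 - a - (1 - e / 2 - a ^+ 2 / (2 * e)) = (a - e) ^+ 2 / (2 * e).
    by field; rewrite gt_eqF.
  by rewrite divr_ge0 ?sqr_ge0// mulr_ge0// ltW.
rewrite binomial_meanZ -/l -/e ler_pM2l ?powR_gt0//.
rewrite binomial_meanB binomial_mean_cst.
under binomial_mean_ext do rewrite mulrC.
rewrite binomial_meanZ binomial_mean_sqr subrr expr0n add0r.
have h2 : (2 * e * l ^+ 2)^-1 * (n%:R * (v * (1 - v))) <= e / 2.
  have h3 : n%:R * (v * (1 - v)) <= l.
    rewrite mulrA /l; apply: (@le_trans _ _ (n%:R * v)); last by rewrite lerDr ltW.
    by rewrite ler_piMr// gerBl.
  have h4 : l / l ^+ 2 <= e ^+ 2.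
    by rewrite e2 expr2 invfM mulVKf ?gt_eqF// lef_pV2 ?posrE// lerDl.
  have -> : (2 * e * l ^+ 2)^-1 * (n%:R * (v * (1 - v))) = (n%:R * (v * (1 - v)) / l ^+ 2) / (2 * e).
    by field; rewrite !gt_eqF.
  rewrite ler_pdivrMr ?mulr_gt0//.
  have -> : e / 2 * (2 * e) = e ^+ 2 by field.
  by apply: le_trans h4; rewrite ler_pM2r// invr_gt0 exprn_gt0.
by move: (_^-1 * _) h2 => x h2; lra.
Qed.

(** Wendel's lower bounds in the closed form of the expected number of hits. *)
Lemma hits_full_ge k m : (0 < k)%N ->
  ((b k - alpha) * (b k - alpha + 1) `^ (- alpha) * (b k + m%:R) `^ alpha - (b k - alpha)) / alpha <= kappa k m.
Proof.
move=> k0; have y0 := stick_bB_gt0 alpha_gt0 theta_gt k0; have z0 := b0 k.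
have a01' : 0 <= 1 - alpha <= 1 by move: a01 => /andP[? ?]; apply/andP; split; lra.
have ym : 0 < b k - alpha + m%:R by rewrite ltr_wpDr.
have zm : 0 < b k + m%:R by rewrite ltr_wpDr.
have w1 := wendel_ge (@gamma_like_Gamma R) z0 a01'.
have w2 := wendel_ge (@gamma_like_Gamma R) ym a01.
rewrite (hits_full_closed alpha_gt0 alpha_lt1 theta_gt mU U01 momU)// ler_pM2r ?invr_gt0// lerD2r.
have e1 : b k + (1 - alpha) = b k - alpha + 1 by ring.
have e2 : b k - alpha + m%:R + alpha = b k + m%:R by ring.
have e3 : 1 - alpha - 1 = - alpha by ring.
rewrite e1 e3 in w1; rewrite e2 in w2.
apply: (@le_trans _ _ ((b k * (b k - alpha + 1) `^ (- alpha)) * ((b k - alpha + m%:R) * (b k + m%:R) `^ (alpha - 1)))).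
  rewrite powRB1//.
  have -> : b k * (b k - alpha + 1) `^ (- alpha) * ((b k - alpha + m%:R) * ((b k + m%:R) `^ alpha / (b k + m%:R))) =
     (b k * (b k - alpha + m%:R) / (b k + m%:R)) * (b k - alpha + 1) `^ (- alpha) * (b k + m%:R) `^ alpha by ring.
  rewrite ler_wpM2r ?powR_ge0// ler_wpM2r ?powR_ge0//.
  rewrite ler_pdivlMr//; have := ler0n R m; move: (m%:R : R) (b k) alpha_gt0 => x z ? ?; nra.
apply: ler_pM.
- by rewrite mulr_ge0 ?powR_ge0// ltW.
- by rewrite mulr_ge0 ?powR_ge0// ltW.
- rewrite (ler_pdivlMr _ _ (Gamma_gt0 z0)); exact: w1.
- rewrite (ler_pdivlMr _ _ (Gamma_gt0 ym)); exact: w2.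
Qed.

Lemma hits_left_le n k (v : R) : (0 < k)%N -> 0 <= v <= 1 ->
  g n k v <= b k `^ (1 - alpha) * (b k + n%:R * v) `^ alpha / alpha.
Proof.
move=> k0 v01; have y0 := stick_bB_gt0 alpha_gt0 theta_gt k0; have z0 := b0 k.
rewrite (hits_left_thinning P mU U01).
apply: (@le_trans _ _ (binomial_mean n v (fun m => b k `^ (1 - alpha) / alpha * (b k + m%:R) `^ alpha))).
  apply: binomial_mean_le => // m.
  apply: le_trans (hits_full_le alpha_gt0 alpha_lt1 theta_gt mU U01 momU m k0) _.
  rewrite mulrAC ler_wpM2l ?mulr_ge0 ?powR_ge0 ?invr_ge0 ?(ltW alpha_gt0)//.
  rewrite ge0_ler_powR ?nnegrE ?(ltW alpha_gt0)//.
  - by rewrite ltW// ltr_wpDr.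
  - by rewrite ltW// ltr_wpDr.
  - by rewrite lerD2r gerBl ltW.
rewrite binomial_meanZ [leRHS]mulrAC ler_wpM2l ?mulr_ge0 ?powR_ge0 ?invr_ge0 ?(ltW alpha_gt0)//.
exact: binomial_mean_powR_le.
Qed.

Lemma hits_left_ge n k (v : R) : (0 < k)%N -> 0 <= v <= 1 ->
  ((b k - alpha) * (b k - alpha + 1) `^ (- alpha) * ((b k + n%:R * v) `^ alpha * (1 - (Num.sqrt (b k))^-1))
    - (b k - alpha)) / alpha <= g n k v.
Proof.
move=> k0 v01; have y0 := stick_bB_gt0 alpha_gt0 theta_gt k0; have z0 := b0 k.
rewrite (hits_left_thinning P mU U01).
pose c := (b k - alpha) * (b k - alpha + 1) `^ (- alpha).
apply: (@le_trans _ _ (binomial_mean n v (fun m => alpha^-1 * (c * (b k + m%:R) `^ alpha - (b k - alpha))))); last first.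
  by apply: binomial_mean_le => // m; rewrite mulrC; exact: hits_full_ge.
rewrite binomial_meanZ binomial_meanB binomial_meanZ binomial_mean_cst mulrC.
rewrite ler_pM2l ?invr_gt0// lerD2r -/c ler_wpM2l ?mulr_ge0 ?powR_ge0 ?(ltW y0)//.
exact: binomial_mean_powR_ge.
Qed.

(** The bounds above both have the size (alpha k) `^ (1 - alpha) (b_k + n v) `^ alpha / alpha.
    For k much smaller than n `^ alpha the term b_k may be dropped, and n `^ alpha times
    the normalised rest remains. *)
Lemma hits_left_cvg (n k : nat -> nat) (v : nat -> R) (l : R) :
  (forall j, (0 < n j)%N) -> (forall j, (0 < k j)%N) -> (forall j, 0 <= v j <= 1) ->
  (k j)%:R^-1 @[j --> \oo] --> (0 : R) -> (k j)%:R / (n j)%:R `^ alpha @[j --> \oo] --> (0 : R) ->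
  0 <= l -> v j `^ alpha * (k j)%:R `^ (1 - alpha) * alpha `^ (- alpha) @[j --> \oo] --> l ->
  g (n j) (k j) (v j) / (n j)%:R `^ alpha @[j --> \oo] --> l.
Proof.
move=> n0 k0 v01 kinv kn l0 vl.
have n0' j : 0 < (n j)%:R :> R by rewrite ltr0n.
have k0' j : 0 < (k j)%:R :> R by rewrite ltr0n.
have na j := powR_gt0 alpha (n0' j).
have y0 j := stick_bB_gt0 alpha_gt0 theta_gt (k0 j).
have z0 j := b0 (k j).
have v0 j : 0 <= v j by have /andP[] := v01 j.
have ratio (c : R) : (c + (k j)%:R * alpha) / ((k j)%:R * alpha) @[j --> \oo] --> (1 : R).
  apply: (@cvg_ext _ (fun j => 1 + c / alpha * (k j)%:R^-1)).
    by move=> j; field; rewrite !gt_eqF.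
  apply: (@cvgE _ _ (1 + c / alpha * 0)); last by rewrite mulr0 addr0.
  by apply: cvgD; [exact: cvg_cst|exact: cvg_scale].
have bE j : b (k j) = (theta + alpha) + (k j)%:R * alpha by rewrite /stick_b -natr1; ring.
have bE' j : b (k j) - alpha = theta + (k j)%:R * alpha by rewrite bE; ring.
have rz : b (k j) / ((k j)%:R * alpha) @[j --> \oo] --> (1 : R).
  by apply: cvg_ext (ratio (theta + alpha)) => j; rewrite bE.
have ry : (b (k j) - alpha) / ((k j)%:R * alpha) @[j --> \oo] --> (1 : R).
  by apply: cvg_ext (ratio theta) => j; rewrite bE'.
have ry1 : (b (k j) - alpha + 1) / ((k j)%:R * alpha) @[j --> \oo] --> (1 : R).
  by apply: cvg_ext (ratio (theta + 1)) => j; rewrite bE'; congr (_ / _); ring.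
have ka j : 0 < (k j)%:R * alpha by exact: mulr_gt0.
pose D j := v j `^ alpha * (k j)%:R `^ (1 - alpha) * alpha `^ (- alpha).
have D0 j : 0 <= D j by rewrite /D !mulr_ge0 ?powR_ge0.
pose A j := b (k j) `^ (1 - alpha) * (b (k j) + (n j)%:R * v j) `^ alpha / alpha / (n j)%:R `^ alpha.
pose err j := b (k j) / ((k j)%:R * alpha) * ((k j)%:R / (n j)%:R `^ alpha) `^ alpha^-1.
have ia : 0 < alpha^-1 by rewrite invr_gt0.
have err0 : err j @[j --> \oo] --> (0 : R).
  have h : ((k j)%:R / (n j)%:R `^ alpha) `^ alpha^-1 @[j --> \oo] --> (0 : R).
    apply: (cvgE (cvg_powR_ge0 ia _ (lexx 0) kn)); last by rewrite powR0// gt_eqF.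
    by move=> j; rewrite divr_ge0// ltW.
  by apply: (cvgE (cvg_mul rz h)); rewrite mulr0.
have err_ge0 j : 0 <= err j.
  by rewrite /err mulr_ge0 ?powR_ge0// divr_ge0 ?(ltW (z0 j))// ltW.
have AE j : A j = (b (k j) / ((k j)%:R * alpha)) `^ (1 - alpha) * (D j `^ alpha^-1 + err j) `^ alpha.
  have -> : D j `^ alpha^-1 + err j =
      (k j)%:R `^ ((1 - alpha) / alpha) * alpha^-1 * ((b (k j) + (n j)%:R * v j) / (n j)%:R).
    have -> : D j `^ alpha^-1 = (k j)%:R `^ ((1 - alpha) / alpha) * alpha^-1 * v j.
      rewrite /D !powRM ?mulr_ge0 ?powR_ge0// -!powRrM mulfV ?gt_eqF// powRr1//.
      by rewrite mulNr mulfV ?gt_eqF// powRN powRr1 ?(ltW alpha_gt0)//; ring.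
    have -> : err j = (k j)%:R `^ ((1 - alpha) / alpha) * alpha^-1 * (b (k j) / (n j)%:R).
      rewrite /err powRM ?invr_ge0 ?powR_ge0// powRVp// -powRrM mulfV ?gt_eqF// powRr1 ?ler0n//.
      have -> : alpha^-1 = (1 - alpha) / alpha + 1 by field; rewrite gt_eqF.
      rewrite powRD1//; have -> : (1 - alpha) / alpha + 1 = alpha^-1 by field; rewrite gt_eqF.
      by move: (_ `^ _) => x; field; rewrite !gt_eqF.
    by field; rewrite !gt_eqF.
  have bn : 0 <= b (k j) + (n j)%:R * v j by rewrite addr_ge0 ?(ltW (z0 j))// mulr_ge0.
  rewrite /A !powRM ?mulr_ge0 ?powR_ge0 ?invr_ge0 ?(ltW alpha_gt0) ?(ltW (z0 j)) ?(ltW (ka j))//.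
  rewrite !powRVp// -powRrM divfK ?gt_eqF// powRM ?(ltW alpha_gt0)//.
  have h1 := powR_gt0 (1 - alpha) (k0' j); have h2 := powR_gt0 alpha alpha_gt0.
  have h3 : alpha = alpha `^ (1 - alpha) * alpha `^ alpha.
    by rewrite -powRDp// subrK powRr1// ltW.
  have h4 := powR_gt0 (1 - alpha) alpha_gt0.
  move: h3 h1 h2 h4 (na j).
  move: (b (k j) `^ (1 - alpha)) ((b (k j) + _) `^ alpha) ((n j)%:R `^ alpha) ((k j)%:R `^ (1 - alpha))
    (alpha `^ alpha) (alpha `^ (1 - alpha)) => x1 x2 x3 x4 x5 x6 h3 h1 h2 h4 h5.
  by rewrite h3; field; rewrite !gt_eqF.
have A_cvg : A j @[j --> \oo] --> l.
  have hD : D j `^ alpha^-1 @[j --> \oo] --> l `^ alpha^-1 by exact: cvg_powR_ge0.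
  have hs : D j `^ alpha^-1 + err j @[j --> \oo] --> l `^ alpha^-1.
    by apply: (@cvgE _ _ (l `^ alpha^-1 + 0)); [exact: cvgD|rewrite addr0].
  have hp : (D j `^ alpha^-1 + err j) `^ alpha @[j --> \oo] --> l.
    apply: (cvgE (cvg_powR_ge0 alpha_gt0 _ (powR_ge0 _ _) hs)).
      by move=> j; rewrite addr_ge0 ?powR_ge0.
    by rewrite -powRrM mulVf ?gt_eqF// powRr1.
  apply: (@cvg_ext _ (fun j => (D j `^ alpha^-1 + err j) `^ alpha * (b (k j) / ((k j)%:R * alpha)) `^ (1 - alpha))).
    by move=> j; rewrite AE mulrC.
  by apply: cvgMl1 => //; exact: cvg_powR1.
(* the quotient of the leading terms of the lower and upper bounds *)
pose r j := (b (k j) - alpha) / b (k j) * (b (k j) / (b (k j) - alpha + 1)) `^ alpha.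
have r1 : r j @[j --> \oo] --> (1 : R).
  have q1 := cvgMl1 ry (cvg_inv1 rz); have q2 := cvgMl1 rz (cvg_inv1 ry1).
  apply: cvgMl1.
    by apply: cvg_ext q1 => j; field; rewrite !gt_eqF.
  apply: cvg_powR1; apply: cvg_ext q2 => j; field.
  by rewrite !gt_eqF// addr_gt0.
have s0 : (Num.sqrt (b (k j)))^-1 @[j --> \oo] --> (0 : R).
  have h : (b (k j))^-1 @[j --> \oo] --> (0 : R).
    apply: (@cvg_ext _ (fun j => (b (k j) / ((k j)%:R * alpha))^-1 * (alpha^-1 * (k j)%:R^-1))).
      by move=> j; field; rewrite !gt_eqF.
    by apply: (cvgE (cvg_mul (cvg_inv1 rz) (cvg_scale (c := alpha^-1) kinv))); rewrite !mulr0.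
  apply: (@cvg_ext _ (fun j => Num.sqrt (b (k j))^-1)) => [j|]; first by rewrite sqrtrV ?(ltW (z0 j)).
  by rewrite -sqrtr0; apply: (continuous_cvg _ _ h); exact: sqrt_continuous.
have t0 : (b (k j) - alpha) / alpha / (n j)%:R `^ alpha @[j --> \oo] --> (0 : R).
  apply: (@cvg_ext _ (fun j => (b (k j) - alpha) / ((k j)%:R * alpha) * ((k j)%:R / (n j)%:R `^ alpha))).
    by move=> j; have := na j; move: (_ `^ _) => x x0; field; rewrite !gt_eqF.
  by apply: (cvgE (cvg_mul ry kn)); rewrite mulr0.
have low : A j * r j * (1 - (Num.sqrt (b (k j)))^-1) - (b (k j) - alpha) / alpha / (n j)%:R `^ alpha
    @[j --> \oo] --> l.
  apply: (@cvgE _ _ (l - 0)); last by rewrite subr0.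
  apply: cvgB => //; apply: cvgMl1; first exact: cvgMl1.
  by apply: (@cvgE _ _ (1 - 0)); [apply: cvgB => //; exact: cvg_cst|rewrite subr0].
apply: squeeze_cvgr low A_cvg; apply: nearW => j; apply/andP; split; last first.
  by rewrite /A ler_pM2r ?invr_gt0//; exact: hits_left_le.
apply: le_trans (_ : ((b (k j) - alpha) * (b (k j) - alpha + 1) `^ (- alpha) *
   ((b (k j) + (n j)%:R * v j) `^ alpha * (1 - (Num.sqrt (b (k j)))^-1)) - (b (k j) - alpha)) / alpha / (n j)%:R `^ alpha <= _); last first.
  by rewrite ler_pM2r ?invr_gt0//; exact: hits_left_ge.
have y1 : 0 < b (k j) - alpha + 1 by rewrite addr_gt0.
have -> : r j = (b (k j) - alpha) * (b (k j) - alpha + 1) `^ (- alpha) / b (k j) `^ (1 - alpha).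
  rewrite /r powRM ?invr_ge0 ?(ltW (z0 j)) ?(ltW y1)// powRVp// powRN.
  have -> : 1 - alpha = - alpha + 1 by ring.
  rewrite (powRD1 _ (z0 j)) powRN.
  have h1 := powR_gt0 alpha y1; have h2 := powR_gt0 alpha (z0 j).
  move: h1 h2 (z0 j); move: ((b (k j) - alpha + 1) `^ alpha) (b (k j) `^ alpha) (b (k j)) => x1 x2 x3 ? ? ?.
  by field; rewrite !gt_eqF.
rewrite /A; have h1 := powR_gt0 (1 - alpha) (z0 j); have h2 := na j.
move: h1 h2; move: (b (k j) `^ (1 - alpha)) ((n j)%:R `^ alpha) ((b (k j) + _) `^ alpha) (_ `^ (- alpha)) => x1 x2 x3 x4 h1 h2.
have q0 : 0 < Num.sqrt (b (k j)) by rewrite sqrtr_gt0.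
by rewrite le_eqVlt; apply/orP; left; apply/eqP; field; rewrite !gt_eqF.
Qed.

End hits_left_asymptotics.

(** * The diversity of the sample *)

Section diversity_of_samples.
Context d (T : measurableType d) (R : realType) (P : probability T R).
Notation Ex := (Ex P).
Notation Beta := (@Beta_fun R).
Context (alpha theta : R) (alpha_gt0 : 0 < alpha) (alpha_lt1 : alpha < 1) (theta_gt : - alpha < theta).
Context (U : nat -> T -> R).
Hypotheses (mU : forall i, measurable_fun setT (U i)) (U01 : forall i w, 0 <= U i w <= 1).
Hypothesis indU : forall k (f : nat -> R -> R), (forall i, ubm (f i)) ->
  Ex (fun w => \prod_(i < k) f i (U i w)) = \prod_(i < k) Ex (fun w => f i (U i w)).
Notation b := (stick_b alpha theta).
Hypothesis momU : forall i (p q : R), 0 <= p -> 0 <= q ->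
  Ex (fun w => U i w `^ p * (1 - U i w) `^ q) = Beta (1 - alpha + p) (b i + q) / Beta (1 - alpha) (b i).
Notation V := (rest U).
Notation g := (hits_left P U).
Notation D_ := (approx_div alpha U).
Context (X : nat -> T -> nat).
Notation p_ j w := (V j w * U j w).
Hypothesis X_gt0 : forall i w, (0 < X i w)%N.
Hypothesis bmf_miss : forall n j, bmf (miss R X n j).
Hypothesis miss1 : forall n j, Ex (miss R X n j) = Ex (fun w => (1 - p_ j w) ^+ n).
Hypothesis missM : forall n j l, Ex (fun w => miss R X n j w * (1 - p_ l w) ^+ n) =
  Ex (fun w => (1 - p_ j w) ^+ n * (1 - p_ l w) ^+ n).
Hypothesis miss2 : forall n j l, j != l -> Ex (fun w => miss R X n j w * miss R X n l w) =
  Ex (fun w => (1 - p_ j w - p_ l w) ^+ n).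

(** For n = j ^ r trials and k = j ^ s classes, the three conditions make the three error
    terms of num_distinct_error, divided by n `^ (2 alpha), summable in j. Up to bounded
    terms they place s between r alpha (2 - 2 alpha) / (2 - alpha) and r alpha, an
    interval that contains integers once r is large. *)
Lemma subsequence_exponents : exists r s : nat,
  [/\ (0 < r)%N, (0 < s)%N, 2 <= r%:R * alpha,
      r%:R * (2 - 2 * alpha) - s%:R * (2 * (1 - alpha) / alpha + 1) <= -2 &
      s%:R + 1 <= r%:R * alpha].
Proof.
pose be := alpha^-1; have be1 : alpha * be = 1 by rewrite /be mulfV// gt_eqF.
have be_gt1 : 1 < be by rewrite /be invf_gt1.
pose r := (Num.truncn (8 * be ^+ 2)).+1.
have hr : 8 * be ^+ 2 <= r%:R by rewrite ltW// truncnS_gt.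
pose A := r%:R * alpha * (1 - alpha / 4).
have ra : 8 * be <= r%:R * alpha.
  have -> : 8 * be = 8 * be ^+ 2 * alpha by rewrite expr2 -mulrA -(mulrA be) (mulrC be alpha) be1 mulr1.
  by rewrite ler_pM2r.
have raa : 8 <= r%:R * alpha * alpha.
  have -> : 8 = 8 * be * alpha by rewrite -mulrA (mulrC be) be1 mulr1.
  by rewrite ler_pM2r.
have A6 : 6 <= A by rewrite /A; move: (r%:R * alpha) ra raa alpha_gt0 alpha_lt1 => x *; nra.
have A0 : 0 <= A by apply: le_trans A6.
pose s := Num.truncn A.
have s1 : s%:R <= A by rewrite truncn_le.
have s2 : A < s%:R + 1 by rewrite natr1 truncnS_gt.
exists r, s; split => //.
- by rewrite -(ltr0n R); move: s2 A6; move: (s%:R : R) => z *; lra.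
- by apply: le_trans ra; move: be_gt1 => ?; lra.
- have -> : 2 * (1 - alpha) / alpha + 1 = 2 * be - 1 by rewrite /be; field; rewrite gt_eqF.
  have h1 : (A - 1) * (2 * be - 1) <= s%:R * (2 * be - 1).
    by rewrite ler_wpM2r//; move: be_gt1 s2 => ? ?; lra.
  have h2 : A * (2 * be - 1) = r%:R * (2 - 2 * alpha) + r%:R * alpha / 2 + r%:R * alpha * alpha / 4.
    have -> : A * (2 * be - 1) = 2 * (alpha * be) * (r%:R * (1 - alpha / 4)) - A by rewrite /A; ring.
    by rewrite be1 /A; field.
  move: h1; rewrite mulrBl mul1r h2.
  by move: (s%:R * _) (r%:R * (2 - _)) (r%:R * alpha) (r%:R * alpha * alpha) ra raa be_gt1 => *; lra.
- by move: s1 raa; rewrite /A; move: (r%:R * alpha) (s%:R : R) => x y *; lra.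
Qed.

Let bmfK n : bmf (fun w => (num_distinct X n w)%:R : R).
Proof. exact: (bmf_num_distinct X_gt0 bmf_miss). Qed.

Lemma num_distinct_ae_cvg :
  {ae P, forall w, (num_distinct X n w)%:R / n%:R `^ alpha @[n --> \oo] --> diversity alpha U w}.
Proof.
have [r [s [r0 s0 h1 h2 h3]]] := subsequence_exponents.
have [C C0 hC] := num_distinct_error alpha_gt0 alpha_lt1 theta_gt mU U01 indU momU X_gt0 bmf_miss miss1 missM miss2.
move: (2 * (1 - alpha) / alpha) hC h2 => e hC h2.
pose n j := (j.+1 ^ r)%N; pose k j := (j.+1 ^ s)%N.
have n0 j : (0 < n j)%N by rewrite expn_gt0.
have k0 j : (0 < k j)%N by rewrite expn_gt0.
have n0' j : 0 < (n j)%:R :> R by rewrite ltr0n.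
have k0' j : 0 < (k j)%:R :> R by rewrite ltr0n.
have J0 j : 0 < j.+1%:R :> R by [].
have nE j (p : R) : (n j)%:R `^ p = j.+1%:R `^ (r%:R * p).
  by rewrite /n natrX -powR_mulrn// -powRrM.
have kE j (p : R) : (k j)%:R `^ p = j.+1%:R `^ (s%:R * p).
  by rewrite /k natrX -powR_mulrn// -powRrM.
pose Z j w := ((num_distinct X (n j) w)%:R - g (n j) (k j) (V (k j) w)) / (n j)%:R `^ alpha.
have bK j : bmf (fun w => (num_distinct X (n j) w)%:R - g (n j) (k j) (V (k j) w)).
  by apply: bmfB => //; exact: (span_bmf mU U01 (span_hits_left P U01 (n j) (k j) (k j))).
have bZ j : bmf (Z j) by apply: bmfM => //; exact: bmf_cst.
have pw j (p : R) : p <= -2 -> j.+1%:R `^ p <= j.+1%:R ^- 2.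
  move=> p2; rewrite -powR_mulrn// -powRN; apply: ler_powR => //; by rewrite ler1n.
have Z2 j : Ex (fun w => Z j w ^+ 2) <= 3 * C * j.+1%:R ^- 2.
  have -> : Ex (fun w => Z j w ^+ 2) = ((n j)%:R `^ alpha) ^- 2 *
      Ex (fun w => ((num_distinct X (n j) w)%:R - g (n j) (k j) (V (k j) w)) ^+ 2).
    rewrite -ExZ; last exact: bmfX.
    by apply: Ex_ext => w; rewrite /Z exprMn exprVn mulrC.
  apply: le_trans (ler_wpM2l _ (hC (n j) (k j) (n0 j) (k0 j))) _; first by rewrite invr_ge0 sqr_ge0.
  have e0 : ((n j)%:R `^ alpha) ^- 2 = j.+1%:R `^ (- (2 * (r%:R * alpha))).
    by rewrite nE -powR_mulrn ?powR_ge0// -powRrM powRN mulrC.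
  have e1 : (n j)%:R ^+ 2 = j.+1%:R `^ (2 * r%:R) :> R.
    by rewrite -powR_mulrn ?(ltW (n0' j))// nE mulrC.
  have e2 : (k j)%:R ^+ 2 = j.+1%:R `^ (2 * s%:R) :> R.
    by rewrite -powR_mulrn ?(ltW (k0' j))// kE mulrC.
  have e3 : (k j)%:R^-1 = j.+1%:R `^ (- s%:R) :> R.
    by rewrite -[(k j)%:R](powRr1 (ltW (k0' j))) kE mulr1 powRN.
  rewrite e0 e1 e2 e3 nE kE mulrCA -powRDp// -powRDp// !mulrDr -!powRDp//.
  have q1 := @pw j (- (2 * (r%:R * alpha)) + r%:R * alpha).
  have q2 := @pw j (- (2 * (r%:R * alpha)) + (2 * r%:R + (s%:R * - e + - s%:R))).
  have q3 := @pw j (- (2 * (r%:R * alpha)) + 2 * s%:R).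
  have {}q1 := q1 _; have {}q2 := q2 _; have {}q3 := q3 _.
  have -> : 3 * C * j.+1%:R ^- 2 = C * (j.+1%:R ^- 2) + C * (j.+1%:R ^- 2) + C * (j.+1%:R ^- 2) by ring.
  apply: lerD; first apply: lerD; rewrite ler_pM2l//.
  - by apply: q1; move: h1; lra.
  - by apply: q2; move: h2; lra.
  - by apply: q3; move: h3; lra.
have sumZ m : \sum_(0 <= j < m) Ex (fun w => Z j w ^+ 2) <= 3 * C * 2.
  apply: le_trans (ler_sum _ (fun j _ => Z2 j)) _.
  rewrite -mulr_sumr ler_pM2l ?mulr_gt0//.
  case: m => [|m]; first by rewrite big_geq.
  rewrite big_nat_recl//= expr1n invr1.
  by have := @sum_invsq_le R 0 m; rewrite invr1 => h; lra.
have aeZ := ae_cvg0 bZ sumZ.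
have aeD := approx_div_cvg_diversity alpha_gt0 alpha_lt1 theta_gt mU U01 indU momU.
have kinv : (k j)%:R^-1 @[j --> \oo] --> (0 : R).
  have h := @cvg_sub_pow R (fun n => n%:R^-1) s 0 s0 (@cvg_inv0 R).
  by move: h; rewrite -cvg_shiftS.
have kn : (k j)%:R / (n j)%:R `^ alpha @[j --> \oo] --> (0 : R).
  apply: (@squeeze_cvgr _ _ _ _ (fun=> 0) (fun j => j.+1%:R^-1)) (@cvg_invS R).
    apply: nearW => j; rewrite divr_ge0 ?(ltW (k0' j)) ?powR_ge0//=.
    rewrite -[X in X / _](powRr1 (ltW (k0' j))) kE nE mulr1 -powRN -powRDp//.
    rewrite -[j.+1%:R in leRHS](powRr1 (ltW (J0 j))) -powRN; apply: ler_powR; first by rewrite ler1n.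
    by move: h3; lra.
  exact: cvg_cst.
suff H w : Z j w @[j --> \oo] --> (0 : R) -> D_ k w @[k --> \oo] --> diversity alpha U w ->
    (num_distinct X n w)%:R / n%:R `^ alpha @[n --> \oo] --> diversity alpha U w.
  exact: (filterS2 _ H aeZ aeD).
move=> hZ hD.
have Dk : D_ (k j) w @[j --> \oo] --> diversity alpha U w.
  by have := @cvg_sub_pow R (fun k => D_ k w) s _ s0 hD; rewrite -cvg_shiftS.
have hg := hits_left_cvg alpha_gt0 alpha_lt1 theta_gt mU U01 momU n0 k0 (fun j => rest01 U01 (k j) w) kinv kn
  (diversity_ge0 alpha U w) Dk.
pose L := diversity alpha U w.
have hK : (num_distinct X (j ^ r)%N w)%:R / (j ^ r)%:R `^ alpha @[j --> \oo] --> L.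
  rewrite -cvg_shiftS.
  apply: (@cvg_ext _ (fun j => Z j w + g (n j) (k j) (V (k j) w) / (n j)%:R `^ alpha)).
    by move=> j; rewrite /Z -mulrDl subrK.
  by apply: (@cvgE _ _ (0 + L)); [exact: cvgD|rewrite add0r].
(* the number of distinct values is nondecreasing in the sample size; maxn only
   matters at 0, where y must be positive to be nonincreasing *)
pose y m : R := ((maxn m 1)%:R `^ alpha)^-1.
have m0 m : 0 < (maxn m 1)%:R :> R by rewrite ltr0n leq_max orbT.
have yE m : (0 < m)%N -> y m = (m%:R `^ alpha)^-1 by move=> m1; rewrite /y (maxn_idPl m1).
apply: (@cvg_ext_near _ (fun m => (num_distinct X m w)%:R * y m)).
  by exists 1%N => // m /= m1; rewrite yE.
have yr p q : (0 < p)%N -> (0 < q)%N -> y p = y q * (q%:R / p%:R) `^ alpha.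
  move=> p1 q1; have p2 : 0 < p%:R :> R by rewrite ltr0n.
  have q2 : 0 < q%:R :> R by rewrite ltr0n.
  rewrite !yE// powRM ?invr_ge0 ?(ltW p2) ?(ltW q2)// powRVp// mulKf// gt_eqF// powR_gt0//.
apply: (@cvg_interpolation _ _ y r) => //.
- apply/nondecreasing_seqP => m; rewrite ler_nat /num_distinct mkseqS.
  apply: uniq_leq_size; first exact: undup_uniq.
  by move=> v; rewrite !mem_undup mem_rcons in_cons => ->; rewrite orbT.
- move=> p q pq; rewrite /y lef_pV2 ?posrE ?powR_gt0//.
  rewrite ge0_ler_powR ?nnegrE ?(ltW alpha_gt0)// ler_nat.
  by rewrite geq_max !leq_max pq leqnn !orbT.
- by move=> m; rewrite invr_ge0 powR_ge0.
- have h := cvgMl1 hK (@cvg_ratio_pow R r alpha).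
  apply: cvg_ext_near h; exists 1%N => // j /= j1.
  have j2 : (0 < j ^ r)%N by rewrite expn_gt0 j1.
  have j3 : (0 < j.+1 ^ r)%N by rewrite expn_gt0.
  by rewrite (yr _ _ j3 j2) (yE _ j2) mulrA.
- have hK1 : (num_distinct X (j.+1 ^ r)%N w)%:R / (j.+1 ^ r)%:R `^ alpha @[j --> \oo] --> L.
    by move: hK; rewrite -cvg_shiftS.
  have h := cvgMl1 hK1 (cvg_inv1 (@cvg_ratio_pow R r alpha)).
  apply: cvg_ext_near h; exists 1%N => // j /= j1.
  have j2 : (0 < j ^ r)%N by rewrite expn_gt0 j1.
  have j3 : (0 < j.+1 ^ r)%N by rewrite expn_gt0.
  rewrite (yr _ _ j2 j3) (yE _ j3) mulrA; congr (_ * _).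
  by rewrite -powRVp ?divr_gt0 ?ltr0n ?expn_gt0 ?j1// invf_div.
Qed.

End diversity_of_samples.

(** * Conditional probabilities given the sticks *)

Section conditional_probabilities.
Context d (T : measurableType d) (R : realType) (P : probability T R).
Notation Ex := (Ex P).
Context (Y : nat -> T -> R) (mY : forall k, measurable_fun setT (Y k)).
Notation G := (sigma_seq Y).

Lemma sigma_seq_measurable B : G B -> measurable B.
Proof.
apply: smallest_sub; first exact: sigma_algebra_measurable.
by move=> _ [k _ [A mA <-]]; exact: mY.
Qed.

(* with this type, measurability in G is measurability of a function *)
Let S := g_sigma_algebraType (\bigcup_k preimage_set_system setT (Y k) measurable).

Let measurableGP (f : T -> R) :
  (forall B, measurable B -> G (f @^-1` B)) <-> measurable_fun (setT : set S) (f : S -> R).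
Proof.
split=> [h _ B mB|h B mB]; first by rewrite setTI; exact: h.
by have := h measurableT B mB; rewrite setTI.
Qed.

Lemma sigma_seq_sub (f g : T -> R) : (forall B, measurable B -> G (f @^-1` B)) ->
  (forall B, measurable B -> G (g @^-1` B)) ->
  forall B, measurable B -> G ((fun w => f w - g w) @^-1` B).
Proof. by move=> /measurableGP hf /measurableGP hg; apply/measurableGP; exact: measurable_funB. Qed.

Lemma sigma_seq_cst (c : R) B : G ((fun=> c) @^-1` B).
Proof.
have [cB|cB] := pselect (B c).
  rewrite (_ : _ @^-1` _ = setT); first exact: (@measurableT _ S).
  by apply/seteqP; split => w.
rewrite (_ : _ @^-1` _ = set0); first exact: (@measurable0 _ S).
by apply/seteqP; split => w.
Qed.

Lemma cond_prob_setT : is_cond_prob P G setT (fun=> 1).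
Proof.
split=> [B _||B GB]; first exact: sigma_seq_cst.
  by apply: bmf_integrable; exact: bmf_cst.
by rewrite integral_cst ?mul1e ?setTI//; exact: sigma_seq_measurable.
Qed.

Lemma cond_prob_setD (E F : set T) (e f : T -> R) : measurable E -> measurable F -> E `<=` F ->
  is_cond_prob P G E e -> is_cond_prob P G F f -> is_cond_prob P G (F `\` E) (fun w => f w - e w).
Proof.
move=> mE mF EF [Ge ie he] [Gf if_ hf]; split; first exact: sigma_seq_sub.
  exact: (integrableB measurableT if_ ie).
move=> B GB; have mB := sigma_seq_measurable GB.
have iBf : P.-integrable B (EFin \o f) by exact: integrableS if_.
have iBe : P.-integrable B (EFin \o e) by exact: integrableS ie.
under eq_integral do rewrite EFinB.
rewrite (integralB mB iBf iBe) he// hf//.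
have -> : (F `\` E) `&` B = (F `&` B) `\` (E `&` B).
  apply/seteqP; split => w /=; first by move=> [[h1 h2] h3]; split => // -[].
  by move=> [[h1 h2] h3]; split => //; split => // h4; apply: h3.
have mFB := measurableI _ _ mF mB; have mEB := measurableI _ _ mE mB.
have fin : (P (F `&` B) < +oo)%E by apply: le_lt_trans (probability_le1 _ mFB) _; rewrite ltry.
have -> := measureD mFB mEB fin.
congr (_ - P _)%E; apply/seteqP; split => w /=; last by move=> [].
by move=> [h1 h2]; split => //; split => //; exact: EF.
Qed.

Lemma cond_prob_Ex (E : set T) (f : T -> R) : measurable E -> is_cond_prob P G E f ->
  P E = (Ex f)%:E.
Proof.
move=> mE [_ if_ hf]; have GT : G setT by exact: (@measurableT _ S).
have := hf _ GT; rewrite setIT => <-.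
by rewrite /Ex /Rintegral fineK//; exact: integrable_fin_num.
Qed.

(** Functions of the conditioning variables may be taken out of the expectation. The
    conditional probability q and the variable Z behave well only almost surely;
    the primed versions, built from the clamped sticks, are bounded everywhere. *)
Lemma cond_prob_weighted (E : set T) (q q' Z Z' : T -> R) (h : R -> R) :
  measurable E -> is_cond_prob P G E q -> bmf q' -> (forall w, 0 <= q' w) ->
  {ae P, forall w, q w = q' w} ->
  (forall B, measurable B -> G (Z @^-1` B)) -> measurable_fun setT Z' -> (forall w, 0 <= Z' w <= 1) ->
  {ae P, forall w, Z w = Z' w} -> ubm h ->
  Ex (fun w => \1_E w * h (Z' w)) = Ex (fun w => q' w * h (Z' w)).
Proof.
move=> mE [Gq iq hq] bq' q'0 qq' GZ mZ' Z'01 ZZ' uh.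
have mq : measurable_fun setT q by apply/measurable_EFinP; exact: measurable_int iq.
apply: Ex_weighted => //; first exact: bmf_indic.
move=> A mA.
have mZA : measurable (Z @^-1` A) by apply: sigma_seq_measurable; exact: GZ.
have m1 : measurable_fun setT (\1_(Z @^-1` A) : T -> R) by exact: measurable_indic.
have m2 : measurable_fun setT (fun w => \1_A (Z' w) : R).
  by apply: (@measurableT_comp _ _ _ _ _ _ (\1_A : R -> R)) => //; exact: measurable_indic.
have i1 w : Z w = Z' w -> \1_A (Z' w) = \1_(Z @^-1` A) w :> R.
  by move=> <-; rewrite !indicE; congr ((_ : bool)%:R); apply/idP/idP; rewrite !inE.
transitivity (Ex (fun w => \1_(E `&` Z @^-1` A) w)).
  apply: Ex_ae; [apply: measurable_funM => //; exact: measurable_indic|exact/measurable_indic/measurableI|].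
  by apply: filterS ZZ' => w /i1 ->; rewrite indicI.
transitivity (Ex (fun w => q w * \1_(Z @^-1` A) w)); last first.
  apply: Ex_ae; [exact: measurable_funM|apply: measurable_funM => //; exact: bmf_measurable|].
  suff K w : q w = q' w -> Z w = Z' w -> q w * \1_(Z @^-1` A) w = q' w * \1_A (Z' w).
    exact: (filterS2 _ K qq' ZZ').
  by move=> -> /i1 ->.
have /(congr1 fine) := hq _ (GZ A mA).
rewrite -(Ex_indic P) //=; last exact: measurableI.
move=> <-; rewrite /Ex /Rintegral; congr fine.
rewrite [LHS]integral_mkcond; apply: eq_integral => w _.
by rewrite epatch_indic EFinM.
Qed.

End conditional_probabilities.

(** * The GEM sample *)

Section gem_sample.
Context (R : realType) d (T : measurableType d) (P : probability T R) (alpha theta : R).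
Context (H : nat -> {RV P >-> R}) (X : nat -> {RV P >-> nat}).
Context (alpha_gt0 : 0 < alpha) (alpha_lt1 : alpha < 1) (theta_gt : - alpha < theta).
Context (HX : GEM_sample P alpha theta H X).
Notation Ex := (Ex P).
Notation b := (stick_b alpha theta).
Notation G := (sigma_seq (stick H)).

Definition fraction i w : R := clamp (H i w).
Notation U := fraction.
Notation V := (rest U).

Lemma measurable_fraction i : measurable_fun setT (U i).
Proof. by apply: measurableT_comp => //; exact: measurable_clamp. Qed.

Lemma fraction01 i w : 0 <= U i w <= 1.
Proof. exact: clamp01. Qed.

Let b0 i : 0 < b i. Proof. exact: stick_b_gt0. Qed.
Let a1 : 0 < 1 - alpha. Proof. by rewrite subr_gt0. Qed.

Lemma independent_fractions k (f : nat -> R -> R) : (forall i, ubm (f i)) ->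
  Ex (fun w => \prod_(i < k) f i (U i w)) = \prod_(i < k) Ex (fun w => f i (U i w)).
Proof. by move=> uf; have [indH _ _ _ _] := HX; exact: (@independent_prod _ _ _ P H k f indH uf). Qed.

Lemma fraction_moments i (p q : R) : 0 <= p -> 0 <= q ->
  Ex (fun w => U i w `^ p * (1 - U i w) `^ q) =
  Beta_fun (1 - alpha + p) (b i + q) / Beta_fun (1 - alpha) (b i).
Proof.
move=> p0 q0; have [_ pdfH _ _ _] := HX.
apply: (@Ex_Beta _ _ _ P (H i) _ _ p q (fun x => clamp x `^ p * (1 - clamp x) `^ q)) => //.
- apply: measurable_funM.
    by apply: (measurableT_comp (f := fun x : R => x `^ p)); [exact: measurable_powR|exact: measurable_clamp].
  apply: (measurableT_comp (f := fun x : R => x `^ q)); first exact: measurable_powR.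
  by apply: measurable_funB => //; exact: measurable_clamp.
- by move=> x; rewrite mulr_ge0 ?powR_ge0.
- by move=> x /andP[x0 x1]; rewrite clampE// !ltW.
Qed.

Lemma fraction_ae : {ae P, forall w, forall i, H i w = U i w}.
Proof.
apply: ae_foralln => i; have [_ pdfH _ _ _] := HX.
apply: filterS (Beta_ae01 a1 (b0 i) (pdfH i)) => w /andP[h1 h2].
by rewrite /U clampE// !ltW.
Qed.

Lemma stick_ae : {ae P, forall w, forall k, stick H k w = 1 - V k w}.
Proof.
apply: filterS fraction_ae => w h k; rewrite /stick /rest; congr (_ - _).
by apply: eq_bigr => i _; rewrite h.
Qed.

Let m_stick k : measurable_fun setT (stick H k).
Proof.
apply: measurable_funB => //; elim: k => [|k ih].
  by under eq_fun do rewrite big_ord0; exact: measurable_cst.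
under eq_fun do rewrite big_ord_recr/=.
by apply: measurable_funM => //; exact: measurable_funB.
Qed.

Let mX j (A : set nat) : measurable (X j @^-1` A).
Proof. by rewrite -[X in measurable X]setTI; apply: measurable_funPT. Qed.

Lemma cond_prob_sample (A : set nat) (f : T -> R) (n : nat) :
  (forall j, is_cond_prob P G (X j @^-1` A) f) ->
  is_cond_prob P G [set w | forall i, (i < n)%N -> A (X i w)] (fun w => f w ^+ n).
Proof.
move=> hf; have [_ _ _ _ ci] := HX.
have := ci [fset i in iota 0 n]%fset (fun=> A) (fun=> f) (fun j _ => hf j).
set B := \bigcap_(i in _) _.
have -> : B = [set w | forall i, (i < n)%N -> A (X i w)].
  apply/seteqP; split => w /= h i; first by move=> i_n; apply: h; rewrite /= !inE mem_iota.
  by rewrite /= !inE mem_iota; exact: h.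
rewrite (_ : (fun w => \prod_(j <- [fset i in iota 0 n]%fset) f w) = (fun w => f w ^+ n))//.
apply/funext => w; transitivity (\prod_(j <- iota 0 n) f w).
  by apply: perm_big; rewrite uniq_perm ?iota_uniq ?fset_uniq// => j; rewrite !inE.
have -> : iota 0 n = index_iota 0 n by rewrite /index_iota subn0.
by rewrite prodr_const_nat subn0.
Qed.

Notation q_ l := (fun w => stick H l.+1 w - stick H l w).

Let cond_le j k : is_cond_prob P G (X j @^-1` [set v | (v <= k)%N]) (stick H k).
Proof. by have [_ _ _ h _] := HX; exact: h. Qed.

Let cond_eq j l : is_cond_prob P G (X j @^-1` [set l.+1]) (q_ l).
Proof.
have := cond_prob_setD m_stick (mX j [set v | (v <= l)%N]) (mX j [set v | (v <= l.+1)%N]) _ (cond_le j l) (cond_le j l.+1).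
rewrite (_ : _ `\` _ = X j @^-1` [set l.+1]); first by apply => w /=; exact: leqW.
apply/seteqP; split => w /=; first by move=> [h1 /negP h2]; apply/eqP; rewrite eqn_leq h1 ltnNge.
by move=> ->; split => //; rewrite ltnn.
Qed.

Let cond_ne j l : is_cond_prob P G (X j @^-1` [set v | v != l.+1]) (fun w => 1 - q_ l w).
Proof.
have := cond_prob_setD m_stick (mX j [set l.+1]) measurableT (@subsetT _ _) (cond_eq j l) (cond_prob_setT P m_stick).
rewrite (_ : _ `\` _ = X j @^-1` [set v | v != l.+1])//.
by apply/seteqP; split => w /=; [move=> [_ /eqP]|move=> /eqP].
Qed.

Let cond_ne2 j l m : l != m ->
  is_cond_prob P G (X j @^-1` [set v | (v != l.+1) && (v != m.+1)]) (fun w => 1 - q_ l w - q_ m w).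
Proof.
move=> lm; have := cond_prob_setD m_stick (mX j [set m.+1]) (mX j [set v | v != l.+1]) _ (cond_eq j m) (cond_ne j l).
rewrite (_ : _ `\` _ = X j @^-1` [set v | (v != l.+1) && (v != m.+1)]).
  by apply => w /= ->; rewrite eqSS eq_sym.
by apply/seteqP; split => w /=; [move=> [-> /eqP]|move=> /andP[-> /eqP]].
Qed.

Let meas_all (A : set nat) n : measurable [set w | forall i, (i < n)%N -> A (X i w)].
Proof.
rewrite (_ : [set w | _] = \bigcap_(i in `I_n) (X i @^-1` A)).
  by apply: fin_bigcap_measurable => //; exact: finite_II.
by apply/seteqP; split.
Qed.

Let all_indic (A : pred nat) n w :
  \1_[set w | forall i, (i < n)%N -> A (X i w)] w = \prod_(i < n) (A (X i w))%:R :> R.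
Proof.
elim: n => [|n ih]; first by rewrite big_ord0 indicE mem_set.
rewrite big_ord_recr/= -ih !indicE -natrM mulnb; congr ((_ : bool)%:R).
apply/idP/andP; rewrite !inE /=.
  by move=> h; split; [move=> i i_n; apply: h; exact: ltnW|exact: h].
by move=> [h1 h2] i; rewrite ltnS leq_eqVlt => /predU1P[->//|]; exact: h1.
Qed.

Let missE n j w : miss R X n j w = \1_[set w | forall i, (i < n)%N -> X i w != j.+1] w.
Proof. by rewrite (all_indic (fun v => v != j.+1)). Qed.

Lemma bmf_miss_sample n j : bmf (miss R X n j).
Proof.
have -> : miss R X n j = \1_[set w | forall i, (i < n)%N -> X i w != j.+1].
  by apply/funext => w; exact: missE.
by apply: bmf_indic; exact: (meas_all [set v | v != j.+1]).
Qed.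

Notation p_ j w := (V j w * U j w).

Let q_ae : {ae P, forall w, forall l, q_ l w = p_ l w}.
Proof. by apply: filterS stick_ae => w h l; rewrite !h restS; ring. Qed.

Let p01 j w : 0 <= 1 - p_ j w <= 1.
Proof.
have /andP[h1 h2] := rest01 fraction01 j w; have /andP[h3 h4] := fraction01 j w.
by rewrite subr_ge0 gerBl mulr_ge0// mulr_ile1.
Qed.

Let bmf_p j : bmf (fun w => 1 - p_ j w).
Proof.
apply: bmf_unit; last exact: p01.
apply: measurable_funB => //; apply: measurable_funM; last exact: measurable_fraction.
exact: (bmf_measurable (span_bmf measurable_fraction fraction01 (span_rest_nat fraction01 j))).
Qed.

(** The hypotheses on the sample under which the diversity was computed are checked
    here, from conditional independence given the sticks. *)
Lemma miss_moment n j (h : R -> R) l : ubm h ->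
  Ex (fun w => miss R X n j w * h (1 - p_ l w)) = Ex (fun w => (1 - p_ j w) ^+ n * h (1 - p_ l w)).
Proof.
move=> uh; under Ex_ext do rewrite missE.
have [G1 _ _] := cond_ne 0 l.
apply: (cond_prob_weighted m_stick (meas_all [set v | v != j.+1] n)
  (cond_prob_sample n (fun i => cond_ne i j)) _ _ _ G1 _ _ _ uh).
- exact: bmfX.
- by move=> w; rewrite exprn_ge0//; have /andP[] := p01 j w.
- by apply: filterS q_ae => w ->.
- exact: (bmf_measurable (bmf_p l)).
- by move=> w; exact: p01.
- by apply: filterS q_ae => w ->.
Qed.

Lemma miss_pair n j l : j != l -> Ex (fun w => miss R X n j w * miss R X n l w) =
  Ex (fun w => (1 - p_ j w - p_ l w) ^+ n).
Proof.
move=> jl; pose A v := (v != j.+1) && (v != l.+1).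
have E w : miss R X n j w * miss R X n l w = \1_[set w | forall i, (i < n)%N -> A (X i w)] w.
  rewrite all_indic /miss -big_split/=; apply: eq_bigr => i _.
  by rewrite -natrM mulnb.
under Ex_ext do rewrite E.
have mA := meas_all [set v | A v] n.
have c := cond_prob_sample n (fun i => cond_ne2 i jl).
have := cond_prob_Ex mA c; rewrite -Ex_indic// => -[->].
have [_ ic _] := c.
apply: Ex_ae; first by apply/measurable_EFinP; exact: measurable_int ic.
  apply: measurable_funX; apply: measurable_funB; first exact: (bmf_measurable (bmf_p j)).
  have := bmf_measurable (bmfB (bmf_cst T (1 : R)) (bmf_p l)).
  by under eq_fun do rewrite opprB addrC subrK.
by apply: filterS q_ae => w h; rewrite !h.
Qed.

(** The maximum is at most k when all the members are, and each is so with conditional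
    probability 1 - V_k. *)
Lemma sample_max_law n k : P [set w | (sample_max X n w <= k)%N] = (Ex (fun w => (1 - V k w) ^+ n))%:E.
Proof.
have -> : [set w | (sample_max X n w <= k)%N] = [set w | forall i, (i < n)%N -> (X i w <= k)%N].
  apply/seteqP; split => w /=.
    by move=> /bigmax_leqP h i i_n; exact: (h (Ordinal i_n)).
  by move=> h; apply/bigmax_leqP => i _; exact: h.
have c := cond_prob_sample n (fun i => cond_le i k).
rewrite (cond_prob_Ex (meas_all [set v | (v <= k)%N] n) c); congr EFin.
have [_ ic _] := c.
apply: Ex_ae; first by apply/measurable_EFinP; exact: measurable_int ic.
  apply: measurable_funX; apply: measurable_funB => //.
  exact: (bmf_measurable (span_bmf measurable_fraction fraction01 (span_rest_nat fraction01 k))).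
by apply: filterS stick_ae => w h; rewrite h.
Qed.

Notation D := (diversity alpha U).
Let e : R := (1 - alpha) / alpha.
Let e_gt0 : 0 < e. Proof. by rewrite divr_gt0. Qed.

Lemma cvg_onem_exp (y : nat -> R) (c : R) : (forall n, 0 <= y n) -> y n @[n --> \oo] --> (0 : R) ->
  n%:R * y n @[n --> \oo] --> c -> (1 - y n) ^+ n @[n --> \oo] --> expR (- c).
Proof.
move=> y0 yn0 ny.
have up : expR (- (n%:R * y n)) @[n --> \oo] --> expR (- c).
  by apply: continuous_cvg; [exact: continuous_expR|exact: cvgN].
have low : expR (- (n%:R * y n * (1 - y n)^-1)) @[n --> \oo] --> expR (- c).
  apply: continuous_cvg; first exact: continuous_expR.
  apply: cvgN; apply: cvgMl1 => //; apply: cvg_inv1.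
  by apply: (@cvgE _ _ (1 - 0)); [apply: cvgB => //; exact: cvg_cst|rewrite subr0].
apply: squeeze_cvgr low up.
move/cvgrPdist_lt : yn0 => /(_ 1 ltr01); apply: filterS => n.
rewrite sub0r normrN ger0_norm// => y1.
have z0 : 0 < 1 - y n by rewrite subr_gt0.
have nE (x : R) : expR (- (n%:R * x)) = expR (- x) ^+ n by rewrite -expRM_natl mulrN mulr_natl.
apply/andP; split; last first.
  by rewrite nE; apply: lerXn2r; rewrite ?nnegrE ?expR_ge0 ?(ltW z0)//; exact: expR_ge1Dx.
rewrite -mulrA nE; apply: lerXn2r; rewrite ?nnegrE ?expR_ge0 ?(ltW z0)//.
rewrite expRN -[leRHS]invrK lef_pV2 ?posrE ?invr_gt0 ?expR_gt0//.
apply: le_trans (expR_ge1Dx _); rewrite le_eqVlt; apply/orP; left; apply/eqP.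
by field; rewrite gt_eqF.
Qed.

(** At this index the rest V_k is of order 1 / n, so that (1 - V_k) ^ n has a
    nontrivial limit. *)
Let threshold (x : R) n := Num.truncn (x * n%:R `^ (alpha / (1 - alpha))).

Let threshold_ratio x : 0 < x -> (threshold x n)%:R * n%:R^-1 `^ (alpha / (1 - alpha)) @[n --> \oo] --> x.
Proof.
move=> x0; set p := alpha / (1 - alpha); have p0 : 0 < p by rewrite divr_gt0.
have low : x - n%:R^-1 `^ p @[n --> \oo] --> x.
  apply: (@cvgE _ _ (x - 0)); last by rewrite subr0.
  apply: cvgB; first exact: cvg_cst.
  apply: (cvgE (cvg_powR_ge0 p0 _ (lexx 0) (@cvg_inv0 R))); last by rewrite powR0// gt_eqF.
  by move=> n; rewrite invr_ge0.
apply: squeeze_cvgr low (cvg_cst x); exists 1%N => // n /= n1.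
have n0 : 0 < n%:R :> R by rewrite ltr0n.
have np := powR_gt0 p n0.
have xn : 0 <= x * n%:R `^ p by rewrite mulr_ge0 ?powR_ge0// ltW.
have h1 : (threshold x n)%:R <= x * n%:R `^ p by rewrite truncn_le.
have h2 : x * n%:R `^ p < (threshold x n)%:R + 1 by rewrite natr1 truncnS_gt.
rewrite powRVp//; apply/andP; split.
  by rewrite ler_pdivlMr// mulrBl mulVf ?gt_eqF//; move: h2; lra.
by rewrite ler_pdivrMr.
Qed.

Let threshold_cvg x : 0 < x -> threshold x n @[n --> \oo] --> \oo.
Proof.
move=> x0 A [N _ NA]; set p := alpha / (1 - alpha); have p0 : 0 < p by rewrite divr_gt0.
exists (Num.truncn ((N%:R / x) `^ p^-1)).+1 => // n /= hn; apply: NA => /=.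
have h1 : (N%:R / x) `^ p^-1 <= n%:R.
  by apply: le_trans (ltW (truncnS_gt _)) _; rewrite ler_nat.
have h2 : N%:R / x <= n%:R `^ p.
  have -> : N%:R / x = ((N%:R / x) `^ p^-1) `^ p.
    by rewrite -powRrM mulVf ?gt_eqF// powRr1// divr_ge0// ltW.
  by rewrite ge0_ler_powR ?nnegrE ?powR_ge0 ?(ltW p0).
rewrite /threshold truncn_ge_nat ?mulr_ge0 ?powR_ge0 ?(ltW x0)//.
by rewrite mulrC -ler_pdivrMr.
Qed.

Let cvg_threshold (u : nat -> R) (l x : R) : 0 < x -> u k @[k --> \oo] --> l ->
  u (threshold x n) @[n --> \oo] --> l.
Proof. by move=> x0 ul; apply: (cvg_comp _ _ (threshold_cvg x0) ul). Qed.

(** Inverting the normalisation, V_k ~ alpha D `^ (1 / alpha) k `^ (- (1 - alpha) / alpha)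
    almost surely; at the threshold n V_k tends to the exponent in the limit, and
    bounded convergence concludes. *)
Lemma sample_max_cvg (x : R) : 0 < x ->
  P [set w | (sample_max X n w)%:R <= x * n%:R `^ (alpha / (1 - alpha))] @[n --> \oo] -->
  (\int[P]_w (expR (- alpha * D w `^ alpha^-1 * x `^ (- e)))%:E)%E.
Proof.
move=> x0; set p := alpha / (1 - alpha); have p0 : 0 < p by rewrite divr_gt0.
have mD := measurable_diversity alpha_gt0 measurable_fraction fraction01.
have bL : bmf (fun w => expR (- alpha * D w `^ alpha^-1 * x `^ (- e))).
  apply: bmf_unit => [|w].
    apply: measurableT_comp => //; apply: measurable_funM => //; apply: measurable_funM => //.
    by apply: (measurableT_comp (f := fun y : R => y `^ alpha^-1)) => //; exact: measurable_powR.
  by rewrite expR_ge0 -expR0 ler_expR !mulNr oppr_le0 !mulr_ge0 ?powR_ge0// ltW.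
rewrite ExE//.
have law n : P [set w | (sample_max X n w)%:R <= x * n%:R `^ p] = (Ex (fun w => (1 - V (threshold x n) w) ^+ n))%:E.
  rewrite -sample_max_law; congr (P _); apply/seteqP; split => w /=;
    by rewrite /threshold truncn_ge_nat// mulr_ge0 ?powR_ge0// ltW.
under eq_fun do rewrite law.
apply: cvg_EFin; first exact: nearW.
have V0 k w : 0 <= V k w by have /andP[] := rest01 fraction01 k w.
have V1 k w : V k w <= 1 by have /andP[] := rest01 fraction01 k w.
apply: (@Ex_cvg _ _ _ P _ _ 1).
- move=> n; apply: measurable_funX; apply: measurable_funB => //.
  exact: (bmf_measurable (span_bmf measurable_fraction fraction01 (span_rest_nat fraction01 _))).
- exact: bmf_measurable.
- by move=> n w; rewrite ger0_norm ?exprn_ge0 ?subr_ge0// exprn_ile1 ?subr_ge0 ?gerBl.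
have aeD := approx_div_cvg_diversity alpha_gt0 alpha_lt1 theta_gt measurable_fraction fraction01
  independent_fractions fraction_moments.
apply: filterS aeD => w hD.
have ia : 0 < alpha^-1 by rewrite invr_gt0.
have hDa : approx_div alpha U k w `^ alpha^-1 @[k --> \oo] --> D w `^ alpha^-1.
  by apply: cvg_powR_ge0 => //; [move=> k; exact: approx_div_ge0|exact: diversity_ge0].
have VE k : (0 < k)%N -> V k w = alpha * approx_div alpha U k w `^ alpha^-1 * k%:R^-1 `^ e.
  move=> k0; have k0' : 0 < k%:R :> R by rewrite ltr0n.
  rewrite /approx_div !powRM ?mulr_ge0 ?powR_ge0// -!powRrM mulfV ?gt_eqF// powRr1//.
  rewrite mulNr mulfV ?gt_eqF// powRN powRr1 ?(ltW alpha_gt0)// powRVp//.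
  have -> : (1 - alpha) * alpha^-1 = e by [].
  by have := powR_gt0 e k0'; move: (_ `^ e) => z z0; field; rewrite !gt_eqF.
have Vcvg : V k w @[k --> \oo] --> (0 : R).
  apply: (@cvg_ext_near _ (fun k => alpha * approx_div alpha U k w `^ alpha^-1 * k%:R^-1 `^ e)).
    by exists 1%N => // k /= k0; rewrite -VE.
  have h : (k%:R^-1 : R) `^ e @[k --> \oo] --> (0 : R).
    apply: (cvgE (cvg_powR_ge0 e_gt0 _ (lexx 0) (@cvg_inv0 R))); last by rewrite powR0// gt_eqF.
    by move=> k; rewrite invr_ge0.
  by have := cvg_mul (cvg_scale (c := alpha) hDa) h; rewrite mulr0.
have -> : - alpha * D w `^ alpha^-1 * x `^ (- e) = - (alpha * D w `^ alpha^-1 * x `^ (- e)) by ring.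
apply: (@cvg_onem_exp (fun n => V (threshold x n) w)) => //.
  exact: (cvg_threshold x0 Vcvg).
have hr := cvg_powR (p := - e) x0 (threshold_ratio x0).
have := cvg_mul (cvg_scale (c := alpha) (cvg_threshold x0 hDa)) hr.
apply: cvg_ext_near.
have [N _ hN] : \forall n \near \oo, (0 < threshold x n)%N.
  have h : \forall k \near \oo, (0 < k)%N by exists 1%N.
  exact: (threshold_cvg x0 h).
exists (maxn N 1) => // n /=; rewrite geq_max => /andP[/hN /= k0 n1].
have k0' : 0 < (threshold x n)%:R :> R by rewrite ltr0n.
have n0 : 0 < n%:R :> R by rewrite ltr0n.
rewrite (VE _ k0) powRM ?powR_ge0// powRVp// -powRN -powRrM !powRVp// -?powRrM.
have -> : - p * - e = 1 by rewrite /p /e; field; rewrite !gt_eqF.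
rewrite powRr1 ?(ltW n0)// powRN.
by ring.
Qed.

End gem_sample.

Theorem theorem3 (R : realType) (d : measure_display) (T : measurableType d)
    (P : probability T R) (alpha theta : R)
    (H : nat -> {RV P >-> R}) (X : nat -> {RV P >-> nat})
    (alpha_gt0 : 0 < alpha) (alpha_lt1 : alpha < 1) (theta_gt : - alpha < theta)
    (HX : GEM_sample P alpha theta H X) :
  exists D : {RV P >-> R},
    [/\ alpha_diversity P alpha X D,
        {ae P, forall w, 0 < D w},
        forall p : R, 0 < p ->
          ('E_P[(fun w => D w `^ p)%R] =
           (Gamma_fun (theta + 1) / Gamma_fun (theta / alpha + 1) *
            (Gamma_fun (p + theta / alpha + 1) /
             Gamma_fun (p * alpha + theta + 1)))%:E)%E,
        determined_by_moments (distribution P D) &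
        forall x : R, 0 < x ->
          P [set w | (sample_max X n w)%:R <= x * n%:R `^ (alpha / (1 - alpha))]
            @[n --> \oo] -->
          ('E_P[(fun w => expR (- alpha * D w `^ alpha^-1 *
                               x `^ (- ((1 - alpha) / alpha))))%R])%E].
Proof.
have mU := @measurable_fraction R d T P H; have U01 := @fraction01 R d T P H.
have indU := independent_fractions HX.
have momU := fraction_moments alpha_gt0 alpha_lt1 theta_gt HX.
have mD := measurable_diversity alpha_gt0 mU U01.
have momD := diversity_momentE alpha_gt0 alpha_lt1 theta_gt mU U01 indU momU.
have posD := diversity_gt0 alpha_gt0 alpha_lt1 theta_gt mU U01 indU momU.
have X_gt0 : forall i w, (0 < X i w)%N by have [_ _ h _ _] := HX.
have missE := miss_moment alpha_gt0 alpha_lt1 theta_gt HX.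
pose D : {RV P >-> R} :=
  HB.pack (diversity alpha (fraction H)) (isMeasurableFun.Build _ _ T R _ mD).
exists D; split => //.
- apply: (num_distinct_ae_cvg alpha_gt0 alpha_lt1 theta_gt mU U01 indU momU X_gt0).
  + exact: bmf_miss_sample.
  + move=> n j; have := missE n j (fun=> 1) 0%N (ubm_cst ler01).
    by under Ex_ext do rewrite mulr1; under [RHS]Ex_ext do rewrite mulr1.
  + by move=> n j l; exact: (missE n j _ l (ubm_exp n ubm_id)).
  + exact: (miss_pair alpha_gt0 alpha_lt1 theta_gt HX).
- by move=> p p0; rewrite unlock; exact: momD.
- apply: (diversity_law_determined alpha_gt0 alpha_lt1 theta_gt).
    have mpos : measurable (D @^-1` [set x | 0 < x]).
      rewrite -[X in measurable X]setTI; apply: (mD measurableT).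
      rewrite (_ : [set x : R | 0 < x] = `]0, +oo[%classic)//.
      by apply/seteqP; split => x /=; rewrite in_itv/= andbT.
    have [N [mN N0 hN]] := posD.
    have null : P (~` (D @^-1` [set x | 0 < x])) = 0%E.
      by apply: (subset_measure0 _ mN hN N0); exact: measurableC.
    have := @probability_setC _ _ _ P _ (measurableC mpos).
    by rewrite setCK null sube0.
  move=> p p0; rewrite ge0_integral_distribution//=; first exact: momD.
  + by apply/measurable_EFinP; exact: measurable_powR.
  + by move=> y; rewrite lee_fin powR_ge0.
- by move=> x x0; rewrite unlock; exact: (sample_max_cvg alpha_gt0 alpha_lt1 theta_gt HX).
Qed.
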